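(* Let $B>0$, $0<r\le2$, $0<\eta<1$, $\gamma=\frac{1-\eta}{4\eta}$, and let $(Y_\ell,\Phi_\ell)$, $\ell=1,\dots,n$, be i.i.d. data from the noisy homodyne model described in the context. Let $\widehat W_h^{\eta,*}$ be the truncated kernel estimator defined in the context with parameters $h$ and $s_n$ specified below. Then there is a constant $C>0$ such that $$\limsup_{n\to\infty}\ \sup_{\rho\in\mathcal R(B,r)}E\left[\left\|\widehat W_h^{\eta,*}-W_\rho\right\|_2^2\right]\varphi_n^{-2}\le C$$ holds with the following choices. (i) For $r=2$, with $\beta=\frac{B}{(1+\sqrt B)^2}$: $$\varphi_n^2=(\log n)^{\frac{16\gamma+3\beta}{8\gamma+2\beta}}\,n^{-\frac{\beta}{4\gamma+\beta}},$$ with $s_n=h^{-1}$ and $h=\left(\frac{2}{4\gamma+\beta}\log n+\frac{1}{4\gamma+\beta}\log(\log n)\right)^{-1/2}$. (ii) For $0<r<2$ and any $0<\beta<B$: $$\varphi_n^2=h^{3r-10}\exp\left(-\frac{2^{1-r}\beta}{h^r}\right),$$ where $s_n=1/h$ and $h$ is the solution of the equation $$\frac{2^{1-r}\beta}{h^r}+\frac{2\gamma}{h^2}=\log n-(\log\log n)^2.$$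
   Context: Notation: $\mathbb N=\{0,1,2,\dots\}$. Fock basis of $L^2(\mathbb R)$: $h_m(x)=(2^m m!\sqrt\pi)^{-1/2}H_m(x)e^{-x^2/2}$, $H_m(x)=(-1)^m e^{x^2}\frac{d^m}{dx^m}e^{-x^2}$. A quantum state is a selfadjoint, positive, trace-one operator $\rho$ on $L^2(\mathbb R)$, identified with its density matrix $\rho_{m,n}=\langle h_m,\rho h_n\rangle$, $m,n\in\mathbb N$. The class is $$\mathcal R(B,r)=\{\rho\text{ quantum state}: |\rho_{m,n}|\le e^{-B(m+n)^{r/2}}\ \text{for all } m,n\in\mathbb N\}.$$ Wigner function: $W_\rho(q,p)=\sum_{m,n}\rho_{m,n}W_{m,n}(q,p)$ with $W_{m,n}(q,p)=\frac1\pi\int e^{2ipx}h_m(q-x)h_n(q+x)\,dx$. Radon transform: $p_\rho(x,\phi)=\int_{-\infty}^{\infty}W_\rho(x\cos\phi-t\sin\phi,\,x\sin\phi+t\cos\phi)\,dt$; for each $\phi$, $p_\rho(\cdot,\phi)$ is a probability density. Model: $(X_\ell,\Phi_\ell)$, $\ell=1,\dots,n$, are i.i.d. in $\mathbb R\times[0,\pi]$ with density $p_\rho(x,\phi)$ with respect to $\frac1\pi\times$Lebesgue measure. One observes $(Y_\ell,\Phi_\ell)$ with $Y_\ell=\sqrt\eta X_\ell+\sqrt{(1-\eta)/2}\,\xi_\ell$, $\xi_\ell$ i.i.d. standard Gaussian independent of all $(X_j,\Phi_j)$, $\eta$ known. $E$ is expectation when the true state is $\rho$. Estimator: let $\widetilde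 N^\eta(t)=e^{-(1-\eta)t^2/4}$ be the Fourier transform of the centered Gaussian density of variance $(1-\eta)/2$. For $h>0$ (tending to $0$ as $n\to\infty$) put $$K_h^\eta(u)=\frac1{4\pi}\int_{-1/h}^{1/h}\frac{e^{-iut}|t|}{\widetilde N^\eta(t/\sqrt\eta)}\,dt,\qquad \widehat W_h^\eta(q,p)=\frac{1}{n}\sum_{\ell=1}^n K_h^\eta\!\left(q\cos\Phi_\ell+p\sin\Phi_\ell-\frac{Y_\ell}{\sqrt\eta}\right),$$ and, for $s_n>0$ tending to infinity, $\widehat W_h^{\eta,*}(z)=\widehat W_h^\eta(z)\,\mathbf 1(\|z\|\le s_n)$, $z=(q,p)\in\mathbb R^2$. $\|\cdot\|_2$ is the $L^2(\mathbb R^2)$ norm. *)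

(* Defs.v *)
From HB Require Import structures.
From mathcomp Require Export all_boot all_order all_algebra.
From mathcomp Require Export complex.
From mathcomp Require Export all_classical all_reals all_analysis.

Set Implicit Arguments.
Unset Strict Implicit.
Unset Printing Implicit Defensive.

Import Order.TTheory GRing.Theory Num.Theory.
Import numFieldNormedType.Exports.

Local Open Scope classical_set_scope.
Local Open Scope ring_scope.
Local Open Scope complex_scope.

Section Homodyne.
Context {R : realType}.

Local Notation leb := (@lebesgue_measure R).
Local Notation leb2 := (@lebesgue_measure R \x @lebesgue_measure R)%E.

Definition cexpi (x : R) : R[i] := cos x +i* sin x.

Definition cintegral (D : set R) (f : R -> R[i]) : R[i] :=
  (\int[leb]_(x in D) complex.Re (f x)) +i* (\int[leb]_(x in D) complex.Im (f x)).

(* L^2(R) = L^2(R; C). Its elements are represented by functions, two of them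
   being identified when they are equal almost everywhere. *)
Definition L2C (f : R -> R[i]) : Prop :=
  [/\ measurable_fun setT (fun x => complex.Re (f x)),
      measurable_fun setT (fun x => complex.Im (f x)) &
      (\int[leb]_x (complex.Re (f x) ^+ 2 + complex.Im (f x) ^+ 2)%:E < +oo)%E].

(* Antilinear in the first argument. *)
Definition inner (f g : R -> R[i]) : R[i] :=
  cintegral setT (fun x => (f x)^* * g x).

Definition hermite (m : nat) (x : R) : R :=
  (-1) ^+ m * expR (x ^+ 2) * (fun y : R => expR (- y ^+ 2))^`(m)%classic x.

Definition fock (m : nat) (x : R) : R :=
  (Num.sqrt (2 ^+ m * m`!%:R * Num.sqrt pi))^-1
    * hermite m x * expR (- (x ^+ 2 / 2)).

Definition fockC (m : nat) (x : R) : R[i] := (fock m x)%:C.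

Definition density_matrix (T : (R -> R[i]) -> (R -> R[i])) (m n : nat)
  : R[i] := inner (fockC m) (T (fockC n)).

(* Everywhere defined bounded selfadjoint operators that are positive and have
   trace one. The trace of a positive operator is the sum of its diagonal in
   any orthonormal basis, here the Fock basis; the diagonal is real by
   positivity, as 0 <= z in R[i] means that z is real and nonnegative. *)
Record quantum_state (T : (R -> R[i]) -> (R -> R[i])) : Prop := {
  qs_L2 : forall f, L2C f -> L2C (T f) ;
  qs_ae : forall f g, L2C f -> L2C g ->
    {ae leb, forall x, f x = g x} -> {ae leb, forall x, T f x = T g x} ;
  qs_linear : forall (a : R[i]) f g, L2C f -> L2C g ->
    {ae leb, forall x, T (fun y => a * f y + g y) x = a * T f x + T g x} ;
  qs_bounded : exists c : R, forall f, L2C f ->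
    complex.Re (inner (T f) (T f)) <= c * complex.Re (inner f f) ;
  qs_selfadjoint : forall f g, L2C f -> L2C g ->
    inner f (T g) = inner (T f) g ;
  qs_positive : forall f, L2C f -> 0 <= inner f (T f) ;
  qs_trace : (fun N : nat => \sum_(m < N) complex.Re (density_matrix T m m))
    @ \oo --> (1 : R)
}.

Definition class_R (B r : R) (T : (R -> R[i]) -> (R -> R[i])) : Prop :=
  quantum_state T /\
  forall m n : nat,
    `|density_matrix T m n| <= (expR (- (B * (m + n)%:R `^ (r / 2))))%:C.

Definition wigner_mn (m n : nat) (q p : R) : R[i] :=
  (pi^-1)%:C *
  cintegral setT (fun x => cexpi (2 * p * x) * (fock m (q - x) * fock n (q + x))%:C).

(* The double series is the limit of its square partial sums; it converges
   absolutely for states in class_R. The square partial sums are real since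
   rho_{n,m} and W_{n,m} are the conjugates of rho_{m,n} and W_{m,n}. *)
Definition wigner (T : (R -> R[i]) -> (R -> R[i])) (q p : R) : R :=
  limn (fun N : nat => complex.Re (\sum_(m < N) \sum_(n < N)
    density_matrix T m n * wigner_mn m n q p)).

Definition radon_wigner (T : (R -> R[i]) -> (R -> R[i])) (x phi : R) : R :=
  \int[leb]_t wigner T (x * cos phi - t * sin phi) (x * sin phi + t * cos phi).

(* hs_indep is mutual independence of the 2n random elements
   (X_l, Phi_l), xi_l, l < n; subfamilies are covered by taking full sets. *)
Record homodyne_sample (T : (R -> R[i]) -> (R -> R[i])) (n : nat)
    (d : measure_display) (Omega : measurableType d) (P : probability Omega R)
    (X Phi xi : 'I_n -> {RV P >-> R}) : Prop := {
  hs_law : forall (l : 'I_n) (A : set (R * R)), measurable A ->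
    P [set w | A (X l w, Phi l w)] =
    (\int[leb2]_(z in A `&` [set z | (0 <= z.2 <= pi)%R])
       (pi^-1 * radon_wigner T z.1 z.2)%:E)%E ;
  hs_gauss : forall (l : 'I_n) (A : set R), measurable A ->
    P (xi l @^-1` A) = normal_prob 0 1 A ;
  hs_indep : forall (A : 'I_n -> set (R * R)) (D : 'I_n -> set R),
    (forall l, measurable (A l)) -> (forall l, measurable (D l)) ->
    P [set w | forall l, A l (X l w, Phi l w) /\ D l (xi l w)] =
    (\prod_(l < n) (P [set w | A l (X l w, Phi l w)] * P (xi l @^-1` D l)))%E
}.

Definition noisy_obs (eta x xi : R) : R :=
  Num.sqrt eta * x + Num.sqrt ((1 - eta) / 2) * xi.

Definition noise_ft (eta t : R) : R := expR (- ((1 - eta) * t ^+ 2 / 4)).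

(* The integral is real: the imaginary part of the integrand is odd. *)
Definition kernelK (eta h u : R) : R :=
  complex.Re (((4 * pi)^-1)%:C *
      cintegral `[- h^-1, h^-1]
        (fun t => cexpi (- (u * t)) *
                  (`|t| / noise_ft eta (t / Num.sqrt eta))%:C)).

Definition estimator (eta h : R) (n : nat) (Y Phi : 'I_n -> R) (q p : R) : R :=
  n%:R^-1 * \sum_(l < n)
    kernelK eta h (q * cos (Phi l) + p * sin (Phi l) - Y l / Num.sqrt eta).

Definition trunc_estimator (eta h s : R) (n : nat) (Y Phi : 'I_n -> R)
    (z : R * R) : R :=
  if Num.sqrt (z.1 ^+ 2 + z.2 ^+ 2) <= s then estimator eta h Y Phi z.1 z.2
  else 0.

Definition mise (T : (R -> R[i]) -> (R -> R[i])) (eta h s : R) (n : nat)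
    (d : measure_display) (Omega : measurableType d) (P : probability Omega R)
    (X Phi xi : 'I_n -> {RV P >-> R}) : \bar R :=
  (\int[P]_w
     (Lnorm leb2 2%:E (fun z =>
        (trunc_estimator eta h s
           (fun l => noisy_obs eta (X l w) (xi l w)) (fun l => Phi l w) z
         - wigner T z.1 z.2)%:E) ^+ 2))%E.

(* The mean integrated squared error only depends on the law of the data, so
   that also ranging over all realizations of the model does not change the
   supremum over the states. *)
Definition maximal_risk (B r eta h s : R) (n : nat) : \bar R :=
  ereal_sup [set x : \bar R |
    exists T : (R -> R[i]) -> (R -> R[i]), class_R B r T /\
    exists (d : measure_display) (Omega : measurableType d)
      (P : probability Omega R) (X Phi xi : 'I_n -> {RV P >-> R}),
      homodyne_sample T X Phi xi /\ x = mise T eta h s X Phi xi].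

End Homodyne.

(* Main.v *)
(* Dividing by the Fourier transform of the noise cancels the noise in
   expectation, so that the estimator at (q, p) has mean
     1/(4 pi^2) int_0^(1/h) t T(t) dt,  T(t) = sum_(m, n) rho_mn c_mn(t) A_mn(t),
   where c_mn is the Fourier transform of h_m h_n and A_mn(t) is the integral of
   e^(i (n - m) phi - i t (q cos phi + p sin phi)) over the circle.  Fourier
   inversion says that W_rho(q, p) is the same integral over [0, +oo[.  It is
   proved for each W_mn separately: both sides satisfy the same recurrences in
   m and n, and for m = n = 0 the dilations of the integral solve a linear
   differential equation.  The bias is thus the tail t > 1/h.

   Moving the line of integration of c_mn into the complex plane, and bounding
   the Laguerre polynomials that come out, yields
     |c_mn(t)| <= 2 exp(u (m + n) - (t/2)^2 u / (1 + u))  for every u > 0.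
   Choosing u as a function of m + n and t, the decay of rho_mn gives
     |rho_mn c_mn(t)| <= D w_m w_n exp(- b (t/2)^r),  w summable,
   for every b < B if r < 2, and for every b < B / (1 + B) if r = 2.  In both
   cases b may be taken larger than beta.  The same bound controls W_rho outside
   the disc of radius 1/h.  Each kernel value is at most C e^(gamma/h^2), so
   that the variance is at most C e^(2 gamma/h^2) / n, and integrating over the
   disc bounds the risk by
     C h^-2 (e^(2 gamma/h^2) / n + exp(- 2^(1-r) beta / h^r)).
   With the given bandwidths this is o(phi_n^2). *)
From HB Require Import structures.
Require Import Defs.
From mathcomp Require Import ring lra measurable_realfun.
Import Order.TTheory GRing.Theory Num.Theory.
Import numFieldNormedType.Exports.

Local Open Scope classical_set_scope.
Local Open Scope ring_scope.
Local Open Scope complex_scope.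

Set Implicit Arguments.
Unset Strict Implicit.
Unset Printing Implicit Defensive.

(** * Integration *)

(** The exponent b is taken strictly above beta in order to split exp(- b x^r) into exp(- beta x^r),
    which gives the rate, and exp(- (b - beta) x^r), which makes the tail t > 1/h and the complement
    of the disc integrable. For r = 2 there is room since (1 + sqrt B)^2 = 1 + B + 2 sqrt B exceeds
    1 + B. All identities are proved for the finite square partial sums; the weights w_m w_n make
    the bounds uniform in the number of terms, so that dominated convergence carries them to the
    limit. Angles are observed in [0, pi] only. The other half of the circle comes from taking real
    parts: the conjugate of c_mn is (-1)^(m + n) c_mn, which adds to each direction its opposite.
    Integrals against the law of the data are taken against a density whose sign is left open, and
    independence is treated in the same way. The risk bound beats phi_n^2 by a factor (log n)^(1/2)
    for r = 2, and by h^(3 r - 8) for r < 2, where the equation forces h to tend to 0; the surplus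
    absorbs every constant. *)

Section RealIntegrals.
Context d (T : measurableType d) (R : realType).
Variable mu : {measure set T -> \bar R}.

Lemma integrable_dom (D : set T) (f g : T -> R) :
  measurable D -> measurable_fun D f -> mu.-integrable D (EFin \o g) ->
  (forall x, D x -> `|f x| <= g x) -> mu.-integrable D (EFin \o f).
Proof.
move=> mD mf ig fg; apply: (le_integrable mD _ _ ig).
  exact/measurable_EFinP.
by move=> x Dx /=; rewrite lee_fin (le_trans (fg x Dx))// ler_norm.
Qed.

Lemma Rintegral_fin (D : set T) (f : T -> R) :
  measurable D -> mu.-integrable D (EFin \o f) ->
  (\int[mu]_(x in D) (f x)%:E)%E = (\int[mu]_(x in D) f x)%:E.
Proof. by move=> mD fi; rewrite /Rintegral fineK//; exact: integrable_fin_num fi. Qed.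

Lemma dominated_cvgR (D : set T) (f_ : nat -> T -> R) (f g : T -> R) :
  measurable D -> (forall n, measurable_fun D (f_ n)) ->
  (forall x, D x -> f_ n x @[n --> \oo] --> f x) ->
  mu.-integrable D (EFin \o g) ->
  (forall n x, D x -> `|f_ n x| <= g x) ->
  (\int[mu]_(x in D) f_ n x)%R @[n --> \oo] --> (\int[mu]_(x in D) f x)%R.
Proof.
move=> mD mf ff ig fg.
have mF : measurable_fun D f by apply: (measurable_fun_cvg mf).
have fi : mu.-integrable D (EFin \o f).
  apply: (@integrable_dom D f g) => // x Dx.
  have cn : `|f_ n x| @[n --> \oo] --> `|f x| by apply: cvg_norm; exact: ff.
  by rewrite -(cvg_lim _ cn)//; apply: limr_le; [by apply/cvg_ex; eexists; exact: cn|
    apply: nearW => n; exact: fg].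
apply: fine_cvg; rewrite -Rintegral_fin//.
apply: (@dominated_cvg _ _ _ mu D mD (fun n x => (f_ n x)%:E)
   (fun x => (f x)%:E) (EFin \o g)) => //.
- by move=> n; exact/measurable_EFinP.
- by move=> x Dx; apply: cvg_EFin; [exact: nearW|exact: ff].
Qed.

(** The restrictions of f to the sets D_ n are dominated by |f|. Used with growing segments, to make
    an improper integral a limit of integrals over bounded intervals. *)
Lemma Rintegral_cvg_sets (D : set T) (D_ : nat -> set T) (f : T -> R) :
  measurable D -> (forall n, measurable (D_ n)) -> (forall n, D_ n `<=` D) ->
  (forall x, D x -> \forall n \near \oo, D_ n x) ->
  mu.-integrable D (EFin \o f) ->
  (\int[mu]_(x in D_ n) f x)%R @[n --> \oo] --> (\int[mu]_(x in D) f x)%R.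
Proof.
move=> mD mD_ sD nD fi.
have mf : measurable_fun D f by have /integrableP[/measurable_EFinP] := fi.
rewrite (_ : (fun n => _) = (fun n => \int[mu]_(x in D) (f \_ (D_ n)) x)%R); last first.
  by apply/funext => n; rewrite -Rintegral_mkcondr; congr Rintegral; rewrite setIC; apply/esym/setIidPl.
apply: (@dominated_cvgR _ _ _ (fun x => `|f x|)) => //.
- by move=> n; apply/measurable_restrict => //; apply: measurable_funS mf => //; exact: subIsetl.
- by move=> x Dx; apply: cvg_near_cst; apply: filterS (nD x Dx) => n Dn; rewrite patchE mem_set.
- by have := integrable_abse fi.
- by move=> n x Dx; rewrite patchE; case: ifP => // _; rewrite normr0.
Qed.
Lemma integrableR_add (D : set T) (f g : T -> R) : measurable D ->
  mu.-integrable D (EFin \o f) -> mu.-integrable D (EFin \o g) ->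
  mu.-integrable D (EFin \o (fun x => f x + g x)).
Proof. by move=> mD hf hg; have := integrableD mD hf hg; exact: eq_integrable. Qed.

Lemma integrableR_scale (D : set T) (c : R) (f : T -> R) : measurable D ->
  mu.-integrable D (EFin \o f) -> mu.-integrable D (EFin \o (fun x => c * f x)).
Proof. by move=> mD hf; have := integrableZl mD c hf; exact: eq_integrable. Qed.

Lemma Rintegral_sumR (D : set T) (I : Type) (s : seq I)
  (f : I -> T -> R) : measurable D -> (forall i, mu.-integrable D (EFin \o f i)) ->
  mu.-integrable D (EFin \o (fun x => \sum_(i <- s) f i x)) /\
  \int[mu]_(x in D) (\sum_(i <- s) f i x) = \sum_(i <- s) \int[mu]_(x in D) f i x.
Proof.
move=> mD fi; elim: s => [|i s [IH1 IH2]].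
  rewrite big_nil; split; last by rewrite /Rintegral integral0_eq// => x _; rewrite big_nil.
  by have := integrable0 mu D; apply: eq_integrable => // x _ /=; rewrite big_nil.
have E x : \sum_(j <- i :: s) f j x = f i x + \sum_(j <- s) f j x by rewrite big_cons.
split.
  by have := integrableR_add mD (fi i) IH1; apply: eq_integrable => // x _ /=; rewrite E.
rewrite big_cons -IH2 -RintegralD//.
by apply: eq_Rintegral => x _; rewrite E.
Qed.

End RealIntegrals.

(** * Fubini's theorem for real-valued functions with a product majorant *)

Section FubiniR.
Context d1 d2 (T1 : measurableType d1) (T2 : measurableType d2) (R : realType).
Variables (m1 : {sigma_finite_measure set T1 -> \bar R})
  (m2 : {sigma_finite_measure set T2 -> \bar R}).
Variables (D1 : set T1) (D2 : set T2).
Hypotheses (mD1 : measurable D1) (mD2 : measurable D2).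
Variables (f : T1 -> T2 -> R) (a : T1 -> R) (b : T2 -> R).
Hypotheses (mf : measurable_fun setT (fun z : T1 * T2 => f z.1 z.2))
  (ia : m1.-integrable D1 (EFin \o a)) (ib : m2.-integrable D2 (EFin \o b))
  (fab : forall x y, D1 x -> D2 y -> `|f x y| <= a x * b y).

(** Extension by zero: Fubini is applied to [g] on the whole product, and the indicators are turned
    back into the domains of integration afterwards. *)
Let g (z : T1 * T2) : R := (\1_D1 z.1 * \1_D2 z.2) * f z.1 z.2.

Let mg : measurable_fun setT g.
Proof.
apply: measurable_funM => //; apply: measurable_funM.
  by apply: measurableT_comp => //; exact: measurable_indic.
by apply: measurableT_comp => //; exact: measurable_indic.
Qed.

Let gab x y : `|g (x, y)| <= (`|a x| * \1_D1 x) * (`|b y| * \1_D2 y).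
Proof.
rewrite /g /= !indicE; case: (boolP (x \in D1)); case: (boolP (y \in D2)) => /=;
  rewrite ?(mul0r, mulr0, mul1r, mulr1, normr0)// => /set_mem Dy /set_mem Dx.
by rewrite (le_trans (fab Dx Dy))// -normrM ler_norm.
Qed.

Let iab d (T : measurableType d) (m : {measure set T -> \bar R}) (D : set T) (h : T -> R) :
  measurable D -> m.-integrable D (EFin \o h) ->
  m.-integrable setT (EFin \o (fun x => `|h x| * \1_D x)).
Proof.
move=> mD ih.
have := integrable_abse ih => /(integrable_mkcond _ mD).
apply: eq_integrable => // x _; rewrite /= patchE indicE; case: ifP; rewrite ?mulr1 ?mulr0//.
Qed.

Let ig : (m1 \x m2)%E.-integrable setT (EFin \o g).
Proof.
apply/integrable12ltyP; first exact/measurable_EFinP.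
have ia' := iab mD1 ia; have ib' := iab mD2 ib.
apply: (@le_lt_trans _ _ (\int[m1]_x ((`|a x| * \1_D1 x)%:E *
   (\int[m2]_y (`|b y| * \1_D2 y))%:E)))%E.
  apply: ge0_le_integral => //.
  - by move=> x _; apply: integral_ge0.
  - apply: (measurable_fun_fubini_tonelli_F (m2:=m2) (fun z => `|(g z)%:E|%E)) => //.
    by apply: measurableT_comp => //; exact/measurable_EFinP.
  - apply: emeasurable_funM => //; by case/integrableP: ia'.
  - move=> x _; rewrite -Rintegral_fin// -ge0_integralZl//; last first.
    + by case/integrableP: ib'.
    apply: ge0_le_integral => //.
    + apply: measurableT_comp => //; apply/measurable_EFinP.
      by apply: (measurableT_comp mg); exact: pair1_measurable.
    + by apply: emeasurable_funM => //; case/integrableP: ib'.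
    + by move=> y _; rewrite /= -EFinM lee_fin gab.
rewrite integralZr//; rewrite Rintegral_fin//.
by rewrite -EFinM ltry.
Qed.

Lemma integrable_prod_dom :
  (m1 \x m2)%E.-integrable (D1 `*` D2) (EFin \o (fun z => f z.1 z.2)).
Proof.
have := ig => /(integrableS _ _ (@subsetT _ (D1 `*` D2))) => /(_ measurableT (measurableX mD1 mD2)).
apply: eq_integrable => //; first exact: measurableX.
move=> [x y] /set_mem[/= Dx Dy].
by rewrite /g /= !indicE !mem_set// !mul1r.
Qed.

Let gE1 : (fun x => (\int[m2]_y (EFin \o g) (x, y))%E) =
   EFin \o (fun x => \1_D1 x * \int[m2]_(y in D2) f x y).
Proof.
apply/funext => x /=; rewrite indicE; case: (boolP (x \in D1)) => [/set_mem Dx|nDx].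
  rewrite mul1r -Rintegral_fin//; last first.
    apply: (integrable_dom (g := fun y => `|a x| * `|b y|)) => //.
    - by apply: measurable_funTS; exact: (measurableT_comp mf (pair1_measurable x)).
    - rewrite (_ : _ \o _ = (fun y => `|a x|%:E * ((abse \o (EFin \o b)) y))%E)//.
      by apply: integrableZl => //; exact: integrable_abse.
    - by move=> y Dy; rewrite (le_trans (fab Dx Dy))// -normrM ler_norm.
  rewrite [RHS]integral_mkcond; apply: eq_integral => y _.
  by rewrite /g /= patchE !indicE mem_set// mul1r; case: ifP; rewrite (mul1r, mul0r).
rewrite mul0r integral0_eq// => y _.
by rewrite /g /= !indicE (negbTE nDx) !mul0r.
Qed.

Let gE2 : (fun y => (\int[m1]_x (EFin \o g) (x, y))%E) =
   EFin \o (fun y => \1_D2 y * \int[m1]_(x in D1) f x y).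
Proof.
apply/funext => y /=; rewrite indicE; case: (boolP (y \in D2)) => [/set_mem Dy|nDy].
  rewrite mul1r -Rintegral_fin//; last first.
    apply: (integrable_dom (g := fun x => `|b y| * `|a x|)) => //.
    - by apply: measurable_funTS; exact: (measurableT_comp mf (pair2_measurable y)).
    - rewrite (_ : _ \o _ = (fun x => `|b y|%:E * ((abse \o (EFin \o a)) x))%E)//.
      by apply: integrableZl => //; exact: integrable_abse.
    - by move=> x Dx; rewrite (le_trans (fab Dx Dy))// -normrM mulrC ler_norm.
  rewrite [RHS]integral_mkcond; apply: eq_integral => x _.
  by rewrite /g /= patchE !indicE [y \in _]mem_set// mulr1; case: ifP; rewrite (mul1r, mul0r).
rewrite mul0r integral0_eq// => x _.
by rewrite /g /= !indicE (negbTE nDy) mulr0 mul0r.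
Qed.

Lemma integrable_inner1 :
  m1.-integrable D1 (EFin \o (fun x => \int[m2]_(y in D2) f x y)).
Proof.
have := integrable_fubini_F ig; rewrite /fubini_F gE1.
move=> /(integrableS measurableT mD1 (@subsetT _ D1)).
by apply: eq_integrable => // x Dx /=; rewrite indicE Dx mul1r.
Qed.

Lemma FubiniR : \int[m1]_(x in D1) \int[m2]_(y in D2) f x y =
  \int[m2]_(y in D2) \int[m1]_(x in D1) f x y.
Proof.
have := Fubini ig; rewrite gE1 gE2 => H.
rewrite /Rintegral [in LHS]integral_mkcond [in RHS]integral_mkcond; congr fine.
rewrite (_ : _ \_ D1 = EFin \o (fun x => \1_D1 x * \int[m2]_(y in D2) f x y)); last first.
  by apply/funext => x; rewrite /= patchE indicE; case: ifP; rewrite (mul1r,mul0r).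
by rewrite {}H; apply: eq_integral => x _ /=; rewrite patchE indicE; case: ifP; rewrite (mul1r,mul0r).
Qed.

Lemma FubiniR_prod : \int[(m1 \x m2)%E]_(z in D1 `*` D2) f z.1 z.2 =
  \int[m1]_(x in D1) \int[m2]_(y in D2) f x y.
Proof.
have := integral12_prod_meas1 ig; rewrite /fubini_F gE1 => H.
rewrite /Rintegral [in LHS]integral_mkcond [in RHS]integral_mkcond; congr fine.
rewrite [in RHS](_ : _ \_ D1 = EFin \o (fun x => \1_D1 x * \int[m2]_(y in D2) f x y)); last first.
  by apply/funext => x; rewrite /= patchE indicE; case: ifP; rewrite (mul1r,mul0r).
rewrite H; apply: eq_integral => -[x y] _ /=; rewrite patchE /g /= !indicE.
by rewrite in_setX/=; case: (x \in D1); case: (y \in D2); rewrite /= ?(mul1r,mul0r,mulr0).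
Qed.

End FubiniR.

(** * Fundamental theorem of calculus and differentiation under the integral *)

Section Calculus.
Context {R : realType}.
Local Notation leb := (@lebesgue_measure R).

Lemma is_derive_continuous (F f : R -> R) :
  (forall x : R, is_derive x 1 F (f x)) -> continuous F.
Proof. by move=> dF x; apply/differentiable_continuous/derivable1_diffP; exact: ex_derive. Qed.

Lemma continuous_integrable_seg (f : R -> R) a b : continuous f ->
  leb.-integrable `[a, b] (EFin \o f).
Proof.
move=> cf; apply: continuous_compact_integrable; first exact: segment_compact.
exact: continuous_subspaceT.
Qed.

Lemma Rintegral_FTC2 (F f : R -> R) a b : a < b ->
  (forall x : R, is_derive x 1 F (f x)) -> continuous f ->
  \int[leb]_(x in `[a, b]) f x = F b - F a.
Proof.
move=> ab dF cf; rewrite /Rintegral (@continuous_FTC2 _ f F)//.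
- exact: continuous_subspaceT.
- have cF := is_derive_continuous dF.
  by split=> [x _||]; [exact: ex_derive|exact/cvg_at_right_filter/cF|exact/cvg_at_left_filter/cF].
- by move=> x _; rewrite derive1E; exact: derive_val.
Qed.

Lemma Rintegral_FTC0y (F f : R -> R) :
  (forall x : R, is_derive x 1 F (f x)) -> continuous f ->
  leb.-integrable `[0, +oo[ (EFin \o f) -> F n%:R @[n --> \oo] --> 0 ->
  \int[leb]_(x in `[0, +oo[) f x = - F 0.
Proof.
move=> dF cf fi F0.
(* The bound n + 1 keeps the segment nondegenerate for every n, as [Rintegral_FTC2] asks for a <
   b. *)
have H : \int[leb]_(x in `[0, n.+1%:R]) f x @[n --> \oo] --> \int[leb]_(x in `[0, +oo[) f x.
  apply: Rintegral_cvg_sets => // [n x /=|x]; first by rewrite !in_itv/= => /andP[->].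
  rewrite /= in_itv/= andbT => x0.
  near=> n; rewrite in_itv/= x0/=; apply: (@le_trans _ _ n%:R); last by rewrite ler_nat.
  near: n; exact: nbhs_infty_ger.
rewrite -(cvg_lim _ H)//; apply/cvg_lim => //.
rewrite (_ : (fun n => _) = (fun n => F n.+1%:R - F 0)); last first.
  by apply/funext => n; apply: Rintegral_FTC2.
rewrite -[X in _ --> X]add0r; apply: cvgB; last exact: cvg_cst.
by rewrite (cvg_shiftS (fun n => F n%:R)).
Unshelve. all: by end_near. Qed.

Lemma Rintegral_FTCT (F f : R -> R) :
  (forall x : R, is_derive x 1 F (f x)) -> continuous f ->
  leb.-integrable setT (EFin \o f) -> F n%:R @[n --> \oo] --> 0 ->
  F (- n%:R) @[n --> \oo] --> 0 -> \int[leb]_x f x = 0.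
Proof.
move=> dF cf fi F0 F0'.
have H : \int[leb]_(x in `[- n.+1%:R, n.+1%:R]) f x @[n --> \oo] --> \int[leb]_x f x.
  apply: Rintegral_cvg_sets => // x _.
  near=> n; rewrite /= in_itv/= -ler_norml; apply: (@le_trans _ _ n%:R); last by rewrite ler_nat.
  near: n; exact: nbhs_infty_ger.
rewrite -(cvg_lim _ H)//; apply/cvg_lim => //.
rewrite (_ : (fun n => _) = (fun n => F n.+1%:R - F (- n.+1%:R))); last first.
  by apply/funext => n; apply: Rintegral_FTC2 => //; rewrite gtrN.
rewrite -[X in _ --> X](subr0 0); apply: cvgB.
  by rewrite (cvg_shiftS (fun n => F n%:R)).
by rewrite (cvg_shiftS (fun n => F (- n%:R))).
Unshelve. all: by end_near. Qed.

Lemma is_derive_Rintegral (D : set R) (f df : R -> R -> R) (G : R -> R) (a : R) :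
  measurable D -> (forall s, leb.-integrable D (EFin \o f s)) ->
  (forall s x : R, is_derive s 1 (fun s => f s x) (df s x)) ->
  leb.-integrable D (EFin \o G) -> (forall x, 0 <= G x) ->
  (forall s x, `|s - a| < 1 -> D x -> `|df s x| <= G x) ->
  is_derive a 1 (fun s => \int[leb]_(x in D) f s x) (\int[leb]_(x in D) df a x).
Proof.
move=> mD fi dfd Gi G0 dG.
have p1 s x : partial1of2 f s x = df s x.
  by rewrite /partial1of2 derive1E; exact: derive_val.
have Ia : `]a - 1, a + 1[%classic a by rewrite /= in_itv/=; apply/andP; split; lra.
have bd s x : `]a - 1, a + 1[%classic s -> D x -> `|partial1of2 f s x| <= G x.
  rewrite /= in_itv/= => /andP[h1 h2] Dx; rewrite p1; apply: dG => //.
  by rewrite ltr_norml; apply/andP; split; lra.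
have der s x : `]a - 1, a + 1[%classic s -> D x -> derivable (f ^~ x) s 1.
  by move=> _ _; exact: ex_derive.
apply: DeriveDef.
  exact: (@derivable_under_integral _ _ _ leb f D mD a (a - 1) (a + 1) Ia (fun s _ => fi s) der G G0 Gi bd).
rewrite -derive1E (@differentiation_under_integral _ _ _ leb f D mD a (a - 1) (a + 1) Ia (fun s _ => fi s) der G G0 Gi bd).
by apply: eq_Rintegral => x _; rewrite p1.
Qed.

End Calculus.

(** * Complex-valued functions of a real variable *)

Section ComplexCalculus.
Context {R : realType}.
Local Notation leb := (@lebesgue_measure R).
Local Notation C := R[i].
Local Notation Re := complex.Re.
Local Notation Im := complex.Im.
Local Notation measR := (@measurable _ (measurableTypeR R)).
Local Notation ii := (Complex 0 1 : C).

Lemma cReD (x y : C) : Re (x + y) = Re x + Re y. Proof. by case: x; case: y. Qed.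
Lemma cImD (x y : C) : Im (x + y) = Im x + Im y. Proof. by case: x; case: y. Qed.
Lemma cReN (x : C) : Re (- x) = - Re x. Proof. by case: x. Qed.
Lemma cImN (x : C) : Im (- x) = - Im x. Proof. by case: x. Qed.
Lemma cReM (x y : C) : Re (x * y) = Re x * Re y - Im x * Im y.
Proof. by case: x; case: y. Qed.
Lemma cImM (x y : C) : Im (x * y) = Re x * Im y + Im x * Re y.
Proof. by case: x => a b; case: y => c d /=; rewrite addrC. Qed.
Lemma cRe_sum I (r : seq I) P (F : I -> C) : Re (\sum_(i <- r | P i) F i) = \sum_(i <- r | P i) Re (F i).
Proof. by elim/big_rec2: _ => // i y1 y2 _ <-; rewrite cReD. Qed.
Definition cRIE := (cReD, cImD, cReN, cImN, cReM, cImM).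

Lemma ceqP (x y : C) : Re x = Re y -> Im x = Im y -> x = y.
Proof. by case: x => a b; case: y => c d /= -> ->. Qed.

Lemma RCD (x y : R) : (x + y)%:C = x%:C + y%:C.
Proof. by apply: ceqP; rewrite ?cRIE/= ?addr0. Qed.
Lemma RCN (x : R) : (- x)%:C = - x%:C.
Proof. by apply: ceqP; rewrite ?cRIE/= ?oppr0. Qed.
Lemma RCM (x y : R) : (x * y)%:C = x%:C * y%:C.
Proof. by apply: ceqP; rewrite ?cRIE/= ?(mulr0, mul0r, subr0, addr0). Qed.
Lemma RC1 : (1 : R)%:C = 1 :> C. Proof. by []. Qed.
Lemma RC0 : (0 : R)%:C = 0 :> C. Proof. by []. Qed.
Lemma RCnat n : (n%:R : R)%:C = n%:R :> C.
Proof. by elim: n => [//|n IH]; rewrite !mulrS RCD IH. Qed.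
Lemma RCX (x : R) n : (x ^+ n)%:C = x%:C ^+ n.
Proof. by elim: n => [//|n IH]; rewrite !exprS RCM IH. Qed.
Lemma RCV (x : R) : (x^-1)%:C = (x%:C)^-1 :> C.
Proof.
have [->|x0] := eqVneq x 0; first by rewrite invr0 RC0 invr0.
apply: (mulfI (_ : x%:C != 0)); first by apply: contra x0 => /eqP [->].
by rewrite -RCM mulfV// mulfV//; apply: contra x0 => /eqP [->].
Qed.
Lemma RC_inj (x y : R) : x%:C = y%:C -> x = y. Proof. by case. Qed.

Lemma ii2 : ii * ii = -1.
Proof. by apply: ceqP; rewrite !cRIE/=; ring. Qed.

(* The norm of R[i] takes its values in R[i]. *)
Definition cmod (z : C) : R := Num.sqrt (Re z ^+ 2 + Im z ^+ 2).

Lemma cmodE z : `|z| = (cmod z)%:C. Proof. exact: normc_def. Qed.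
Lemma cmod_ge0 z : 0 <= cmod z. Proof. exact: sqrtr_ge0. Qed.
Lemma cmod0 : cmod 0 = 0. Proof. by rewrite /cmod/= expr0n addr0 sqrtr0. Qed.
Lemma cmodM x y : cmod (x * y) = cmod x * cmod y.
Proof. by apply: RC_inj; rewrite RCM -!cmodE normrM. Qed.
Lemma cmodD x y : cmod (x + y) <= cmod x + cmod y.
Proof. by rewrite -lecR RCD -!cmodE ler_normD. Qed.
Lemma cmodN x : cmod (- x) = cmod x.
Proof. by apply: RC_inj; rewrite -!cmodE normrN. Qed.
Lemma cmod_real (x : R) : cmod x%:C = `|x|.
Proof. by rewrite /cmod/= expr0n/= addr0 sqrtr_sqr. Qed.
Lemma cmodX x n : cmod (x ^+ n) = cmod x ^+ n.
Proof. by apply: RC_inj; rewrite RCX -!cmodE normrX. Qed.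
Lemma cmod_ii : cmod ii = 1.
Proof. by rewrite /cmod/= expr0n/= add0r expr1n sqrtr1. Qed.
Lemma cmod_Re z : `|Re z| <= cmod z.
Proof. by rewrite -sqrtr_sqr ler_wsqrtr// lerDl sqr_ge0. Qed.
Lemma cmod_Im z : `|Im z| <= cmod z.
Proof. by rewrite -sqrtr_sqr ler_wsqrtr// lerDr sqr_ge0. Qed.
Lemma cmod_le z : cmod z <= `|Re z| + `|Im z|.
Proof.
rewrite -[leRHS]ger0_norm ?addr_ge0// -sqrtr_sqr ler_wsqrtr// sqrrD !real_normK ?num_real//.
by rewrite -addrA lerD2l lerDr mulrn_wge0// mulr_ge0.
Qed.
Lemma cmod_cexpi x : cmod (cexpi x) = 1.
Proof. by rewrite /cmod/= cos2Dsin2 sqrtr1. Qed.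
Lemma cmod_sum I (r : seq I) P (F : I -> C) :
  cmod (\sum_(i <- r | P i) F i) <= \sum_(i <- r | P i) cmod (F i).
Proof.
elim/big_ind2: _ => [|x a y b h1 h2|//]; first by rewrite cmod0.
by rewrite (le_trans (cmodD _ _))// lerD.
Qed.

Lemma cexpiD x y : cexpi (x + y) = cexpi x * cexpi y :> C.
Proof. by apply: ceqP; rewrite !cRIE/= (cosD,sinD)//; ring. Qed.
Lemma cexpi0 : cexpi (0 : R) = 1.
Proof. by apply: ceqP; rewrite /= (cos0, sin0). Qed.

Lemma is_derive_mulR (f g : R -> R) (x a b : R) : is_derive x 1 f a -> is_derive x 1 g b ->
  is_derive x 1 (fun y => f y * g y) (a * g x + f x * b).
Proof.
move=> df dg; have H := is_deriveM df dg.
have E : f x *: b + g x *: a = a * g x + f x * b by rewrite addrC /GRing.scale/= mulrC.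
by move: H; rewrite E.
Qed.
Lemma is_derive_addR (f g : R -> R) (x a b : R) : is_derive x 1 f a -> is_derive x 1 g b ->
  is_derive x 1 (fun y => f y + g y) (a + b).
Proof. by move=> df dg; have := is_deriveD df dg. Qed.
Lemma is_derive_oppR (f : R -> R) (x a : R) : is_derive x 1 f a ->
  is_derive x 1 (fun y => - f y) (- a).
Proof. by move=> df; have := is_deriveN df. Qed.
Lemma is_derive_scaleR (f : R -> R) (c x a : R) : is_derive x 1 f a ->
  is_derive x 1 (fun y => c * f y) (c * a).
Proof. by move=> df; have := is_deriveZ c df. Qed.
Lemma is_derive_compR (f g : R -> R) (x a b : R) : is_derive (g x) 1 f a -> is_derive x 1 g b ->
  is_derive x 1 (fun y => f (g y)) (a * b).
Proof. by move=> df dg; have := is_derive1_comp df dg. Qed.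
Lemma is_derive_ext (f g : R -> R) (x a b : R) : is_derive x 1 f a -> f =1 g -> a = b ->
  is_derive x 1 g b.
Proof. by move=> df /funext <- <-. Qed.
Lemma is_derive_idR (x : R) : is_derive x 1 (fun y : R => y) 1.
Proof. exact: is_derive_id. Qed.
Lemma is_derive_cstR (c x : R) : is_derive x 1 (fun y : R => c) 0.
Proof. exact: is_derive_cst. Qed.

(** Componentwise, to match [cintegral]. Both functions are total, so that a single hypothesis
    covers every point and can be rewritten by [cder_eq]. *)
Definition cder (F f : R -> C) := forall x : R,
  is_derive x 1 (fun y => Re (F y)) (Re (f x)) /\
  is_derive x 1 (fun y => Im (F y)) (Im (f x)).

Lemma cder_eq F f G g : cder F f -> F =1 G -> f =1 g -> cder G g.
Proof. by move=> h /funext <- /funext <-. Qed.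

Lemma cder_cst c : cder (fun _ => c) (fun _ => 0).
Proof. by move=> x; split; exact: is_derive_cstR. Qed.

Lemma cder_real (F f : R -> R) : (forall x : R, is_derive x 1 F (f x)) ->
  cder (fun x => (F x)%:C) (fun x => (f x)%:C).
Proof. by move=> h x; split => /=; [exact: h|exact: is_derive_cstR]. Qed.

Lemma cderD F f G g : cder F f -> cder G g ->
  cder (fun x => F x + G x) (fun x => f x + g x).
Proof.
move=> hF hG x; have [h1 h2] := hF x; have [h3 h4] := hG x; split.
  by apply: (is_derive_ext (is_derive_addR h1 h3)) => [y|]; rewrite cRIE.
by apply: (is_derive_ext (is_derive_addR h2 h4)) => [y|]; rewrite cRIE.
Qed.

Lemma cderM F f G g : cder F f -> cder G g ->
  cder (fun x => F x * G x) (fun x => f x * G x + F x * g x).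
Proof.
move=> hF hG x; have [h1 h2] := hF x; have [h3 h4] := hG x; split.
  by apply: (is_derive_ext (is_derive_addR (is_derive_mulR h1 h3) (is_derive_oppR (is_derive_mulR h2 h4)))) => [y|]; rewrite !cRIE//; ring.
by apply: (is_derive_ext (is_derive_addR (is_derive_mulR h1 h4) (is_derive_mulR h2 h3))) => [y|]; rewrite !cRIE//; ring.
Qed.

Lemma cderZ c F f : cder F f -> cder (fun x => c * F x) (fun x => c * f x).
Proof.
move=> h; apply: (cder_eq (cderM (cder_cst c) h)) => x //.
by rewrite mul0r add0r.
Qed.

Lemma cder_poly (P : {poly C}) : cder (fun x => P.[x%:C]) (fun x => P^`().[x%:C]).
Proof.
elim/poly_ind: P => [|P c IH].
  by apply: (cder_eq (cder_cst 0)) => x; rewrite ?deriv0 horner0.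
have h := cderD (cderM IH (cder_real is_derive_idR)) (cder_cst c).
apply: (cder_eq h) => x; first by rewrite !hornerE.
by rewrite derivD derivC derivM derivX !hornerE.
Qed.

Lemma cder_cexpi (f df : R -> R) : (forall x : R, is_derive x 1 f (df x)) ->
  cder (fun x => cexpi (f x)) (fun x => ii * (df x)%:C * cexpi (f x)).
Proof.
move=> h x; split.
  by apply: (is_derive_ext (is_derive_compR (is_derive_cos _) (h x))) => //; rewrite !cRIE/=; ring.
by apply: (is_derive_ext (is_derive_compR (is_derive_sin _) (h x))) => //; rewrite !cRIE/=; ring.
Qed.

Definition ccont (f : R -> C) :=
  continuous (fun x => Re (f x)) /\ continuous (fun x => Im (f x)).

Lemma cder_cont F f : cder F f -> ccont F.
Proof.
move=> h; split; apply: is_derive_continuous => x.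
  by have [] := h x.
by have [] := h x.
Qed.

Lemma ccontD f g : ccont f -> ccont g -> ccont (fun x => f x + g x).
Proof.
move=> [h1 h2] [h3 h4]; split => x.
  rewrite (_ : (fun _ => _) = (fun y => Re (f y) + Re (g y))); last by apply/funext => y; rewrite cRIE.
  by apply: cvgD; [exact: h1|exact: h3].
rewrite (_ : (fun _ => _) = (fun y => Im (f y) + Im (g y))); last by apply/funext => y; rewrite cRIE.
by apply: cvgD; [exact: h2|exact: h4].
Qed.

Lemma ccontM f g : ccont f -> ccont g -> ccont (fun x => f x * g x).
Proof.
move=> [h1 h2] [h3 h4]; split => x.
  rewrite (_ : (fun _ => _) = (fun y => Re (f y) * Re (g y) - Im (f y) * Im (g y))); last by apply/funext => y; rewrite cRIE.
  by apply: cvgB; apply: cvgM; [exact: h1|exact: h3|exact: h2|exact: h4].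
rewrite (_ : (fun _ => _) = (fun y => Re (f y) * Im (g y) + Im (f y) * Re (g y))); last by apply/funext => y; rewrite cRIE.
by apply: cvgD; apply: cvgM; [exact: h1|exact: h4|exact: h2|exact: h3].
Qed.

Lemma ccont_cst c : ccont (fun _ => c).
Proof. by split => x; exact: cvg_cst. Qed.

Definition Cint (D : set R) (f : R -> C) :=
  leb.-integrable D (EFin \o (fun x => Re (f x))) /\
  leb.-integrable D (EFin \o (fun x => Im (f x))).

Lemma Cint_dom (D : set R) f (g : R -> R) : measR D -> ccont f ->
  leb.-integrable D (EFin \o g) -> (forall x, D x -> cmod (f x) <= g x) -> Cint D f.
Proof.
move=> mD [h1 h2] ig fg; split; apply: (integrable_dom mD _ ig).
- by apply: measurable_funTS; exact: continuous_measurable_fun.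
- by move=> x Dx; rewrite (le_trans (cmod_Re _))// fg.
- by apply: measurable_funTS; exact: continuous_measurable_fun.
- by move=> x Dx; rewrite (le_trans (cmod_Im _))// fg.
Qed.

Lemma Cint_seg a b f : ccont f -> Cint `[a, b] f.
Proof. by move=> [h1 h2]; split; exact: continuous_integrable_seg. Qed.

Lemma eq_cintegral (D : set R) f g : (forall x, D x -> f x = g x) ->
  cintegral D f = cintegral D g.
Proof.
move=> h; apply: ceqP => /=; apply: eq_Rintegral => x /set_mem Dx; by rewrite h.
Qed.

Lemma Cint_add (D : set R) f g : measR D -> Cint D f -> Cint D g ->
  Cint D (fun x => f x + g x).
Proof.
move=> mD [f1 f2] [g1 g2]; split.
  by have := integrableR_add mD f1 g1; apply: eq_integrable => // x _ /=; rewrite cRIE.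
by have := integrableR_add mD f2 g2; apply: eq_integrable => // x _ /=; rewrite cRIE.
Qed.

Lemma Cint_scale (D : set R) (c : C) f : measR D -> Cint D f ->
  Cint D (fun x => c * f x).
Proof.
move=> mD [f1 f2]; split.
  have := integrableR_add mD (integrableR_scale (Re c) mD f1) (integrableR_scale (- Im c) mD f2).
  by apply: eq_integrable => // x _ /=; rewrite cRIE mulNr.
have := integrableR_add mD (integrableR_scale (Re c) mD f2) (integrableR_scale (Im c) mD f1).
by apply: eq_integrable => // x _ /=; rewrite cRIE.
Qed.

Lemma cintegralD (D : set R) f g : measR D -> Cint D f -> Cint D g ->
  cintegral D (fun x => f x + g x) = cintegral D f + cintegral D g.
Proof.
move=> mD [f1 f2] [g1 g2]; apply: ceqP; rewrite cRIE/=.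
  by rewrite -RintegralD//; apply: eq_Rintegral => x _; rewrite cRIE.
by rewrite -RintegralD//; apply: eq_Rintegral => x _; rewrite cRIE.
Qed.

Lemma cintegralZ (D : set R) c f : measR D -> Cint D f ->
  cintegral D (fun x => c * f x) = c * cintegral D f.
Proof.
move=> mD [f1 f2]; apply: ceqP; rewrite cRIE/=.
  rewrite -!RintegralZl// -RintegralB//; last 2 first.
  - exact: (integrableR_scale (Re c) mD f1).
  - exact: (integrableR_scale (Im c) mD f2).
  by apply: eq_Rintegral => x _; rewrite cRIE.
rewrite -!RintegralZl// -RintegralD//; last 2 first.
- exact: (integrableR_scale (Re c) mD f2).
- exact: (integrableR_scale (Im c) mD f1).
by apply: eq_Rintegral => x _; rewrite cRIE.
Qed.

(** The factor 2 is the price of bounding the real and imaginary parts separately. *)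
Lemma cmod_cintegral (D : set R) f (g : R -> R) : measR D -> Cint D f ->
  leb.-integrable D (EFin \o g) -> (forall x, D x -> cmod (f x) <= g x) ->
  cmod (cintegral D f) <= 2 * \int[leb]_(x in D) g x.
Proof.
move=> mD [f1 f2] ig fg.
have h (k : R -> R) : leb.-integrable D (EFin \o k) -> (forall x, D x -> `|k x| <= g x) ->
    `|\int[leb]_(x in D) k x| <= \int[leb]_(x in D) g x.
  move=> ik kg; apply: (le_trans (le_normr_Rintegral mD ik)).
  by apply: le_Rintegral => //; exact: integrable_abse ik.
rewrite (le_trans (cmod_le _))// mulrDl mul1r lerD//=; apply: h => // x Dx.
  by rewrite (le_trans (cmod_Re _))// fg.
by rewrite (le_trans (cmod_Im _))// fg.
Qed.

Lemma cder_cintegral (D : set R) (f df : R -> R -> C) (G : R -> R -> R) :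
  measR D -> (forall s, Cint D (f s)) ->
  (forall x, cder (fun s => f s x) (fun s => df s x)) ->
  (forall a, leb.-integrable D (EFin \o G a)) -> (forall a x, 0 <= G a x) ->
  (forall a s x, `|s - a| < 1 -> D x -> cmod (df s x) <= G a x) ->
  cder (fun s => cintegral D (f s)) (fun s => cintegral D (df s)).
Proof.
move=> mD fi dfd Gi G0 dG a; split => /=.
  apply: (@is_derive_Rintegral _ D (fun s x => Re (f s x)) (fun s x => Re (df s x)) (G a)) => //.
  - by move=> s; have [] := fi s.
  - by move=> s x; have [] := dfd x s.
  - by move=> s x h Dx; rewrite (le_trans (cmod_Re _))// dG.
apply: (@is_derive_Rintegral _ D (fun s x => Im (f s x)) (fun s x => Im (df s x)) (G a)) => //.
- by move=> s; have [] := fi s.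
- by move=> s x; have [] := dfd x s.
- by move=> s x h Dx; rewrite (le_trans (cmod_Im _))// dG.
Qed.

(* An integrable majorant with vanishing limits. *)
Definition lor (x : R) : R := (1 + x ^+ 2)^-1.

Lemma lor_ge0 x : 0 <= lor x. Proof. by rewrite invr_ge0 addr_ge0// sqr_ge0. Qed.
Lemma continuous_lor : continuous lor.
Proof. exact: continuous_oneDsqrV. Qed.

Lemma integrable_lor : leb.-integrable setT (EFin \o lor).
Proof.
have ml : measurable_fun setT lor by apply: continuous_measurable_fun; exact: continuous_lor.
apply/integrableP; split; first exact/measurable_EFinP.
under eq_integral do rewrite /= ger0_norm ?lor_ge0//.
rewrite ge0_symfun_integralT//=.
- rewrite (_ : [set x | _] = `[0, +oo[%classic); last first.
    by apply/seteqP; split => x/=; rewrite in_itv/= andbT.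
  by rewrite (integral0y_oneDsqr R) -EFinM ltry.
- exact: lor_ge0.
- exact: continuous_lor.
- by move=> x /=; rewrite /lor sqrrN.
Qed.

Lemma integrable_lorZ K : leb.-integrable setT (EFin \o (fun x => K * lor x)).
Proof. exact: (integrableR_scale K measurableT integrable_lor). Qed.

Lemma cvg_lor0 : lor n%:R @[n --> \oo] --> 0.
Proof.
apply: (@squeeze_cvgr _ _ _ _ (cst 0) (fun n => n.+1%:R^-1)).
- apply: nearW => n; rewrite lor_ge0/= /lor lef_pV2 ?posrE ?ltr_pwDl ?sqr_ge0//.
  rewrite -natr1 addrC lerD2l expr2 -natrM ler_nat.
  by case: n => // n; rewrite leq_pmulr.
- exact: cvg_cst.
- exact: cvg_harmonic.
Qed.

Lemma cvg_lor_bound (f : nat -> R) K : (forall n, `|f n| <= K * lor n%:R) ->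
  f n @[n --> \oo] --> 0.
Proof.
move=> h; apply: norm_cvg0; apply: (@squeeze_cvgr _ _ _ _ (cst 0) (fun n => K * lor n%:R)).
- by apply: nearW => n; rewrite normr_ge0 h.
- exact: cvg_cst.
- by rewrite -(mulr0 K); apply: cvgM; [exact: cvg_cst|exact: cvg_lor0].
Qed.

(** A Lorentzian bound on F makes the boundary values vanish, and on f it gives integrability: this
    is integration by parts on the line without boundary terms. *)
Lemma cintegral_FTCT F f K : cder F f -> ccont f ->
  (forall x, cmod (F x) <= K * lor x) -> (forall x, cmod (f x) <= K * lor x) ->
  cintegral setT f = 0.
Proof.
move=> dF [c1 c2] FK fK.
have [i1 i2] : Cint setT f by apply: Cint_dom (integrable_lorZ K) _.
apply: ceqP => /=.
  apply: (Rintegral_FTCT (F := fun y => Re (F y))) => //.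
  - by move=> x; have [] := dF x.
  - by apply: (@cvg_lor_bound _ K) => n; rewrite (le_trans (cmod_Re _)).
  - by apply: (@cvg_lor_bound _ K) => n; rewrite (le_trans (cmod_Re _))// (le_trans (FK _))// /lor sqrrN.
apply: (Rintegral_FTCT (F := fun y => Im (F y))) => //.
- by move=> x; have [] := dF x.
- by apply: (@cvg_lor_bound _ K) => n; rewrite (le_trans (cmod_Im _)).
- by apply: (@cvg_lor_bound _ K) => n; rewrite (le_trans (cmod_Im _))// (le_trans (FK _))// /lor sqrrN.
Qed.

Lemma cintegral_FTC0y F f K : cder F f -> ccont f ->
  (forall x, 0 <= x -> cmod (F x) <= K * lor x) -> (forall x, 0 <= x -> cmod (f x) <= K * lor x) ->
  cintegral `[0, +oo[ f = - F 0.
Proof.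
move=> dF [c1 c2] FK fK.
have [i1 i2] : Cint `[0, +oo[ f.
  apply: Cint_dom => //; first by apply: (integrableS _ _ _ (integrable_lorZ K)).
  by move=> x /=; rewrite in_itv/= andbT; exact: fK.
apply: ceqP; rewrite cRIE/=.
  apply: (Rintegral_FTC0y (F := fun y => Re (F y))) => //.
  - by move=> x; have [] := dF x.
  - by apply: (@cvg_lor_bound _ K) => n; rewrite (le_trans (cmod_Re _))// FK.
apply: (Rintegral_FTC0y (F := fun y => Im (F y))) => //.
- by move=> x; have [] := dF x.
- by apply: (@cvg_lor_bound _ K) => n; rewrite (le_trans (cmod_Im _))// FK.
Qed.

Lemma cintegral_FTC2 F f a b : a < b -> cder F f -> ccont f ->
  cintegral `[a, b] f = F b - F a.
Proof.
move=> ab dF [c1 c2]; apply: ceqP; rewrite !cRIE/=.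
  by apply: (Rintegral_FTC2 (F := fun y => Re (F y))) => // x; have [] := dF x.
by apply: (Rintegral_FTC2 (F := fun y => Im (F y))) => // x; have [] := dF x.
Qed.

Lemma cder0_cst F : cder F (fun _ => 0) -> forall x, F x = F 0.
Proof.
move=> h x; apply: ceqP.
  by apply: (@is_derive_0_is_cst _ (fun y => Re (F y))) => y; have [] := h y.
by apply: (@is_derive_0_is_cst _ (fun y => Im (F y))) => y; have [] := h y.
Qed.

End ComplexCalculus.

(** * Hermite polynomials and Gaussian integrals *)

Section HermitePolynomials.
Variable K : comNzRingType.

(** Hermite polynomials over an arbitrary ring, so that they can be evaluated at complex arguments
    once the contour is moved. *)
Fixpoint hermp n : {poly K} :=
  if n is n'.+1 then (hermp n' * 'X) *+ 2 - (hermp n')^`() else 1.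

(** At n = 0 the index n.-1 is 0, but the multiplicity 2 * 0 kills the term. All recurrences below
    rely on the same convention. *)
Lemma deriv_hermp n : (hermp n)^`() = hermp n.-1 *+ (2 * n).
Proof.
elim: n => [|n IH]; first by rewrite /= muln0 mulr0n derivC.
rewrite [LHS]/= derivB derivMn derivM derivX mulr1.
case: n IH => [|n] IH; first by rewrite IH/= !mulr0n derivC mul0r add0r subr0.
rewrite IH derivMn -[n.+1.-1]/n -[n.+2.-1]/n.+1 [hermp n.+1]/=.
rewrite (_ : 2 * n.+2 = 2 * n.+1 + 2)%N; last by rewrite -[n.+2]addn1 mulnDr.
move: ((hermp n)^`()) (2 * n.+1)%N => D k; move: (hermp n * 'X) (mulrnAl (hermp n) 'X k) => Y ->.
by rewrite mulrnDl mulrnDr [in RHS]mulrnBl [Y *+ k *+ 2]mulrnAC addrAC.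
Qed.

(** Real shifts occur in the products h_m(q - x) h_n(q + x) of the Wigner function, imaginary ones
    when the line of integration is moved. *)
Definition hermps n (al : K) := hermp n \Po ('X + al%:P).

Lemma hermps0 al : hermps 0 al = 1.
Proof. by rewrite /hermps/= comp_polyC. Qed.

Lemma deriv_hermps n al : (hermps n al)^`() = hermps n.-1 al *+ (2 * n).
Proof.
rewrite /hermps deriv_comp derivD derivX derivC addr0 mulr1 deriv_hermp.
by rewrite -[LHS]/(comp_poly _ _) raddfMn.
Qed.

Lemma hermpsS n al : hermps n.+1 al =
  (hermps n al * 'X) *+ 2 + (al *+ 2) *: hermps n al - (hermps n al)^`().
Proof.
rewrite {1}/hermps /= comp_polyB -[_ \Po _ as X in X - _]/(comp_poly _ _) raddfMn /= comp_polyM comp_polyX.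
rewrite -[hermp n \Po _]/(hermps n al) mulrDr mulrnDl; congr (_ + _ - _).
  by rewrite mulrC mul_polyC scalerMnl.
by rewrite deriv_comp derivD derivX derivC addr0 mulr1.
Qed.

(* Up to normalisation, Ito's complex Hermite polynomials, which are the
   Gaussian integrals of products of two shifted Hermite polynomials. *)
Fixpoint Gmn (m n : nat) (a b : K) : K :=
  if n is n'.+1 then a * Gmn m n' a b + (2 * m)%:R * Gmn m.-1 n' a b else b ^+ m.

Lemma GmnSr m n a b : Gmn m n.+1 a b = a * Gmn m n a b + (2 * m)%:R * Gmn m.-1 n a b.
Proof. by []. Qed.

(** Induction on n: Pascal's rule for C(n + 1, j) splits the sum into the two terms of the
    recurrence, the second one through (j + 1) C(m, j + 1) = m C(m - 1, j). The terms with j > n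
    vanish, which leaves N free. *)
Lemma Gmn_sum N m n a b : (n < N)%N -> Gmn m n a b =
  \sum_(j < N) ('C(m, j) * 'C(n, j) * j`! * 2 ^ j)%:R * a ^+ (n - j) * b ^+ (m - j).
Proof.
elim: n m N => [|n IH] m N.
  case: N => // N _; rewrite big_ord_recl /= big1 => [|i _].
    by rewrite !bin0 subnn expr0 subn0 fact0 addr0 -[(_ * 2 ^ 0)%N]/1%N !mul1r.
  by rewrite bin0n /= muln0 mul0n mul0n !mul0r.
case: N => // N nN.
rewrite [LHS]/= (IH m N.+1 (ltnW nN)) (IH m.-1 N nN) mulr_sumr mulr_sumr.
rewrite [in LHS]big_ord_recl [in RHS]big_ord_recl -addrA; congr (_ + _).
  by rewrite !bin0 !subn0 exprS; ring.
rewrite -big_split /=; apply: eq_bigr => i _; rewrite /bump/= !add1n binS.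
have -> : (n.+1 - i.+1 = n - i)%N by [].
rewrite mulnDr !mulnDl natrD !mulrDl; congr (_ + _).
  have [ni|ni] := leqP i.+1 n; last by rewrite (bin_small ni) muln0 !mul0n !mul0r mulr0.
  have -> : a ^+ (n - i) = a * a ^+ (n - i.+1) by rewrite -exprS -subSn.
  by ring.
case: m => [|m] /=; first by rewrite muln0 !mul0n !mul0r.
have -> : ('C(m.+1, i.+1) * 'C(n, i) * (i.+1)`! * 2 ^ i.+1 =
   2 * m.+1 * ('C(m, i) * 'C(n, i) * i`! * 2 ^ i))%N.
  rewrite factS expnS.
  have := mul_bin_diag m.+1 i => /= E.
  have -> : ('C(m.+1, i.+1) * 'C(n, i) * (i.+1 * i`!) * (2 * 2 ^ i) =
     (i.+1 * 'C(m.+1, i.+1)) * ('C(n, i) * i`! * (2 * 2 ^ i)))%N by ring.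
  by rewrite -E; ring.
by rewrite natrM subSS; ring.
Qed.

(** Every monomial is a^(n - j) b^(m - j), so the substitution (l a, b / l) multiplies it by l^(n -
    m); the powers of l' avoid negative exponents. For |l| = 1 this is how W_mn behaves under
    rotations. *)
Lemma Gmn_homog m n a b l l' : l * l' = 1 ->
  l' ^+ n * Gmn m n (l * a) (l' * b) = l' ^+ m * Gmn m n a b.
Proof.
move=> ll; elim: n m => [|n IH] m; first by rewrite /= mul1r exprMn.
rewrite /= mulrDr exprS.
have -> : l' * l' ^+ n * (l * a * Gmn m n (l * a) (l' * b)) =
  l * l' * a * (l' ^+ n * Gmn m n (l * a) (l' * b)) by ring.
have -> : l' * l' ^+ n * ((2 * m)%:R * Gmn m.-1 n (l * a) (l' * b)) =
  (2 * m)%:R * l' * (l' ^+ n * Gmn m.-1 n (l * a) (l' * b)) by ring.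
rewrite !IH ll; case: m => [|m] /=; first by ring.
by rewrite exprS; ring.
Qed.

End HermitePolynomials.

(** * Gaussian Fourier transforms of polynomials *)

Section GaussianFunctional.
Context {R : realType}.
Local Notation C := R[i].
Local Notation ii := (Complex 0 1 : C).

(** Raise x / n <= e^(x / n) to the power n. *)
Lemma pow_le_exp (x : R) n : 0 <= x -> x ^+ n <= n%:R ^+ n * expR x.
Proof.
move=> x0; case: n => [|n]; first by rewrite !expr0 mul1r (le_trans _ (expR_ge1Dx _))// lerDl.
have n0 : (0 : R) < n.+1%:R by rewrite ltr0n.
have h : x / n.+1%:R <= expR (x / n.+1%:R) by rewrite (le_trans _ (expR_ge1Dx _))// lerDr.
have h2 : (x / n.+1%:R) ^+ n.+1 <= expR (x / n.+1%:R) ^+ n.+1.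
  by rewrite lerXn2r// nnegrE ?expR_ge0// divr_ge0// ltW.
rewrite -expRM_natl mulrCA divff ?gt_eqF// mulr1 expr_div_n in h2.
by rewrite mulrC -ler_pdivrMr ?exprn_gt0.
Qed.

Lemma poly_exp_bound (P : {poly C}) : exists2 K : R, 0 <= K &
  forall x : R, cmod P.[x%:C] <= K * expR `|x|.
Proof.
exists (\sum_(i < size P) cmod P`_i * i%:R ^+ i).
  by apply: sumr_ge0 => i _; rewrite mulr_ge0 ?cmod_ge0// exprn_ge0.
move=> x; rewrite horner_coef (le_trans (cmod_sum _ _ _))// mulr_suml ler_sum// => i _.
rewrite cmodM cmodX cmod_real -mulrA ler_wpM2l ?cmod_ge0//.
exact: pow_le_exp.
Qed.

Lemma exp_lor (x : R) : expR (- (2 * `|x|)) <= lor x.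
Proof.
rewrite /lor expRN lef_pV2 ?posrE ?expR_gt0 ?ltr_pwDl ?sqr_ge0//.
have h : 1 + `|x| <= expR `|x| := expR_ge1Dx _.
have h0 : 0 <= `|x| by [].
rewrite -(real_normK (num_real x)) expRM_natl.
by apply: (@le_trans _ _ ((1 + `|x|) ^+ 2)); [nra|rewrite lerXn2r ?nnegrE ?expR_ge0// addr_ge0].
Qed.

(** Completing the square bounds (a + 2) |x| - c x^2; the additional 2 |x| pays for the Lorentzian
    by [exp_lor]. *)
Lemma exp_gauss_lor (a c x : R) : 0 < c ->
  expR (a * `|x| - c * x ^+ 2) <= expR ((a + 2) ^+ 2 / (4 * c)) * lor x.
Proof.
move=> c0; apply: (@le_trans _ _ (expR ((a + 2) ^+ 2 / (4 * c)) * expR (- (2 * `|x|)))); last first.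
  by rewrite ler_pM2l ?expR_gt0// exp_lor.
rewrite -expRD ler_expR -(real_normK (num_real x)) -subr_ge0.
have -> : (a + 2) ^+ 2 / (4 * c) - 2 * `|x| - (a * `|x| - c * `|x| ^+ 2) =
  (2 * c * `|x| - (a + 2)) ^+ 2 / (4 * c) by field; rewrite gt_eqF.
by rewrite divr_ge0 ?sqr_ge0// mulr_ge0// ltW.
Qed.

Definition gw (c s x : R) : C := cexpi (s * x) * (expR (- (c * x ^+ 2)))%:C.

Lemma cmod_gw c s x : cmod (gw c s x) = expR (- (c * x ^+ 2)).
Proof. by rewrite /gw cmodM cmod_cexpi mul1r cmod_real ger0_norm// expR_ge0. Qed.

Lemma poly_gw_bound (c : R) (P : {poly C}) : 0 < c -> exists2 K : R, 0 <= K &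
  forall s x : R, cmod (P.[x%:C] * gw c s x) <= K * lor x.
Proof.
move=> c0; have [K K0 hK] := poly_exp_bound P.
exists (K * expR ((1 + 2) ^+ 2 / (4 * c))); first by rewrite mulr_ge0 ?expR_ge0.
move=> s x; rewrite cmodM cmod_gw (le_trans (ler_wpM2r _ (hK x))) ?expR_ge0//.
rewrite -[leLHS]mulrA -[leRHS]mulrA ler_wpM2l// -expRD.
by have := @exp_gauss_lor 1 c x c0; rewrite mul1r.
Qed.

Lemma cder_gw c s : cder (gw c s) (fun x => (ii * s%:C - (2 * c * x)%:C) * gw c s x).
Proof.
have h1 := cder_cexpi (fun x => is_derive_scaleR s (is_derive_idR x)).
have h2 (x : R) : is_derive x 1 (fun x => expR (- (c * x ^+ 2))) (- (2 * c * x) * expR (- (c * x ^+ 2))).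
  apply: (is_derive_ext (is_derive_compR (is_derive_expR _) (is_derive_oppR (is_derive_scaleR c (is_derive_mulR (is_derive_idR x) (is_derive_idR x)))))) => //.
  by rewrite -expr2; ring.
apply: (cder_eq (cderM h1 (cder_real h2))) => x //.
by rewrite /gw mulr1 !RCM RCN !RCM; ring.
Qed.

Lemma cder_gw_s c x : cder (fun s => gw c s x) (fun s => ii * x%:C * gw c s x).
Proof.
have h1 : cder (fun s => cexpi (s * x)) (fun s => ii * x%:C * cexpi (s * x)).
  apply: cder_cexpi => s; apply: (is_derive_ext (is_derive_mulR (is_derive_idR s) (is_derive_cstR x s))) => //.
  by rewrite mul1r mulr0 addr0.
apply: (cder_eq (cderM h1 (cder_cst (expR (- (c * x ^+ 2)))%:C))) => s //.
by rewrite /gw mulr0 addr0 mulrA.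
Qed.

Lemma ccont_poly_gw c s (P : {poly C}) : ccont (fun x => P.[x%:C] * gw c s x).
Proof. by apply: ccontM; [exact: cder_cont (cder_poly P)|exact: cder_cont (cder_gw c s)]. Qed.

(** The Fourier transform at s of P(x) e^(- c x^2), viewed as a functional of P. The case c = 1
    serves products of two Fock functions, c = 1/2 the Gaussian noise. *)
Definition J (c s : R) (P : {poly C}) : C :=
  cintegral setT (fun x => P.[x%:C] * gw c s x).

Section FixedWeight.
Variable c : R.
Hypothesis c0 : 0 < c.

Lemma J_int s P : Cint setT (fun x => P.[x%:C] * gw c s x).
Proof.
have [K _ hK] := poly_gw_bound P c0.
by apply: Cint_dom (integrable_lorZ K) _ => //; exact: ccont_poly_gw.
Qed.

Lemma J_add s P Q : J c s (P + Q) = J c s P + J c s Q.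
Proof.
rewrite /J -cintegralD//; [|exact: J_int|exact: J_int].
by apply: eq_cintegral => x _; rewrite hornerD mulrDl.
Qed.

Lemma J_scale s a (P : {poly C}) : J c s (a *: P) = a * J c s P.
Proof.
rewrite /J -cintegralZ//; last exact: J_int.
apply: eq_cintegral => x _; by rewrite hornerZ; move: (gw _ _ _) => g; rewrite mulrA.
Qed.

Lemma J_opp s P : J c s (- P) = - J c s P.
Proof. by rewrite -scaleN1r J_scale mulN1r. Qed.

Lemma J_muln s P n : J c s (P *+ n) = J c s P *+ n.
Proof. by rewrite -scaler_nat J_scale mulr_natl. Qed.

Lemma J_0 s : J c s 0 = 0.
Proof. by rewrite -(scale0r 0) J_scale mul0r. Qed.

(** The derivative of P(x) e^(i s x - c x^2) integrates to 0; its polynomial factor is the [Q]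
    below. *)
Lemma J_parts s P : (2 * c)%:C * J c s (P * 'X) = J c s P^`() + ii * s%:C * J c s P.
Proof.
pose Q := P^`() + (ii * s%:C) *: P - ((2 * c)%:C) *: (P * 'X).
suff : J c s Q = 0.
  rewrite /Q !J_add J_opp !J_scale => /eqP; rewrite subr_eq0 => /eqP ->; ring.
have [K1 K10 hK1] := poly_gw_bound P c0.
have [K2 K20 hK2] := poly_gw_bound Q c0.
apply: (@cintegral_FTCT _ (fun x => P.[x%:C] * gw c s x) _ (K1 + K2)).
- apply: (cder_eq (cderM (cder_poly P) (cder_gw c s))) => x //.
  rewrite /Q hornerD hornerN hornerD !hornerZ hornerM hornerX !RCM; move: (gw _ _ _) => g; ring.
- exact: ccont_poly_gw.
- by move=> x; rewrite (le_trans (hK1 _ _))// ler_wpM2r ?lor_ge0// lerDl.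
- by move=> x; rewrite (le_trans (hK2 _ _))// ler_wpM2r ?lor_ge0// lerDr.
Qed.

Lemma J_der P : cder (fun s => J c s P) (fun s => ii * J c s (P * 'X)).
Proof.
pose Q := ii *: (P * 'X).
have [K K0 hK] := poly_gw_bound Q c0.
have h : cder (fun s => J c s P) (fun s => J c s Q).
  apply: (@cder_cintegral _ setT (fun s x => P.[x%:C] * gw c s x)
    (fun s x => Q.[x%:C] * gw c s x) (fun _ x => K * lor x)) => //.
  - by move=> s; exact: J_int.
  - move=> x; apply: (cder_eq (cderZ P.[x%:C] (cder_gw_s c x))) => s //.
    by rewrite /Q hornerZ hornerM hornerX; move: (gw _ _ _) => g; ring.
  - by move=> _; exact: integrable_lorZ.
  - by move=> _ x; rewrite mulr_ge0// lor_ge0.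
by apply: (cder_eq h) => // s; rewrite J_scale.
Qed.

(** By [J_der] and [J_parts] at P = 1, J satisfies J' = - s / (2 c) J, so J times e^(s^2 / (4 c))
    has derivative 0. *)
Lemma J_one s : J c s 1 = J c 0 1 * (expR (- (s ^+ 2 / (4 * c))))%:C.
Proof.
have dE (x : R) : is_derive x 1 (fun s => expR (s ^+ 2 / (4 * c))) (x / (2 * c) * expR (x ^+ 2 / (4 * c))).
  apply: (is_derive_ext (is_derive_compR (is_derive_expR _) (is_derive_scaleR (4 * c)^-1 (is_derive_mulR (is_derive_idR x) (is_derive_idR x))))) => //.
    by move=> y; rewrite -expr2 mulrC.
  by rewrite -expr2 [_^-1 * _ ^+ 2]mulrC; field; rewrite gt_eqF.
pose F s := J c s 1 * (expR (s ^+ 2 / (4 * c)))%:C.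
have F0 : forall x, F x = F 0.
  apply: cder0_cst; apply: (cder_eq (cderM (J_der 1) (cder_real dE))) => x //.
  have := J_parts x 1; rewrite derivC J_0 add0r => E.
  have c20 : (2 * c)%:C != 0 :> C by apply: contraTneq c0 => -[/eqP]; rewrite mulf_eq0 pnatr_eq0/= => /eqP ->; rewrite ltxx.
  have -> : J c x (1 * 'X) = ((2 * c)%:C)^-1 * (ii * x%:C * J c x 1) by rewrite -E mulKf.
  rewrite (RCM (x / _)) (RCM x) RCV.
  have -> : ii * ((2 * c)%:C^-1 * (ii * x%:C * J c x 1)) = ii * ii * ((2 * c)%:C^-1 * (x%:C * J c x 1)) by ring.
  by rewrite ii2; ring.
have := F0 s; rewrite /F expr0n/= mul0r expR0 RC1 mulr1 => <-.
by rewrite -mulrA -RCM -expRD subrr expR0 RC1 mulr1.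
Qed.

End FixedWeight.

Lemma J1_0 : J 1 0 1 = (Num.sqrt pi)%:C.
Proof.
have E x : (1 : {poly C}).[x%:C] * gw 1 0 x = (gauss_fun x)%:C.
  by rewrite hornerC mul1r /gw mul0r cexpi0 !mul1r.
rewrite /J (eq_cintegral (fun x _ => E x)); apply: ceqP => /=.
  by rewrite /Rintegral integralT_gauss.
by rewrite Rintegral_cst//= mul0r.
Qed.

Lemma J1_one s : J 1 s 1 = (Num.sqrt pi * expR (- (s ^+ 2 / 4)))%:C.
Proof. by rewrite J_one// J1_0 mulr1 -RCM. Qed.

Lemma J_mulX s P : J 1 s (P * 'X) + J 1 s (P * 'X) = J 1 s P^`() + ii * s%:C * J 1 s P.
Proof. by rewrite -(J_parts ltr01) mulr1 RCnat mulr_natl mulr2n. Qed.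

(** Expand the raised factor as 2 (X + be) H_n - H_n' and integrate the factor 2 X by parts: the
    derivative of H_n cancels. There remain (i s + 2 be) times the old value and the term with the
    derivative of the other factor, which is the recurrence of [Gmn]. *)
Lemma J_herm m n al be s : J 1 s (hermps m al * hermps n be) =
  J 1 s 1 * Gmn m n (ii * s%:C + be *+ 2) (ii * s%:C + al *+ 2).
Proof.
elim: n m => [|n IH] m.
  rewrite hermps0 mulr1 /=; elim: m => [|m IH]; first by rewrite hermps0 expr0 mulr1.
  rewrite hermpsS !(J_add, J_opp, J_muln, J_scale)// J_mulX IH exprS; ring.
have E : J 1 s ((hermps m al)^`() * hermps n be) = (2 * m)%:R *
    (J 1 s 1 * Gmn m.-1 n (ii * s%:C + be *+ 2) (ii * s%:C + al *+ 2)).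
  by rewrite deriv_hermps [in LHS]mulrnAl J_muln// IH mulr_natl.
rewrite GmnSr; move: (Gmn m n _ _) (Gmn m.-1 n _ _) (IH m) E => g g' {}IH E.
rewrite hermpsS mulr2n mulrBr !mulrDr mulrA.
rewrite -scalerAr !(J_add, J_opp, J_scale)// J_mulX derivM J_add// IH E.
ring.
Qed.

End GaussianFunctional.

(** * Bounds for the Fourier transforms of Hermite products *)

Section HermiteBounds.
Context {R : realType}.
Local Notation leb := (@lebesgue_measure R).
Local Notation C := R[i].
Local Notation Re := complex.Re.
Local Notation ii := (Complex 0 1 : C).

Lemma map_hermp (K L : comNzRingType) (f : {rmorphism K -> L}) n :
  map_poly f (hermp K n) = hermp L n.
Proof.
elim: n => [|n IH] /=; first by rewrite rmorph1.
by rewrite rmorphB rmorphMn rmorphM /= map_polyX -deriv_map IH.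
Qed.

(** Differentiating H_m(y) e^(- y^2) reproduces the recurrence of [hermp] up to a sign, so the
    Rodrigues formula follows by induction on the order of the derivative. *)
Lemma hermite_hermp n (x : R) : hermite n x = (hermp R n).[x].
Proof.
have H m : (fun y : R => expR (- y ^+ 2))^`(m)%classic =
    (fun y => (-1) ^+ m * (hermp R m).[y] * expR (- y ^+ 2)).
  elim: m => [|m IH].
    by rewrite derive1n0; apply/funext => y; rewrite hornerC !mul1r.
  rewrite derive1nS IH; apply/funext => y; rewrite derive1E.
  have d1 (z : R) : is_derive z 1 (fun z => expR (- z ^+ 2)) (- (2 * z) * expR (- z ^+ 2)).
    apply: (is_derive_ext (is_derive_compR (is_derive_expR _) (is_derive_oppR (is_derive_mulR (is_derive_idR z) (is_derive_idR z))))) => //.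
    by rewrite -expr2; ring.
  have d2 := is_derive_poly (hermp R m) y.
  have := is_derive_mulR (is_derive_scaleR ((-1) ^+ m) d2) (d1 y).
  move=> d3; rewrite (@derive_val _ _ _ _ _ _ _ d3) /=.
  rewrite hornerD hornerN hornerMn hornerM hornerX [(-1) ^+ m.+1]exprS.
  by move: (expR _) (hermp R m).[y] => e H; ring.
have s2 : (-1) ^+ n * (-1) ^+ n = 1 :> R by rewrite -exprMn mulrNN mulr1 expr1n.
have e2 : expR (x ^+ 2) * expR (- x ^+ 2) = 1 by rewrite -expRD subrr expR0.
rewrite /hermite H.
transitivity ((-1) ^+ n * (-1) ^+ n * (expR (x ^+ 2) * expR (- x ^+ 2)) * (hermp R n).[x]); first by ring.
by rewrite s2 e2 !mul1r.
Qed.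

Lemma hermp_real n (x : R) : (hermp C n).[x%:C] = ((hermp R n).[x])%:C.
Proof. by rewrite -(map_hermp (real_complex R)) horner_map. Qed.

Lemma hermps_horner n al (x : C) : (hermps n al).[x] = (hermp C n).[x + al].
Proof. by rewrite /hermps horner_comp !hornerE. Qed.

Lemma hermps_id n : hermps n 0 = hermp C n.
Proof. by rewrite /hermps addr0 comp_polyXr. Qed.

(** H_n has real coefficients, hence conjugating its value conjugates the shift. The squared modulus
    thus becomes a polynomial in x, to which [J_herm] applies. *)
Lemma cmod_hermps n al (x : R) : ((cmod (hermps n al).[x%:C]) ^+ 2)%:C =
  (hermps n al * hermps n al^*).[x%:C].
Proof.
have cj z : (hermp C n).[z^*] = ((hermp C n).[z])^*.
  by rewrite -[in LHS](map_hermp (conjc : {rmorphism C -> C})) horner_map.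
rewrite hornerM !hermps_horner.
have -> : x%:C + al^* = (x%:C + al)^* by rewrite rmorphD /= oppr0.
rewrite cj; case: ((hermp C n).[_]) => a b.
rewrite /cmod sqr_sqrtr ?addr_ge0 ?sqr_ge0//.
by apply: ceqP; rewrite !cRIE/=; ring.
Qed.

Lemma exp_partial (z : R) n : 0 <= z -> \sum_(i < n) z ^+ i / i`!%:R <= expR z.
Proof.
move=> z0.
have -> : \sum_(i < n) z ^+ i / i`!%:R = series (exp_coeff z) n.
  by rewrite /series /= big_mkord; apply: eq_bigr => i _; rewrite /exp_coeff.
apply: nondecreasing_cvgn_le; last exact: is_cvg_series_exp_coeff.
apply/nondecreasing_seqP => k; rewrite /series /= big_nat_recr//= lerDl.
by rewrite /exp_coeff /= divr_ge0// exprn_ge0.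
Qed.

(* The left-hand side is 2^m m! L_m(- w), where L_m is a Laguerre polynomial. *)
Lemma laguerre_bound m (w x : R) : 0 <= w -> 0 < x < 1 ->
  \sum_(j < m.+1) ('C(m, j) * 'C(m, j) * j`! * 2 ^ j)%:R * (2 * w) ^+ (m - j) <=
  2 ^+ m * m`!%:R * x^-1 ^+ m * expR (w * (x / (1 - x))).
Proof.
move=> w0 /andP[x0 x1].
have x1' : 0 < 1 - x by rewrite subr_gt0.
have z0 : 0 <= w * (x / (1 - x)) by rewrite mulr_ge0// divr_ge0// ltW.
apply: (@le_trans _ _ (2 ^+ m * m`!%:R * x^-1 ^+ m *
   \sum_(i < m.+1) (w * (x / (1 - x))) ^+ i / i`!%:R)); last first.
  rewrite ler_wpM2l ?exp_partial//.
  by rewrite mulr_ge0// ?mulr_ge0// ?exprn_ge0// invr_ge0 ltW.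
rewrite (reindex_inj rev_ord_inj) /= mulr_sumr ler_sum// => i _.
have im : (i <= m)%N by rewrite -ltnS.
rewrite subSS bin_sub// subKn//.
have -> : ('C(m, i) * 'C(m, i) * (m - i)`! * 2 ^ (m - i))%:R * (2 * w) ^+ i =
  2 ^+ m * m`!%:R * ('C(m, i)%:R * w ^+ i / i`!%:R) :> R.
  rewrite -(bin_fact im) !natrM natrX exprMn.
  have -> : (2 : R) ^+ m = 2 ^+ (m - i) * 2 ^+ i by rewrite -exprD subnK.
  by field; rewrite pnatr_eq0 -lt0n fact_gt0.
rewrite -[leRHS]mulrA ler_wpM2l// ?mulr_ge0// ?exprn_ge0//.
(* A single term of the binomial expansion of (x + (1 - x))^m = 1. It trades the binomial
   coefficient for x^-m (x / (1 - x))^i, and the sum for a partial sum of an exponential series. *)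
have hb : 'C(m, i)%:R * x ^+ (m - i) * (1 - x) ^+ i <= 1.
  have := exprDn x (1 - x) m; rewrite addrC subrK expr1n => E.
  rewrite [leRHS]E (bigD1 (Ordinal (ltn_ord i)))//= -mulrA mulr_natl lerDl.
  by apply: sumr_ge0 => k _; rewrite mulrn_wge0// mulr_ge0// exprn_ge0// ltW.
rewrite [leRHS]mulrA ler_pM2r ?invr_gt0 ?ltr0n ?fact_gt0//.
rewrite exprMn [leRHS]mulrCA mulrC ler_wpM2l ?exprn_ge0//.
have -> : x^-1 ^+ m * (x / (1 - x)) ^+ i = (x ^+ (m - i) * (1 - x) ^+ i)^-1.
  rewrite -{1}(subnK im) exprD !exprVn expr_div_n; field.
  by rewrite !expf_neq0 ?gt_eqF.
by rewrite -[leRHS]mul1r ler_pdivlMr ?mulr_gt0 ?exprn_gt0// mulrA.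
Qed.

Definition hnorm m : R := Num.sqrt (2 ^+ m * m`!%:R * Num.sqrt pi).

Lemma hnorm_gt0 m : 0 < hnorm m.
Proof.
by rewrite sqrtr_gt0 !mulr_gt0 ?exprn_gt0 ?sqrtr_gt0 ?pi_gt0 ?ltr0n ?fact_gt0.
Qed.

Lemma hnorm2 m : hnorm m ^+ 2 = 2 ^+ m * m`!%:R * Num.sqrt pi.
Proof.
by rewrite sqr_sqrtr// !mulr_ge0// ?exprn_ge0// sqrtr_ge0.
Qed.

Definition gauss1 (x : R) : R := expR (- x ^+ 2).

(** With al = i y the squared modulus is H_m(x + al) H_m(x - al), whose Gaussian integral is [Gmn]
    at (- 2 al, 2 al). Since - 4 al^2 = 4 y^2, all terms are nonnegative and the sum has the form
    bounded in [laguerre_bound], with w = 2 y^2. *)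
Lemma hermps_sqr_int m (y : R) :
  leb.-integrable setT (EFin \o (fun x => cmod (hermps m (ii * y%:C)).[x%:C] ^+ 2 * gauss1 x)) /\
  \int[leb]_x (cmod (hermps m (ii * y%:C)).[x%:C] ^+ 2 * gauss1 x) =
  Num.sqrt pi * \sum_(j < m.+1) ('C(m, j) * 'C(m, j) * j`! * 2 ^ j)%:R * (2 * (2 * y ^+ 2)) ^+ (m - j).
Proof.
set al := ii * y%:C; set P := hermps m al * hermps m (- al).
have E x : P.[x%:C] * gw 1 0 x = (cmod (hermps m al).[x%:C] ^+ 2 * gauss1 x)%:C.
  have alc : - al = al^* by apply: ceqP; rewrite !cRIE/=; ring.
  by rewrite /P alc -cmod_hermps RCM /gw mul0r cexpi0 !mul1r.
have := @J_herm R m m al (- al) 0.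
have := J_int ltr01 0 P => -[i1 _].
rewrite -/P J1_one expr0n/= mul0r oppr0 expR0 mulr1 mulr0 !add0r.
rewrite (@Gmn_sum _ m.+1)// => H; split.
  by move: i1; apply: eq_integrable => // x _ /=; rewrite E.
have : Re (J 1 0 P) = Re (J 1 0 P) by [].
rewrite {2}H /J /= => {H} H.
transitivity (\int[leb]_x Re (P.[x%:C] * gw 1 0 x)).
  by apply: eq_Rintegral => x _; rewrite E.
rewrite H !cRIE/= mul0r subr0; congr (_ * _).
rewrite cRe_sum; apply: eq_bigr => j _.
have -> : ((- al *+ 2) ^+ (m - j)) = ((- (2 * y) )%:C * ii) ^+ (m - j).
  by congr (_ ^+ _); rewrite /al; apply: ceqP; rewrite !cRIE/=; ring.
have -> : ((al *+ 2) ^+ (m - j)) = ((2 * y)%:C * ii) ^+ (m - j).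
  by congr (_ ^+ _); rewrite /al; apply: ceqP; rewrite !cRIE/=; ring.
rewrite -mulrA -exprMn.
have -> : (- (2 * y))%:C * ii * ((2 * y)%:C * ii) = (2 * (2 * y ^+ 2))%:C.
  by apply: ceqP; rewrite !cRIE/=; ring.
by rewrite -RCX -RCnat -RCM.
Qed.

(* Contour shift by the imaginary number i y. *)
Lemma J_shift m n (s y : R) : J 1 s (hermp C m * hermp C n) =
  (expR (- (s * y) + y ^+ 2))%:C *
  J 1 (s - 2 * y) (hermps m (ii * y%:C) * hermps n (ii * y%:C)).
Proof.
(* Cauchy's theorem is bypassed: [J_herm] evaluates both sides, and the arguments of [Gmn] agree
   because i (s - 2 y) + 2 i y = i s. *)
rewrite -!hermps_id !J_herm !J1_one mulrA -RCM.
have -> : expR (- (s * y) + y ^+ 2) * (Num.sqrt pi * expR (- ((s - 2 * y) ^+ 2 / 4))) =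
   Num.sqrt pi * expR (- (s ^+ 2 / 4)).
  by rewrite mulrCA -expRD; congr (_ * expR _); field.
congr (_ * Gmn _ _ _ _).
  by apply: ceqP; rewrite !cRIE/=; ring.
by apply: ceqP; rewrite !cRIE/=; ring.
Qed.

(** After the shift by i y, AM-GM separates the two Hermite factors and [laguerre_bound] at x = e^(-
    2 u) controls each squared norm; the powers of 1 / x combine to e^(u (m + n)). *)
Lemma J_herm_bound m n (s u : R) : 0 < u ->
  cmod (J 1 s (hermp C m * hermp C n)) <=
  2 * (hnorm m * hnorm n) * expR (u * (m + n)%:R - s ^+ 2 / 4 * (u / (1 + u))).
Proof.
move=> u0; pose x := expR (- (2 * u)).
have x0 : 0 < x by exact: expR_gt0.
have x1 : x < 1 by rewrite -[ltRHS]expR0 ltr_expR oppr_lt0 mulr_gt0.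
have x01 : 0 < x < 1 by rewrite x0.
(* The minimiser of - s y + y^2 + 2 y^2 x / (1 - x). The minimum is - (s^2 / 4) (1 - x) / (1 + x),
   that is - (s^2 / 4) tanh u. *)
pose y := s * (1 - x) / (2 * (1 + x)).
pose E := expR (2 * y ^+ 2 * (x / (1 - x))).
rewrite (J_shift m n s y) cmodM cmod_real ger0_norm ?expR_ge0//.
set P := hermps m _; set Q := hermps n _.
have xV k : x^-1 ^+ k = expR (2 * u * k%:R) :> R.
  by rewrite -expRN opprK -expRM_natl mulrC.
have w0 : 0 <= 2 * y ^+ 2 by rewrite mulr_ge0// sqr_ge0.
have nb k : \int[leb]_x (cmod (hermps k (ii * y%:C)).[x%:C] ^+ 2 * gauss1 x) <=
    hnorm k ^+ 2 * expR (2 * u * k%:R) * E.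
  rewrite (hermps_sqr_int k y).2 hnorm2 -xV.
  have := laguerre_bound k w0 x01; rewrite -(ler_pM2l (_ : 0 < Num.sqrt pi :> R)) ?sqrtr_gt0 ?pi_gt0//.
  move=> h; apply: (le_trans h); rewrite le_eqVlt; apply/orP; left; apply/eqP.
  by rewrite /E; ring.
pose la := hnorm n / hnorm m * expR (u * (n%:R - m%:R)).
have la0 : 0 < la by rewrite mulr_gt0 ?expR_gt0// divr_gt0 ?hnorm_gt0.
have ip := (hermps_sqr_int m y).1; have iq := (hermps_sqr_int n y).1.
have ip' := integrableZl measurableT (la / 2) ip.
have iq' := integrableZl measurableT (la^-1 / 2) iq.
have hJ : cmod (J 1 (s - 2 * y) (P * Q)) <= 2 * \int[leb]_x
   (la / 2 * (cmod P.[x%:C] ^+ 2 * gauss1 x) + la^-1 / 2 * (cmod Q.[x%:C] ^+ 2 * gauss1 x)).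
  apply: cmod_cintegral => //; first exact: J_int.
    by have := integrableD measurableT ip' iq'; apply: eq_integrable.
  move=> z _; rewrite cmodM cmod_gw hornerM cmodM mul1r -/(gauss1 z).
  have -> : la / 2 * (cmod P.[z%:C] ^+ 2 * gauss1 z) + la^-1 / 2 * (cmod Q.[z%:C] ^+ 2 * gauss1 z) =
    (la * cmod P.[z%:C] ^+ 2 + la^-1 * cmod Q.[z%:C] ^+ 2) / 2 * gauss1 z by ring.
  rewrite ler_wpM2r ?expR_ge0// ler_pdivlMr//.
  (* AM-GM; the weight la balances the norms of the two factors *)
  rewrite -subr_ge0.
  have -> : la * cmod P.[z%:C] ^+ 2 + la^-1 * cmod Q.[z%:C] ^+ 2 - cmod P.[z%:C] * cmod Q.[z%:C] * 2 =
    la^-1 * (la * cmod P.[z%:C] - cmod Q.[z%:C]) ^+ 2 by field; rewrite gt_eqF.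
  by rewrite mulr_ge0 ?sqr_ge0// invr_ge0 ltW.
have {hJ} hJ : cmod (J 1 (s - 2 * y) (P * Q)) <= 2 * (hnorm m * hnorm n) * expR (u * (m + n)%:R) * E.
  apply: (le_trans hJ); rewrite RintegralD//.
  rewrite !RintegralZl// mulrDr.
  have e1 : la * (hnorm m ^+ 2 * expR (2 * u * m%:R) * E) = hnorm m * hnorm n * expR (u * (m + n)%:R) * E.
    rewrite /la.
    have -> : expR (u * (m + n)%:R) = expR (u * (n%:R - m%:R)) * expR (2 * u * m%:R).
      by rewrite -expRD natrD; congr expR; ring.
    by field; rewrite gt_eqF ?hnorm_gt0.
  have e2 : la^-1 * (hnorm n ^+ 2 * expR (2 * u * n%:R) * E) = hnorm m * hnorm n * expR (u * (m + n)%:R) * E.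
    rewrite /la !invfM invrK -expRN.
    have -> : expR (u * (m + n)%:R) = expR (- (u * (n%:R - m%:R))) * expR (2 * u * n%:R).
      by rewrite -expRD natrD; congr expR; ring.
    by field; rewrite gt_eqF ?hnorm_gt0.
  have b1 := nb m; have b2 := nb n.
  rewrite -(ler_pM2l la0) e1 in b1.
  rewrite -(ler_pM2l (_ : 0 < la^-1)) ?invr_gt0// e2 in b2.
  rewrite -/P in b1; rewrite -/Q in b2.
  move: b1 b2; set I1 := Rintegral _ _ _; set I2 := Rintegral _ _ _ => b1 b2.
  by lra.
apply: (le_trans (ler_wpM2l (expR_ge0 _) hJ)).
have A0 : 0 < 2 * (hnorm m * hnorm n) by rewrite !mulr_gt0 ?hnorm_gt0.
move: A0; set A := 2 * _ => A0.
have -> : expR (- (s * y) + y ^+ 2) * (A * expR (u * (m + n)%:R) * E) =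
    A * expR (u * (m + n)%:R + (- (s * y) + y ^+ 2 + 2 * y ^+ 2 * (x / (1 - x)))).
  by rewrite (expRD (u * (m + n)%:R)) (expRD (- (s * y) + y ^+ 2)) -/E; ring.
rewrite ler_pM2l// ler_expR lerD2l.
have x1' : 0 < 1 - x by rewrite subr_gt0.
have x1p : 0 < 1 + x by rewrite addr_gt0.
have u1p : 0 < 1 + u by rewrite addr_gt0.
have -> : - (s * y) + y ^+ 2 + 2 * y ^+ 2 * (x / (1 - x)) =
  - (s ^+ 2 / 4 * ((1 - x) / (1 + x))).
  by rewrite /y; field; rewrite !gt_eqF.
rewrite lerN2 ler_wpM2l ?divr_ge0 ?sqr_ge0// ler_pdivlMr// mulrAC ler_pdivrMr//.
(* The remaining inequality tanh u >= u / (1 + u) amounts to e^(2 u) >= 1 + 2 u. *)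
have : x * (1 + 2 * u) <= 1.
  rewrite /x expRN mulrC ler_pdivrMr ?expR_gt0// mul1r; exact: expR_ge1Dx.
by nra.
Qed.

End HermiteBounds.

(** * The Fock basis *)

Section WignerBasis.
Context {R : realType}.
Local Notation leb := (@lebesgue_measure R).
Local Notation C := R[i].
Local Notation ii := (Complex 0 1 : C).

Lemma hermp_rec (K : comNzRingType) n (x : K) :
  (hermp K n.+1).[x] = x * (hermp K n).[x] *+ 2 - (hermp K n.-1).[x] *+ (2 * n).
Proof.
by rewrite [hermp K n.+1]/= deriv_hermp hornerD hornerN !hornerMn hornerM hornerX mulrC.
Qed.

Lemma hermp_parity (K : comNzRingType) n (x : K) :
  (hermp K n).[- x] = (-1) ^+ n * (hermp K n).[x].
Proof.
suff H : (hermp K n).[- x] = (-1) ^+ n * (hermp K n).[x] /\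
   (hermp K n.+1).[- x] = (-1) ^+ n.+1 * (hermp K n.+1).[x] by case: H.
elim: n => [|n [IH1 IH2]].
  split; first by rewrite /= !hornerE.
  by rewrite !hermp_rec [hermp K 0]/= -[(2 * 0)%N]/0%N !mulr0n !hornerC !mulr1 expr1 mulN1r !subr0 mulNrn.
split=> //; rewrite hermp_rec [in RHS]hermp_rec [n.+1.-1]/= IH1 IH2 !exprS.
move: ((-1) ^+ n) => e; move: (hermp K n).[x] (hermp K n.+1).[x] (2 * n.+1)%N => u v k.
by rewrite !mulN1r opprK mulrBr !mulrnAr !mulNr mulrN opprK mulrCA.
Qed.

Lemma fockE m (x : R) : fock m x = (hnorm m)^-1 * (hermp R m).[x] * expR (- (x ^+ 2 / 2)).
Proof. by rewrite /fock hermite_hermp. Qed.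

(** The polynomial x -> H_m(q - x) H_n(q + x); the sign comes from H_m(q - x) = (-1)^m H_m(x -
    q). *)
Definition wpoly m n (q : R) : {poly C} := (-1) ^+ m *: (hermps m (- q%:C) * hermps n q%:C).

Definition nrm m n : R := (hnorm m * hnorm n)^-1.

Lemma nrm_gt0 m n : 0 < nrm m n.
Proof. by rewrite invr_gt0 mulr_gt0// hnorm_gt0. Qed.

Lemma wpoly_fock m n (q x : R) : (fock m (q - x) * fock n (q + x))%:C =
  (nrm m n * expR (- q ^+ 2) * expR (- (1 * x ^+ 2)))%:C * (wpoly m n q).[x%:C].
Proof.
have -> : (wpoly m n q).[x%:C] = ((hermp R m).[q - x] * (hermp R n).[q + x])%:C.
  rewrite /wpoly hornerZ hornerM !hermps_horner.
  have -> : x%:C + - q%:C = - (q - x)%:C by rewrite RCD RCN opprD opprK addrC.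
  rewrite -RCD hermp_parity !hermp_real !mulrA -exprMn mulrNN mulr1 expr1n mul1r.
  by rewrite -RCM [x + q]addrC.
rewrite -RCM; congr real_complex_def; rewrite !fockE /nrm invfM.
have E : expR (- q ^+ 2) * expR (- (1 * x ^+ 2)) =
   expR (- ((q - x) ^+ 2 / 2)) * expR (- ((q + x) ^+ 2 / 2)).
  by rewrite -!expRD; congr expR; field.
rewrite -[X in _ = X * _]mulrA E; ring.
Qed.

Lemma wigner_J m n (q p : R) : wigner_mn m n q p =
  (pi^-1 * (nrm m n * expR (- q ^+ 2)))%:C * J 1 (2 * p) (wpoly m n q).
Proof.
rewrite /wigner_mn RCM -mulrA; congr (_ * _).
rewrite -J_scale//; apply: eq_cintegral => x _.
by rewrite wpoly_fock hornerZ RCM /gw; ring.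
Qed.

(** The form from which rotations are read off: with z = q + i p, the point enters only through 2 z,
    - 2 conj(z) and |z|^2. *)
Lemma wigner_G m n (q p : R) : wigner_mn m n q p =
  (pi^-1 * nrm m n * Num.sqrt pi * expR (- (q ^+ 2 + p ^+ 2)))%:C * ((-1) ^+ m *
  Gmn m n ((2 : C) * (q +i* p)) (- (2 * (q -i* p)))).
Proof.
rewrite wigner_J /wpoly J_scale// J_herm J1_one.
have -> : ii * (2 * p)%:C + q%:C *+ 2 = 2 * (q +i* p).
  by apply: ceqP; rewrite !cRIE/=; ring.
have -> : ii * (2 * p)%:C + - q%:C *+ 2 = - (2 * (q -i* p)).
  by apply: ceqP; rewrite !cRIE/=; ring.
have -> : expR (- (q ^+ 2 + p ^+ 2)) = expR (- q ^+ 2) * expR (- ((2 * p) ^+ 2 / 4)).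
  by rewrite -expRD; congr expR; field.
by rewrite !RCM; ring.
Qed.

Lemma J_G m n (s : R) : J 1 s (hermp C m * hermp C n) =
  (Num.sqrt pi * expR (- (s ^+ 2 / 4)))%:C * Gmn m n (ii * s%:C) (ii * s%:C).
Proof. by rewrite -!hermps_id J_herm J1_one mul0rn addr0. Qed.

Lemma cmod_sign m : cmod ((-1) ^+ m : C) = 1.
Proof. by rewrite cmodX cmodN -RC1 cmod_real normr1 expr1n. Qed.

(** By [Gmn_homog] a unimodular factor turns the arguments at (q, p) into those of c_mn at frequency
    2 |z| without changing the modulus. Every bound on c_mn is therefore also a bound on W_mn. *)
Lemma cmod_wigner m n (q p : R) : cmod (wigner_mn m n q p) =
  pi^-1 * nrm m n * cmod (J 1 (2 * Num.sqrt (q ^+ 2 + p ^+ 2)) (hermp C m * hermp C n)).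
Proof.
set r := Num.sqrt _.
have r2 : r ^+ 2 = q ^+ 2 + p ^+ 2 by rewrite sqr_sqrtr// addr_ge0// sqr_ge0.
have r0 : 0 <= r by exact: sqrtr_ge0.
rewrite wigner_G J_G !cmodM cmod_sign mul1r !cmod_real.
rewrite !ger0_norm ?mulr_ge0 ?invr_ge0 ?expR_ge0 ?sqrtr_ge0 ?pi_ge0 ?ltW ?mulr_gt0 ?hnorm_gt0//.
have -> : (2 * r) ^+ 2 / 4 = q ^+ 2 + p ^+ 2 by rewrite -r2; field.
rewrite -!mulrA; do 4 congr (_ * _).
have [rz|rn0] := eqVneq r 0.
  have /eqP : q ^+ 2 + p ^+ 2 = 0 by rewrite -r2 rz expr0n.
  rewrite paddr_eq0 ?sqr_ge0// !sqrf_eq0 => /andP[/eqP -> /eqP ->].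
  by rewrite rz !mulr0; congr (cmod (Gmn _ _ _ _)); apply: ceqP; rewrite !cRIE/=; ring.
(* l = - i (q + i p) / r, so that l (2 i r) = 2 (q + i p). *)
pose l : C := (p / r) -i* (q / r); pose l' : C := (p / r) +i* (q / r).
have ll : l * l' = 1.
  have e : p / r * (p / r) + q / r * (q / r) = 1.
    by rewrite -!expr2 !expr_div_n -mulrDl addrC -r2 divff// sqrf_eq0.
  by apply: ceqP; rewrite !cRIE/=; [rewrite -e|]; ring.
have l1 : cmod l' = 1.
  by rewrite /cmod /l' /= !expr_div_n -mulrDl addrC -r2 divff ?sqrf_eq0// sqrtr1.
have := Gmn_homog m n (ii * (2 * r)%:C) (ii * (2 * r)%:C) ll.
have -> : l * (ii * (2 * r)%:C) = 2 * (q +i* p).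
  by apply: ceqP; rewrite !cRIE/=; field.
have -> : l' * (ii * (2 * r)%:C) = - (2 * (q -i* p)).
  by apply: ceqP; rewrite !cRIE/=; field.
by move=> /(congr1 cmod); rewrite !cmodM !cmodX l1 !expr1n !mul1r.
Qed.

Lemma cexpiX (x : R) n : cexpi x ^+ n = cexpi (n%:R * x).
Proof.
elim: n => [|n IH]; first by rewrite mul0r cexpi0.
by rewrite exprS IH -cexpiD -natr1 mulrDl mul1r addrC.
Qed.

(** The rotation multiplies q + i p by e^(i phi), to which [Gmn_homog] answers with e^(i (n - m)
    phi). *)
Lemma wigner_rot m n (x t phi : R) :
  wigner_mn m n (x * cos phi - t * sin phi) (x * sin phi + t * cos phi) =
  cexpi ((n%:R - m%:R) * phi) * wigner_mn m n x t.
Proof.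
rewrite !wigner_G.
have -> : (x * cos phi - t * sin phi) ^+ 2 + (x * sin phi + t * cos phi) ^+ 2 = x ^+ 2 + t ^+ 2.
  have := cos2Dsin2 phi => e.
  transitivity ((x ^+ 2 + t ^+ 2) * (cos phi ^+ 2 + sin phi ^+ 2)); first by ring.
  by rewrite e mulr1.
rewrite [RHS]mulrCA [cexpi _ * _]mulrCA; congr (_ * (_ * _)).
pose l := cexpi phi; pose l' := cexpi (- phi).
have ll : l * l' = 1 by rewrite -cexpiD subrr cexpi0.
have := Gmn_homog m n ((2 : C) * (x +i* t)) (- (2 * (x -i* t))) ll.
have -> : l * (2 * (x +i* t)) = 2 * ((x * cos phi - t * sin phi) +i* (x * sin phi + t * cos phi)).
  by apply: ceqP; rewrite !cRIE/=; ring.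
have -> : l' * - (2 * (x -i* t)) = - (2 * ((x * cos phi - t * sin phi) -i* (x * sin phi + t * cos phi))).
  by apply: ceqP; rewrite !cRIE/= cosN sinN; ring.
move=> /(congr1 (fun z => l ^+ n * z)); rewrite !mulrA -exprMn ll expr1n mul1r => ->.
by rewrite !cexpiX -cexpiD; congr (cexpi _ * _); ring.
Qed.

Lemma J_bounded (P : {poly C}) : exists2 K : R, 0 <= K & forall s, cmod (J 1 s P) <= K.
Proof.
have [K K0 hK] := poly_gw_bound P (ltr01 : (0 : R) < 1).
exists (2 * \int[leb]_x (K * lor x)).
  by rewrite mulr_ge0// Rintegral_ge0// => x _; rewrite mulr_ge0// lor_ge0.
move=> s; apply: cmod_cintegral => //; [exact: J_int|exact: integrable_lorZ].
Qed.

(** [J_mulX] rewrites i s J(P) through values of J at other polynomials, which are bounded in s. A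
    second use of it gives the decay of [J_decay]. *)
Lemma J_sbounded (P : {poly C}) : exists2 K : R, 0 <= K & forall s, `|s| * cmod (J 1 s P) <= K.
Proof.
have [K1 K10 h1] := J_bounded (P * 'X); have [K2 K20 h2] := J_bounded P^`().
exists (2 * K1 + K2); first by rewrite addr_ge0// mulr_ge0.
move=> s.
have -> : `|s| * cmod (J 1 s P) = cmod (ii * s%:C * J 1 s P).
  by rewrite !cmodM cmod_ii mul1r cmod_real.
have -> : ii * s%:C * J 1 s P = J 1 s (P * 'X) + J 1 s (P * 'X) - J 1 s P^`().
  by rewrite J_mulX addrC addKr.
rewrite (le_trans (cmodD _ _))// cmodN lerD// mulrDl mul1r (le_trans (cmodD _ _))//.
by rewrite lerD.
Qed.

Lemma J_decay (P : {poly C}) : exists2 K : R, 0 <= K & forall s, cmod (J 1 (2 * s) P) <= K * lor s.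
Proof.
have [K0 K00 h0] := J_bounded P; have [K1 K10 h1] := J_sbounded (P * 'X); have [K2 K20 h2] := J_sbounded P^`().
exists (K0 + 2 * K1 + K2); first by rewrite !addr_ge0// mulr_ge0.
move=> s; rewrite /lor ler_pdivlMr ?ltr_pwDl ?sqr_ge0//.
have h : (2 * s) ^+ 2 * cmod (J 1 (2 * s) P) <= 2 * K1 + K2.
  have -> : (2 * s) ^+ 2 * cmod (J 1 (2 * s) P) =
      `|2 * s| * cmod (ii * (2 * s)%:C * J 1 (2 * s) P).
    by rewrite !cmodM cmod_ii mul1r cmod_real mulrA -expr2 real_normK ?num_real.
  have -> : ii * (2 * s)%:C * J 1 (2 * s) P = J 1 (2 * s) (P * 'X) + J 1 (2 * s) (P * 'X) - J 1 (2 * s) P^`().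
    by rewrite J_mulX addrC addKr.
  have := h1 (2 * s); have := h2 (2 * s); move: (normr_ge0 (2 * s)); set a := `|_| => a0 g2 g1.
  have := cmodD (J 1 (2 * s) (P * 'X) + J 1 (2 * s) (P * 'X)) (- J 1 (2 * s) P^`()).
  have := cmodD (J 1 (2 * s) (P * 'X)) (J 1 (2 * s) (P * 'X)).
  by rewrite cmodN; nra.
have := h0 (2 * s); have := cmod_ge0 (J 1 (2 * s) P); move: (sqr_ge0 s) h; rewrite exprMn.
by nra.
Qed.

Lemma cder_scale2 (F f : R -> C) : cder F f -> cder (fun t => F (2 * t)) (fun t => 2 * f (2 * t)).
Proof.
move=> h x; have [h1 h2] := h (2 * x); split.
  by apply: (is_derive_ext (is_derive_compR h1 (is_derive_scaleR 2 (is_derive_idR x)))) => //; rewrite !cRIE/=; ring.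
by apply: (is_derive_ext (is_derive_compR h2 (is_derive_scaleR 2 (is_derive_idR x)))) => //; rewrite !cRIE/=; ring.
Qed.

Lemma ccont_J2 (P : {poly C}) : ccont (fun t => J 1 (2 * t) P).
Proof. exact: cder_cont (cder_scale2 (J_der ltr01 P)). Qed.

Lemma Cint_J2 (P : {poly C}) : Cint setT (fun t => J 1 (2 * t) P).
Proof.
have [K _ hK] := J_decay P.
by apply: Cint_dom (integrable_lorZ K) _ => //; exact: ccont_J2.
Qed.

(** Fourier inversion at the origin. Write the polynomial as P X + c: by [J_der] the first part is a
    derivative in t and integrates to 0, and the constant contributes a Gaussian integral. *)
Lemma cintegral_J2 (P : {poly C}) :
  cintegral setT (fun t => J 1 (2 * t) P) = pi%:C * P.[0].
Proof.
elim/poly_ind: P => [|P c _].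
  rewrite horner0 mulr0 (@eq_cintegral _ _ _ (fun _ => 0)) => [|t _]; last by rewrite J_0.
  by apply: ceqP => /=; rewrite Rintegral_cst//= mul0r.
have [K1 _ h1] := J_decay P; have [K2 _ h2] := J_decay (2 *: (ii *: (P * 'X))).
have E t : J 1 (2 * t) (P * 'X + c%:P) = (2 * ii)^-1 * J 1 (2 * t) (2 *: (ii *: (P * 'X))) + c * J 1 (2 * t) 1.
  rewrite J_add// -(alg_polyC c) !J_scale//; congr (_ + _).
  rewrite mulrA mulKf//; apply: contraTneq isT => E.
  have : (2 : R) = 0 by have := congr1 (@complex.Im R) E; rewrite !cRIE/=; lra.
  by move/eqP; rewrite pnatr_eq0.
rewrite (eq_cintegral (fun t _ => E t)) cintegralD//; last 2 first.
  by apply: Cint_scale => //; exact: Cint_J2.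
  by apply: Cint_scale => //; exact: Cint_J2.
rewrite !cintegralZ//; [|exact: Cint_J2|exact: Cint_J2].
rewrite hornerD hornerC hornerM hornerX mulr0 add0r.
rewrite (@cintegral_FTCT _ (fun t => J 1 (2 * t) P) _ (Num.max K1 K2)); last 4 first.
- by apply: (cder_eq (cder_scale2 (J_der ltr01 P))) => // t; rewrite !J_scale.
- exact: ccont_J2.
- by move=> t; rewrite (le_trans (h1 _))// ler_wpM2r ?lor_ge0// le_max lexx.
- by move=> t; rewrite (le_trans (h2 _))// ler_wpM2r ?lor_ge0// le_max lexx orbT.
rewrite mulr0 add0r mulrC; congr (_ * _).
have G (t : R) : J 1 (2 * t) 1 = (Num.sqrt pi * gauss_fun t)%:C.
  by rewrite J1_one; congr (_ * _)%:C; congr expR; field.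
rewrite (eq_cintegral (fun t _ => G t)); apply: ceqP => /=; last by rewrite Rintegral_cst//= mul0r.
rewrite RintegralZl//; last exact: integrableT_gauss.
by rewrite /Rintegral integralT_gauss/= -expr2 sqr_sqrtr// pi_ge0.
Qed.

(** The marginal property at angle 0; [wigner_rot] carries it to all other angles. *)
Lemma cintegral_wigner m n (x : R) :
  cintegral setT (fun t => wigner_mn m n x t) = (fock m x * fock n x)%:C.
Proof.
rewrite (eq_cintegral (fun t _ => wigner_J m n x t)) cintegralZ//; last exact: Cint_J2.
rewrite cintegral_J2.
have := wpoly_fock m n x 0; rewrite subr0 addr0 expr0n/= mulr0 oppr0 expR0 mulr1 => ->.
rewrite mulrA -RCM; congr (_%:C * _).
by rewrite mulrAC mulVf ?mul1r ?gt_eqF ?pi_gt0.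
Qed.

End WignerBasis.

(** * Fourier inversion on the Fock basis *)

Section FockCoefficients.
Context {R : realType}.
Local Notation leb := (@lebesgue_measure R).
Local Notation C := R[i].
Local Notation ii := (Complex 0 1 : C).

(** Decay faster than every power. The Lorentzian on the right makes each t^j f(t) both integrable
    and null at infinity. *)
Definition rapid (f : R -> C) := forall j : nat, exists K : R,
  forall t, `|t| ^+ j * cmod (f t) <= K * lor t.

Lemma rapidD f g : rapid f -> rapid g -> rapid (fun t => f t + g t).
Proof.
move=> hf hg j; have [K hK] := hf j; have [L hL] := hg j.
exists (K + L) => t; rewrite mulrDl (le_trans _ (lerD (hK t) (hL t)))// -mulrDr.
by rewrite ler_wpM2l ?exprn_ge0// cmodD.
Qed.

Lemma rapidZ (c : C) f : rapid f -> rapid (fun t => c * f t).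
Proof.
move=> hf j; have [K hK] := hf j; exists (cmod c * K) => t.
by rewrite cmodM mulrCA -mulrA ler_wpM2l// cmod_ge0.
Qed.

Lemma rapidX f : rapid f -> rapid (fun t => t%:C * f t).
Proof.
move=> hf j; have [K hK] := hf j.+1; exists K => t.
by rewrite cmodM cmod_real mulrA -exprSr.
Qed.

Lemma rapidM f g M : rapid f -> (forall t, cmod (g t) <= M) -> rapid (fun t => f t * g t).
Proof.
move=> hf hg j; have [K hK] := hf j; exists (M * K) => t.
rewrite cmodM mulrA mulrC -mulrA ler_pM ?cmod_ge0 ?mulr_ge0 ?exprn_ge0 ?cmod_ge0//.
Qed.

Lemma rapid_eq f g : f =1 g -> rapid f -> rapid g.
Proof. by move=> /funext ->. Qed.

Lemma rapid_bound f : rapid f -> exists K, forall t, cmod (f t) <= K * lor t.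
Proof. by move=> /(_ 0%N)[K hK]; exists K => t; rewrite -[leLHS]mul1r -(expr0 `|t|). Qed.

Lemma gauss_rapid (f : R -> C) (K c : R) : 0 < c -> 0 <= K ->
  (forall t, cmod (f t) <= K * expR (- (c * t ^+ 2))) -> rapid f.
Proof.
move=> c0 K0 hf j; exists (j%:R ^+ j * K * expR ((1 + 2) ^+ 2 / (4 * c))) => t.
apply: (@le_trans _ _ ((j%:R ^+ j * expR `|t|) * (K * expR (- (c * t ^+ 2))))).
  by rewrite ler_pM ?exprn_ge0 ?cmod_ge0// pow_le_exp.
rewrite mulrACA -[leRHS]mulrA ler_wpM2l ?mulr_ge0 ?exprn_ge0// -expRD.
by have := @exp_gauss_lor _ 1 c t c0; rewrite mul1r.
Qed.

(** Without normalisation: multiplied by [nrm m n] it is the Fourier transform of h_m h_n, as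
    [fock_fourier] shows. *)
Definition cmn m n (t : R) : C := J 1 t (hermp C m * hermp C n).

Lemma rapid_cmn m n : rapid (cmn m n).
Proof.
apply: (@gauss_rapid _ (2 * (hnorm m * hnorm n) * expR (m + n)%:R) 8^-1) => //.
  by rewrite mulr_ge0 ?expR_ge0// !mulr_ge0// ltW// hnorm_gt0.
move=> t; rewrite (le_trans (J_herm_bound m n t ltr01))//.
have A0 : 0 <= 2 * (hnorm m * hnorm n) :> R by rewrite !mulr_ge0// ltW// hnorm_gt0.
have -> : (1 + 1 : R) = 2 by [].
by rewrite -[leRHS]mulrA -expRD mul1r ler_wpM2l// ler_expR; lra.
Qed.

Lemma cmnC m n : cmn m n = cmn n m.
Proof. by apply/funext => t; rewrite /cmn mulrC. Qed.

Lemma cmnSr m n t : cmn m n.+1 t = ii * t%:C * cmn m n t + (2 * m)%:R * cmn m.-1 n t.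
Proof. by rewrite /cmn !J_G GmnSr; move: (Gmn m n _ _) (Gmn m.-1 n _ _) => g g'; ring. Qed.

Lemma cmnSl m n t : cmn m.+1 n t = ii * t%:C * cmn m n t + (2 * n)%:R * cmn m n.-1 t.
Proof. by rewrite cmnC cmnSr ![cmn n _]cmnC [cmn n.-1 m]cmnC. Qed.

Definition dcmn m n (t : R) : C := ii * (m%:R * cmn m.-1 n t + n%:R * cmn m n.-1 t)
  - (t / 2)%:C * cmn m n t.

Lemma cder_cmn m n : cder (cmn m n) (dcmn m n).
Proof.
apply: (cder_eq (J_der ltr01 (hermp C m * hermp C n))) => // t.
have E := @J_mulX R t (hermp C m * hermp C n).
have E2 : J 1 t (hermp C m * hermp C n)^`() = (2 * m)%:R * cmn m.-1 n t + (2 * n)%:R * cmn m n.-1 t.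
  rewrite derivM J_add// !deriv_hermp [in LHS]mulrnAl [in LHS]mulrnAr.
  by rewrite !J_muln// !mulr_natl.
rewrite E2 in E.
have -> : J 1 t (hermp C m * hermp C n * 'X) = 2^-1 * (J 1 t (hermp C m * hermp C n * 'X) + J 1 t (hermp C m * hermp C n * 'X)).
  by field.
rewrite E /dcmn !natrM RCM RCV RCnat -/(cmn m n t).
have : ii * ii = -1 :> C := ii2.
move: (cmn m n t) (cmn m.-1 n t) (cmn m n.-1 t) => x y z i2.
transitivity (ii * (m%:R * y + n%:R * z) + ii * ii * (t%:C * x / 2)); first by field.
by rewrite i2; field.
Qed.

Lemma ccont_cmn m n : ccont (cmn m n). Proof. exact: cder_cont (cder_cmn m n). Qed.

(** Both raising recurrences express c_mn through c_(m-1,n-1); in n c_mn - m c_mn these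
    contributions, 2 m n c_(m-1,n-1) each, cancel. *)
Lemma cmn_euler m n t :
  ii * (n%:R - m%:R) * cmn m n t = t%:C * (m%:R * cmn m.-1 n t - n%:R * cmn m n.-1 t).
Proof.
have h1 : n%:R * cmn m n t = n%:R * (ii * t%:C * cmn m n.-1 t + (2 * m)%:R * cmn m.-1 n.-1 t).
  by case: n => [|n]; rewrite ?mul0r// cmnSr.
have h2 : m%:R * cmn m n t = m%:R * (ii * t%:C * cmn m.-1 n t + (2 * n)%:R * cmn m.-1 n.-1 t).
  by case: m h1 => [|m] h1; rewrite ?mul0r// cmnSl.
have : ii * ii = -1 :> C := ii2.
rewrite mulrAC mulrBr -[X in X - _]mulrA -[X in _ - X]mulrA ![cmn m n t * _]mulrC h1 h2 !natrM.
move: (cmn m n.-1 t) (cmn m.-1 n t) (cmn m.-1 n.-1 t) => x y z i2.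
transitivity (ii * ii * t%:C * (n%:R * x - m%:R * y)); first by ring.
by rewrite i2; ring.
Qed.

(** * Angular integrals and their Bessel recurrences *)

Section Angular.
Variables q p : R.
Local Notation z := (q +i* p : C).
Local Notation zc := (q -i* p : C).

Definition pj (phi : R) : R := q * cos phi + p * sin phi.
Definition dpj (phi : R) : R := p * cos phi - q * sin phi.

(* The term with (-1) ^+ (m + n) stands for the opposite direction phi + pi, so
   that the integral over [0, pi] is the integral over the circle. *)
Definition Efun m n (t phi : R) : C :=
  (cexpi (- (t * pj phi)) + (-1) ^+ (m + n) * cexpi (t * pj phi)) * cexpi ((n%:R - m%:R) * phi).

(** The companion of [Efun] with the opposite sign: both neighbours (m, n + 1) and (m + 1, n) of
    [Efun] equal it up to e^(i phi) or e^(- i phi). *)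
Definition Dfun m n (t phi : R) : C :=
  (cexpi (- (t * pj phi)) - (-1) ^+ (m + n) * cexpi (t * pj phi)) * cexpi ((n%:R - m%:R) * phi).

Lemma EfunSS m n t phi : Efun m.+1 n.+1 t phi = Efun m n t phi.
Proof.
rewrite /Efun addSn addnS !exprS mulrA mulrNN mulr1 mul1r.
by congr (_ * cexpi (_ * _)); rewrite -!natr1; ring.
Qed.

Lemma Efun_Sr m n t phi : Efun m n.+1 t phi = cexpi phi * Dfun m n t phi.
Proof.
rewrite /Efun /Dfun addnS exprS mulN1r mulNr [RHS]mulrCA; congr (_ * _).
by rewrite -cexpiD; congr cexpi; rewrite -natr1; ring.
Qed.

Lemma Efun_Sl m n t phi : Efun m.+1 n t phi = cexpi (- phi) * Dfun m n t phi.
Proof.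
rewrite /Efun /Dfun addSn exprS mulN1r mulNr [RHS]mulrCA; congr (_ * _).
by rewrite -cexpiD; congr cexpi; rewrite -natr1; ring.
Qed.

Lemma zc_exp phi : zc * cexpi phi = pj phi -i* dpj phi.
Proof. by apply: ceqP; rewrite !cRIE/= /pj /dpj; ring. Qed.
Lemma z_exp phi : z * cexpi (- phi) = pj phi +i* dpj phi.
Proof. by apply: ceqP; rewrite !cRIE/= cosN sinN /pj /dpj; ring. Qed.

(** Differentiation brings down pj = (zc e^(i phi) + z e^(- i phi)) / 2, and the two exponentials
    raise n and m respectively. In [cder_Efun_phi] the difference of the same two terms appears,
    through dpj. *)
Lemma cder_Efun_t m n phi : cder (fun t => Efun m n t phi)
  (fun t => - (ii / 2) * (zc * Efun m n.+1 t phi + z * Efun m.+1 n t phi)).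
Proof.
have d1 : cder (fun t => cexpi (- (t * pj phi))) (fun t => ii * (- pj phi)%:C * cexpi (- (t * pj phi))).
  apply: cder_cexpi => t; apply: (is_derive_ext (is_derive_oppR (is_derive_mulR (is_derive_idR t) (is_derive_cstR (pj phi) t)))) => //; ring.
have d2 : cder (fun t => cexpi (t * pj phi)) (fun t => ii * (pj phi)%:C * cexpi (t * pj phi)).
  apply: cder_cexpi => t; apply: (is_derive_ext (is_derive_mulR (is_derive_idR t) (is_derive_cstR (pj phi) t))) => //; ring.
have d3 := cderM (cderD d1 (cderZ ((-1) ^+ (m + n)) d2)) (cder_cst (cexpi ((n%:R - m%:R) * phi))).
apply: (cder_eq d3) => t //.
rewrite Efun_Sr Efun_Sl (mulrA zc) (mulrA z) zc_exp z_exp -mulrDl.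
have -> : (pj phi -i* dpj phi) + (pj phi +i* dpj phi) = 2 * (pj phi)%:C.
  by apply: ceqP; rewrite !cRIE/=; ring.
rewrite /Dfun RCN.
move: (cexpi (- (t * pj phi))) (cexpi (t * pj phi)) (cexpi ((n%:R - m%:R) * phi)) ((-1) ^+ (m + n)) => a b c e.
by field.
Qed.

Lemma cder_Efun_phi m n t : cder (Efun m n t)
  (fun phi => (t / 2)%:C * (zc * Efun m n.+1 t phi - z * Efun m.+1 n t phi)
     + ii * (n%:R - m%:R) * Efun m n t phi).
Proof.
have dp (x : R) : is_derive x 1 (fun x => t * pj x) (t * dpj x).
  apply: (is_derive_ext (is_derive_scaleR t (is_derive_addR (is_derive_scaleR q (is_derive_cos x)) (is_derive_scaleR p (is_derive_sin x))))) => //.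
  by rewrite /dpj; ring.
have d1 := cder_cexpi (fun x => is_derive_oppR (dp x)); have d2 := cder_cexpi dp.
have d3 := cder_cexpi (fun x : R => is_derive_scaleR (n%:R - m%:R) (is_derive_idR x)).
have d4 := cderM (cderD d1 (cderZ ((-1) ^+ (m + n)) d2)) d3.
apply: (cder_eq d4) => phi //.
rewrite Efun_Sr Efun_Sl (mulrA zc) (mulrA z) zc_exp z_exp -mulrBl.
have -> : (pj phi -i* dpj phi) - (pj phi +i* dpj phi) = - (2 * ii * (dpj phi)%:C).
  by apply: ceqP; rewrite !cRIE/=; ring.
rewrite mulr1 /Dfun /Efun !RCM RCN !RCM RCV RCD RCN !RCnat.
move: (cexpi (- (t * pj phi))) (cexpi (t * pj phi)) (cexpi ((n%:R - m%:R) * phi)) ((-1) ^+ (m + n)) => a b c e.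
by field.
Qed.

Lemma cmod_Efun m n t phi : cmod (Efun m n t phi) <= 2.
Proof.
rewrite /Efun cmodM cmod_cexpi mulr1 (le_trans (cmodD _ _))//.
by rewrite cmodM cmod_sign !cmod_cexpi mul1r.
Qed.

(** Up to a constant and a phase, the Bessel function of order n - m at t |z|. This identification
    guides the recurrences but is not proved. *)
Definition Amn m n (t : R) : C := cintegral `[0, pi] (Efun m n t).

Lemma Cint_Efun m n t : Cint `[0, pi] (Efun m n t).
Proof. by apply: Cint_seg; exact: cder_cont (cder_Efun_phi m n t). Qed.

Lemma cmod_Amn m n t : cmod (Amn m n t) <= 4 * pi.
Proof.
have i2 : leb.-integrable `[0, pi] (EFin \o (fun _ => 2 : R)).
  by apply: continuous_integrable_seg => x; exact: cvg_cst.
rewrite (le_trans (cmod_cintegral _ (Cint_Efun m n t) i2 _))//.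
  by move=> x _; exact: cmod_Efun.
have d (x : R) : is_derive x 1 (fun x => 2 * x) 2.
  by apply: (is_derive_ext (is_derive_scaleR 2 (is_derive_idR x))) => //; rewrite mulr1.
rewrite (Rintegral_FTC2 (pi_gt0 R) d) => [|x]; last exact: cvg_cst.
by rewrite mulr0 subr0 mulrA -natrM.
Qed.

Lemma AmnSS m n t : Amn m.+1 n.+1 t = Amn m n t.
Proof. by apply: eq_cintegral => phi _; rewrite EfunSS. Qed.

Lemma cder_Amn m n : cder (Amn m n)
  (fun t => - (ii / 2) * (zc * Amn m n.+1 t + z * Amn m.+1 n t)).
Proof.
have i2 : leb.-integrable `[0, pi] (EFin \o (fun _ => 2 * (cmod zc + cmod z))).
  by apply: continuous_integrable_seg => x; exact: cvg_cst.
have M0 : 0 <= 2 * (cmod zc + cmod z) by rewrite mulr_ge0// addr_ge0// cmod_ge0.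
have h : cder (Amn m n) (fun t => cintegral `[0, pi] (fun phi => - (ii / 2) * (zc * Efun m n.+1 t phi + z * Efun m.+1 n t phi))).
  apply: (@cder_cintegral _ `[0, pi]%classic (Efun m n) _ (fun _ _ => 2 * (cmod zc + cmod z))) => //.
  - by move=> s; exact: Cint_Efun.
  - by move=> phi; exact: cder_Efun_t.
  - move=> _ s x _ _; rewrite cmodM cmodN.
    have -> : cmod (ii / 2) = 2^-1.
      by rewrite /cmod !cRIE/= !mul0r; rewrite (_ : _ + _ = 2^-1 ^+ 2) ?sqrtr_sqr ?ger0_norm//; field.
    have h1 := cmodD (zc * Efun m n.+1 s x) (z * Efun m.+1 n s x).
    rewrite (cmodM zc) (cmodM z) in h1.
    have h2 := cmod_Efun m n.+1 s x; have h3 := cmod_Efun m.+1 n s x.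
    have := cmod_ge0 zc; have := cmod_ge0 z; have := cmod_ge0 (Efun m n.+1 s x); have := cmod_ge0 (Efun m.+1 n s x).
    nra.
apply: (cder_eq h) => // t.
have i1 := Cint_scale zc (measurable_itv _) (Cint_Efun m n.+1 t).
have i3 := Cint_scale z (measurable_itv _) (Cint_Efun m.+1 n t).
by rewrite cintegralZ// ?cintegralD// ?cintegralZ//; [exact: Cint_Efun|exact: Cint_Efun|exact: Cint_add].
Qed.

Lemma cexpi_pi : cexpi (pi : R) = -1.
Proof. by apply: ceqP; rewrite !cRIE/= (cospi, sinpi)// oppr0. Qed.

(** At phi = pi the direction is reversed, which exchanges the two exponentials; the factor e^(i (n
    - m) pi) = (-1)^(m + n) restores their coefficients. *)
Lemma Efun_pi m n t : Efun m n t pi = Efun m n t 0.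
Proof.
rewrite /Efun /pj cospi sinpi cos0 sin0 !mulr0 !addr0 mulrN1 mulr1 cexpi0 mulr1.
have -> : cexpi ((n%:R - m%:R) * pi) = (-1) ^+ (m + n) :> C.
  rewrite mulrBl cexpiD -cexpiX -mulrN -cexpiX.
  have -> : cexpi (- pi) = -1 :> C by apply: ceqP; rewrite !cRIE/= ?cosN ?sinN (cospi, sinpi)// oppr0.
  by rewrite cexpi_pi -exprD addnC.
rewrite mulrN opprK mulrDl mulrAC -exprD addnn -mul2n exprM sqrrN expr1n expr1n mul1r.
by rewrite addrC; congr (_ + _); rewrite mulrC.
Qed.

(** The integral of the phi-derivative of [Efun] is a difference of boundary values, which is 0 by
    [Efun_pi]. It is the relation between three consecutive Bessel functions. *)
Lemma Amn_phi m n t : (t / 2)%:C * (zc * Amn m n.+1 t - z * Amn m.+1 n t)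
  + ii * (n%:R - m%:R) * Amn m n t = 0.
Proof.
have i1 := Cint_scale zc (measurable_itv _) (Cint_Efun m n.+1 t).
have i3 := Cint_scale (- z) (measurable_itv _) (Cint_Efun m.+1 n t).
have c1 := cder_cont (cder_Efun_phi m n t).
have c2 := cder_cont (cder_Efun_phi m n.+1 t).
have c3 := cder_cont (cder_Efun_phi m.+1 n t).
have cc : ccont (fun phi => (t / 2)%:C * (zc * Efun m n.+1 t phi - z * Efun m.+1 n t phi)
     + ii * (n%:R - m%:R) * Efun m n t phi).
  apply: ccontD; apply: ccontM; [exact: ccont_cst| |exact: ccont_cst|by []].
  have := ccontD (ccontM (ccont_cst zc) c2) (ccontM (ccont_cst (- z)) c3).
  by congr ccont; apply/funext => phi; rewrite mulNr.
have := cintegral_FTC2 (pi_gt0 R) (cder_Efun_phi m n t) cc.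
rewrite Efun_pi subrr => <-.
have E phi : (t / 2)%:C * (zc * Efun m n.+1 t phi - z * Efun m.+1 n t phi) +
   ii * (n%:R - m%:R) * Efun m n t phi =
   (t / 2)%:C * (zc * Efun m n.+1 t phi + (- z) * Efun m.+1 n t phi) +
   ii * (n%:R - m%:R) * Efun m n t phi by rewrite mulNr.
have i4 := Cint_add (measurable_itv _) i1 i3.
rewrite (eq_cintegral (fun phi _ => E phi)) cintegralD//; last 2 first.
- exact: Cint_scale.
- by apply: Cint_scale => //; exact: Cint_Efun.
rewrite !cintegralZ//; last exact: Cint_Efun.
rewrite cintegralD// !cintegralZ//; [|exact: Cint_Efun|exact: Cint_Efun].
by rewrite mulNr.
Qed.

Definition dAmn m n (t : R) : C := - (ii / 2) * (zc * Amn m n.+1 t + z * Amn m.+1 n t).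

Lemma Amn_rec_r m n t : t%:C * (z * Amn m n t) =
  ii * (t%:C * dAmn m n.+1 t) + ii * (n.+1%:R - m%:R) * Amn m n.+1 t.
Proof.
have := Amn_phi m n.+1 t; rewrite /dAmn AmnSS RCM RCV RCnat.
have : ii * ii = -1 :> C := ii2.
move: (Amn m n.+2 t) (Amn m n.+1 t) (Amn m n t) (n.+1%:R - m%:R : C) => x y w k i2 h.
transitivity (- (ii * ii) * t%:C / 2 * (zc * x + z * w) + ii * k * y); last by field.
rewrite i2.
have -> : ii * k * y = - (t%:C / 2 * (zc * x - z * w)) by apply/eqP; rewrite -addr_eq0 addrC h.
by field.
Qed.

Lemma Amn_rec_l m n t : t%:C * (zc * Amn m n t) =
  ii * (t%:C * dAmn m.+1 n t) - ii * (n%:R - m.+1%:R) * Amn m.+1 n t.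
Proof.
have := Amn_phi m.+1 n t; rewrite /dAmn AmnSS RCM RCV RCnat.
have : ii * ii = -1 :> C := ii2.
move: (Amn m.+2 n t) (Amn m.+1 n t) (Amn m n t) (n%:R - m.+1%:R : C) => x y w k i2 h.
transitivity (- (ii * ii) * t%:C / 2 * (zc * w + z * x) - ii * k * y); last by field.
rewrite i2.
have -> : ii * k * y = - (t%:C / 2 * (zc * w - z * x)) by apply/eqP; rewrite -addr_eq0 addrC h.
by field.
Qed.

End Angular.
End FockCoefficients.

(** * The radial inversion integral in closed form *)

Section RadialInversion.
Context {R : realType}.
Local Notation leb := (@lebesgue_measure R).
Local Notation C := R[i].
Local Notation measR := (@measurable _ (measurableTypeR R)).
Local Notation ii := (Complex 0 1 : C).
Local Notation pos := (`[0, +oo[%classic : set R).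

Lemma Cint_rapid (D : set R) f : measR D -> ccont f -> rapid f -> Cint D f.
Proof.
move=> mD cf rf; have [K hK] := rapid_bound rf.
apply: (Cint_dom mD cf (g := fun x => K * lor x)) => [|x _]; last exact: hK.
by apply: (integrableS _ _ _ (integrable_lorZ K)).
Qed.

Lemma FTC_rapid (F f : R -> C) : cder F f -> ccont f -> rapid F -> rapid f ->
  cintegral pos f = - F 0.
Proof.
move=> dF cf rF rf; have [K hK] := rapid_bound rF; have [L hL] := rapid_bound rf.
apply: (@cintegral_FTC0y _ _ _ (Num.max K L)) => // x _.
  by rewrite (le_trans (hK _))// ler_wpM2r ?lor_ge0// le_max lexx.
by rewrite (le_trans (hL _))// ler_wpM2r ?lor_ge0// le_max lexx orbT.
Qed.

Lemma cder_lin (F f : R -> C) (t : R) : cder F f ->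
  cder (fun s => F (s * t)) (fun s => t%:C * f (s * t)).
Proof.
move=> h x; have [h1 h2] := h (x * t).
have d : is_derive x 1 (fun s : R => s * t) t.
  by apply: (is_derive_ext (is_derive_mulR (is_derive_idR x) (is_derive_cstR t x))) => //; ring.
split.
  by apply: (is_derive_ext (@is_derive_compR _ _ (fun s => s * t) x _ _ h1 d)) => //; rewrite !cRIE/=; ring.
by apply: (is_derive_ext (@is_derive_compR _ _ (fun s => s * t) x _ _ h2 d)) => //; rewrite !cRIE/=; ring.
Qed.

Lemma cder_idC : cder (fun t : R => t%:C) (fun _ => 1).
Proof. exact: (cder_real (@is_derive_idR R)). Qed.

Lemma ccont_eq (f g : R -> C) : f =1 g -> ccont f -> ccont g.
Proof. by move=> /funext ->. Qed.

Lemma ccont_idC : ccont (fun t : R => t%:C).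
Proof. exact: cder_cont cder_idC. Qed.

Lemma rapid_dcmn m n : rapid (@dcmn R m n).
Proof.
have h1 := rapidZ ii (rapidD (rapidZ m%:R (@rapid_cmn R m.-1 n)) (rapidZ n%:R (@rapid_cmn R m n.-1))).
have h2 := rapidZ (- 2^-1) (rapidX (@rapid_cmn R m n)).
apply: rapid_eq (rapidD h1 h2) => t.
by rewrite /dcmn RCM RCV RCnat; field.
Qed.

Lemma ccont_dcmn m n : ccont (@dcmn R m n).
Proof.
have h1 := ccontM (ccont_cst ii) (ccontD (ccontM (ccont_cst m%:R) (@ccont_cmn R m.-1 n)) (ccontM (ccont_cst n%:R) (@ccont_cmn R m n.-1))).
have h2 := ccontM (ccontM (ccont_cst (- 2^-1)) ccont_idC) (@ccont_cmn R m n).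
apply: ccont_eq (ccontD h1 h2) => t.
by rewrite /dcmn RCM RCV RCnat; field.
Qed.

Section Fixed.
Variables q p : R.
Local Notation z := (q +i* p : C).
Local Notation zc := (q -i* p : C).
Local Notation A := (Amn q p).
Local Notation dA := (dAmn q p).

Lemma ccont_A m n : ccont (A m n).
Proof. exact: cder_cont (cder_Amn q p m n). Qed.

Lemma ccont_dA m n : ccont (dA m n).
Proof.
have := ccontM (ccont_cst (- (ii / 2))) (ccontD (ccontM (ccont_cst zc) (ccont_A m n.+1)) (ccontM (ccont_cst z) (ccont_A m.+1 n))).
by [].
Qed.

Lemma dA_bound m n : exists M, forall t, cmod (dA m n t) <= M.
Proof.
exists (cmod (- (ii / 2)) * (cmod zc * (4 * pi) + cmod z * (4 * pi))) => t.
rewrite /dAmn cmodM ler_wpM2l ?cmod_ge0// (le_trans (cmodD _ _))//.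
by rewrite (cmodM zc) (cmodM z) lerD// ler_wpM2l ?cmod_ge0// cmod_Amn.
Qed.

Lemma rapidMA f m n : rapid f -> rapid (fun t => f t * A m n t).
Proof. by move=> h; apply: rapidM h (cmod_Amn q p m n). Qed.

Definition Vmn m n : C := cintegral pos (fun t => t%:C * (cmn m n t * A m n t)).

(** f is the derivative of t c(t) A(t), which vanishes at 0 because of the factor t and at infinity
    because c decreases rapidly. *)
Lemma Vmn_ftc m n k l : let c := cmn m n in let c' := dcmn m n in
  let f := fun t => c t * A k l t + t%:C * (c' t * A k l t + c t * dA k l t) in
  cintegral pos f = 0 /\ Cint pos f.
Proof.
move=> c c' f.
have d : cder (fun t => t%:C * (c t * A k l t)) f.
  apply: (cder_eq (cderM cder_idC (cderM (cder_cmn m n) (cder_Amn q p k l)))) => // t.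
  by rewrite /f mul1r.
have cc : ccont f.
  apply: ccontD; first exact: ccontM (ccont_cmn m n) (ccont_A k l).
  apply: ccontM; first exact: ccont_idC.
  apply: ccontD; first exact: ccontM (ccont_dcmn m n) (ccont_A k l).
  exact: ccontM (ccont_cmn m n) (ccont_dA k l).
have rF : rapid (fun t => t%:C * (c t * A k l t)) by apply: rapidX; apply: rapidMA; exact: rapid_cmn.
have rf : rapid f.
  have [M hM] := dA_bound k l.
  apply: rapidD; first by apply: rapidMA; exact: rapid_cmn.
  apply: rapidX; apply: rapidD; first by apply: rapidMA; exact: rapid_dcmn.
  by apply: rapidM hM; exact: rapid_cmn.
split; last exact: Cint_rapid.
by rewrite (FTC_rapid d cc rF rf) RC0 mul0r oppr0.
Qed.

Lemma Cint_tcA m n k l : Cint pos (fun t => t%:C * (cmn m n t * A k l t)).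
Proof.
apply: Cint_rapid => //.
  by apply: ccontM ccont_idC _; exact: ccontM (ccont_cmn m n) (ccont_A k l).
by apply: rapidX; apply: rapidMA; exact: rapid_cmn.
Qed.

(** Up to - 2 i times the exact derivative of t c_mn A_(m,n+1), the raised integrand reduces to
    lower ones: [Amn_rec_r] replaces z A_mn and [cmn_euler] the term with n c_(m,n-1). The outcome
    is the recurrence of (-1)^m [Gmn]. *)
Lemma Vmn_rec_r m n : Vmn m n.+1 = 2 * z * Vmn m n - (2 * m)%:R * Vmn m.-1 n.
Proof.
have [I0 i0] := Vmn_ftc m n m n.+1.
have i1 := Cint_tcA m n m n; have i2 := Cint_tcA m.-1 n m n.+1.
have E t : t%:C * (cmn m n.+1 t * A m n.+1 t) =
   2 * z * (t%:C * (cmn m n t * A m n t)) +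
   ((- (2 * m)%:R) * (t%:C * (cmn m.-1 n t * A m n.+1 t)) +
   (- (2 * ii)) * (cmn m n t * A m n.+1 t + t%:C * (dcmn m n t * A m n.+1 t + cmn m n t * dA m n.+1 t))).
  have h1 := Amn_rec_r q p m n t; have h2 := cmn_euler m n t.
  have -> : 2 * z * (t%:C * (cmn m n t * A m n t)) = 2 * cmn m n t * (t%:C * (z * A m n t)) by ring.
  have i2' : ii * ii = -1 :> C := ii2.
  rewrite h1 cmnSr /dcmn -[n.+1%:R]natr1 !natrM RCM RCV RCnat.
  move: h2 i2'; move: (cmn m n t) (cmn m.-1 n t) (cmn m n.-1 t) (A m n.+1 t) (dA m n.+1 t) => c c1 c2 a da h2 i2'.
  apply/eqP; rewrite -subr_eq0; apply/eqP.
  transitivity (- a * (2 * (ii * (n%:R - m%:R) * c) - 4 * m%:R * t%:C * c1 - 2 * (ii * ii) * t%:C * (m%:R * c1 + n%:R * c2))); first by field.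
  by rewrite h2 i2'; ring.
have i3 : Cint pos (fun t => - (2 * m)%:R * (t%:C * (cmn m.-1 n t * A m n.+1 t))) by exact: Cint_scale.
have i4 := Cint_scale (- (2 * ii)) (measurable_itv _) i0.
rewrite /Vmn (eq_cintegral (fun t _ => E t)) cintegralD//; last 2 first.
- exact: Cint_scale.
- exact: Cint_add.
have mp : measR pos by [].
have e4 := cintegralZ (- (2 * ii)) mp i0; rewrite I0 mulr0 in e4.
have e5 := cintegralD mp i3 i4; rewrite e4 addr0 in e5.
(* For m = 0 the coefficient vanishes; otherwise A depends on its indices only up to a common
   shift. *)
have e6 : (2 * m)%:R * cintegral pos (fun t => t%:C * (cmn m.-1 n t * A m n.+1 t)) =
    (2 * m)%:R * cintegral pos (fun t => t%:C * (cmn m.-1 n t * A m.-1 n t)).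
  case: (m) => [|k]; first by rewrite muln0 [LHS]mul0r [RHS]mul0r.
  have h (t : R) : pos t -> t%:C * (cmn k n t * A k.+1 n.+1 t) = t%:C * (cmn k n t * A k n t).
    by move=> _; rewrite AmnSS.
  by rewrite -[k.+1.-1]/k (eq_cintegral h).
have e7 := cintegralZ (2 * z) mp i1; have e8 := cintegralZ (- (2 * m)%:R) mp i2.
exact: (f_equal2 +%R e7 (etrans e5 (etrans e8 (etrans (mulNr _ _) (f_equal -%R e6))))).
Qed.

Lemma Vmn_rec_l m : Vmn m.+1 0 = 2 * zc * Vmn m 0.
Proof.
have [I0 i0] := Vmn_ftc m 0 m.+1 0.
have i1 := Cint_tcA m 0 m 0.
have E t : t%:C * (cmn m.+1 0 t * A m.+1 0 t) =
   2 * zc * (t%:C * (cmn m 0 t * A m 0 t)) +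
   (- (2 * ii)) * (cmn m 0 t * A m.+1 0 t + t%:C * (dcmn m 0 t * A m.+1 0 t + cmn m 0 t * dA m.+1 0 t)).
  have h1 := Amn_rec_l q p m 0 t; have h2 := cmn_euler m 0 t.
  have -> : 2 * zc * (t%:C * (cmn m 0 t * A m 0 t)) = 2 * cmn m 0 t * (t%:C * (zc * A m 0 t)) by ring.
  have i2' : ii * ii = -1 :> C := ii2.
  rewrite h1 cmnSl /dcmn -[m.+1%:R]natr1 muln0 RCM RCV RCnat.
  move: h2 i2'; move: (cmn m 0 t) (cmn m.-1 0 t) (A m.+1 0 t) (dA m.+1 0 t) => c c1 a da h2 i2'.
  apply/eqP; rewrite -subr_eq0; apply/eqP.
  transitivity (a * (2 * (ii * (0%:R - m%:R) * c) + 2 * (ii * ii) * t%:C * (m%:R * c1))); first by field.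
  by rewrite h2 i2'; ring.
rewrite /Vmn (eq_cintegral (fun t _ => E t)) cintegralD//; last 2 first.
- exact: Cint_scale.
- exact: Cint_scale.
by rewrite !cintegralZ// I0 mulr0 addr0.
Qed.

Lemma A01_0 : A 0 1 0 = 0.
Proof.
rewrite /Amn (@eq_cintegral _ _ _ (fun _ => 0)); last first.
  by move=> phi _; rewrite /Efun mul0r oppr0 cexpi0 expr1 mulr1 subrr mul0r.
by apply: ceqP => /=; rewrite Rintegral_cst//= mul0r.
Qed.

Lemma A10_0 : A 1 0 0 = 0.
Proof.
rewrite /Amn (@eq_cintegral _ _ _ (fun _ => 0)); last first.
  by move=> phi _; rewrite /Efun mul0r oppr0 cexpi0 expr1 mulr1 subrr mul0r.
by apply: ceqP => /=; rewrite Rintegral_cst//= mul0r.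
Qed.

(** For t != 0 divide [Amn_rec_l] at (0, 1) by t, its order term being 0; at t = 0 both sides
    vanish. *)
Lemma dA00 t : ii * dA 0 0 t = zc * A 0 1 t.
Proof.
have [->|t0] := eqVneq t 0.
  by rewrite /dAmn A01_0 A10_0 !mulr0 addr0 !mulr0.
have := Amn_rec_l q p 0 1 t; rewrite subrr mulr0 mul0r subr0.
have -> : dA 1 1 t = dA 0 0 t by rewrite /dAmn !AmnSS.
have t0' : t%:C != 0 :> C by apply: contra t0 => /eqP [->].
by move=> h; apply: (mulfI t0'); rewrite h mulrCA.
Qed.

Lemma A00_0 : A 0 0 0 = (2 * pi)%:C.
Proof.
rewrite /Amn (@eq_cintegral _ _ _ (fun _ => (2 : R)%:C)); last first.
  move=> phi _; by rewrite /Efun subrr !mul0r oppr0 cexpi0 expr0 mul1r mulr1 RCnat.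
apply: ceqP => /=; last by rewrite Rintegral_cst//= mul0r.
have d (x : R) : is_derive x 1 (fun x => 2 * x) 2.
  by apply: (is_derive_ext (is_derive_scaleR 2 (is_derive_idR x))) => //; rewrite mulr1.
rewrite (Rintegral_FTC2 (pi_gt0 R) d) => [|x]; last exact: cvg_cst.
by rewrite mulr0 subr0.
Qed.

(* Ul 1 = Vmn 0 0, while Ul 0 is elementary: the differential equation in l
   replaces the Hankel transform of a Gaussian. *)
Definition Ul (l : R) : C := cintegral pos (fun t => t%:C * (cmn 0 0 t * A 0 0 (l * t))).

Lemma dcmn00 t : dcmn 0 0 t = - (t / 2)%:C * cmn 0 0 t :> C.
Proof. by rewrite /dcmn !mul0r addr0 mulr0 add0r mulNr. Qed.

Lemma ccont_lin (F : R -> C) (l : R) f : cder F f -> ccont (fun t => F (l * t)).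
Proof.
move=> h; have := cder_cont (cder_lin l h).
by apply: ccont_eq => t; rewrite mulrC.
Qed.

Lemma Ul0 : Ul 0 = (4 * pi * Num.sqrt pi)%:C.
Proof.
have E t : t%:C * (cmn 0 0 t * A 0 0 (0 * t)) = (2 * pi)%:C * (t%:C * cmn 0 0 t) :> C.
  by rewrite mul0r A00_0; ring.
have i : Cint pos (fun t => t%:C * cmn 0 0 t).
  by apply: Cint_rapid => //; [exact: ccontM ccont_idC (ccont_cmn 0 0)|apply: rapidX; exact: rapid_cmn].
rewrite /Ul (eq_cintegral (fun t _ => E t)) cintegralZ//.
have d : cder (fun t => - 2 * cmn 0 0 t) (fun t => t%:C * cmn 0 0 t :> C).
  apply: (cder_eq (cderZ (- 2) (cder_cmn 0 0))) => // t.
  by rewrite dcmn00 RCM RCV RCnat; field.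
rewrite (FTC_rapid d); last 3 first.
- exact: ccontM ccont_idC (ccont_cmn 0 0).
- by apply: rapidZ; exact: rapid_cmn.
- by apply: rapidX; exact: rapid_cmn.
rewrite /cmn mulr1 J1_one expr0n/= mul0r oppr0 expR0 mulr1 mulNr opprK !RCM !RCnat.
ring.
Qed.

(** The l-derivative brings down t dA_00(l t), a multiple of t A_01(l t). Integrating the exact
    derivative of t c_00(t) A_01(l t), where c_00' = - (t / 2) c_00, turns the resulting integral
    back into a multiple of l U(l). *)
Lemma cder_Ul : cder Ul (fun l => - (2 * (q ^+ 2 + p ^+ 2) * l)%:C * Ul l).
Proof.
have [M hM] := dA_bound 0 0.
have r2 : rapid (fun t => t%:C * (t%:C * cmn 0 0 t) : C) by do 2 apply: rapidX; exact: rapid_cmn.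
have [K hK] := rapid_bound r2.
have M0 : 0 <= M by apply: le_trans (hM 0); exact: cmod_ge0.
have h : cder Ul (fun l => cintegral pos (fun t => t%:C * (cmn 0 0 t * (t%:C * dA 0 0 (l * t))))).
  apply: (@cder_cintegral _ pos (fun l t => t%:C * (cmn 0 0 t * A 0 0 (l * t)))
    (fun l t => t%:C * (cmn 0 0 t * (t%:C * dA 0 0 (l * t)))) (fun _ t => K * lor t * M)).
  - by [].
  - move=> l; apply: Cint_rapid => //.
      by apply: ccontM ccont_idC _; exact: ccontM (ccont_cmn 0 0) (ccont_lin l (cder_Amn q p 0 0)).
    by apply: rapidX; apply: rapidM (rapid_cmn 0 0) (fun t => cmod_Amn q p 0 0 (l * t)).
  - by move=> t; exact: cderZ (cderZ _ (cder_lin t (cder_Amn q p 0 0))).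
  - move=> _; have : leb.-integrable pos (EFin \o (fun x => K * M * lor x)).
      by apply: (integrableS _ _ _ (integrable_lorZ (K * M))).
    by apply: eq_integrable => // t _ /=; rewrite mulrAC.
  - by move=> _ t; rewrite mulr_ge0// (le_trans _ (hK t))// cmod_ge0.
  - move=> _ l t _ _; have -> : t%:C * (cmn 0 0 t * (t%:C * dA 0 0 (l * t))) =
      (t%:C * (t%:C * cmn 0 0 t)) * dA 0 0 (l * t) by ring.
    by rewrite cmodM ler_pM ?cmod_ge0.
apply: (cder_eq h) => // l.
pose G := fun t => t%:C * (t%:C * (cmn 0 0 t * A 0 1 (l * t))) : C.
have cA01 := ccont_lin l (cder_Amn q p 0 1).
have iG : Cint pos G.
  apply: Cint_rapid => //.
    by apply: ccontM ccont_idC _; apply: ccontM ccont_idC _; exact: ccontM (ccont_cmn 0 0) cA01.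
  by do 2 apply: rapidX; apply: rapidM (rapid_cmn 0 0) (fun t => cmod_Amn q p 0 1 (l * t)).
have iU : Cint pos (fun t => t%:C * (cmn 0 0 t * A 0 0 (l * t))).
  apply: Cint_rapid => //.
    by apply: ccontM ccont_idC _; exact: ccontM (ccont_cmn 0 0) (ccont_lin l (cder_Amn q p 0 0)).
  by apply: rapidX; apply: rapidM (rapid_cmn 0 0) (fun t => cmod_Amn q p 0 0 (l * t)).
have E t : t%:C * (cmn 0 0 t * (t%:C * dA 0 0 (l * t))) = - (ii * zc) * G t.
  have -> : dA 0 0 (l * t) = - ii * (ii * dA 0 0 (l * t)) by rewrite mulrA mulNr ii2 opprK mul1r.
  by rewrite dA00 /G; ring.
rewrite (eq_cintegral (fun t _ => E t)) cintegralZ//.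
have d : cder (fun t => t%:C * (cmn 0 0 t * A 0 1 (l * t)))
   (fun t => - 2^-1 * G t + (- (ii * z * l%:C)) * (t%:C * (cmn 0 0 t * A 0 0 (l * t)))).
  have d1 := cder_lin l (cder_Amn q p 0 1).
  apply: (cder_eq (cderM cder_idC (cderM (cder_cmn 0 0) d1))) => [t|t].
    by rewrite [t * l]mulrC.
  rewrite -/(dA 0 1 (t * l)) [t * l]mulrC mul1r dcmn00 /G RCM RCV RCnat.
  have := Amn_rec_r q p 0 0 (l * t); rewrite subr0 mulr1 RCM => hr.
  have i2 : ii * ii = -1 :> C := ii2.
  move: (cmn 0 0 t) (A 0 1 (l * t)) (dA 0 1 (l * t)) (A 0 0 (l * t)) hr => c a da b hr.
  have hr' : a + l%:C * t%:C * da = - ii * (l%:C * t%:C * (z * b)).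
    by rewrite hr -mulrDr mulrA mulNr i2 opprK mul1r addrC.
  transitivity (- 2^-1 * (t%:C * (t%:C * (c * a))) + c * (a + l%:C * t%:C * da)); first by field.
  by rewrite hr'; ring.
have I : cintegral pos (fun t => - 2^-1 * G t + (- (ii * z * l%:C)) * (t%:C * (cmn 0 0 t * A 0 0 (l * t)))) = 0.
  rewrite (FTC_rapid d) ?RC0 ?mul0r ?oppr0//.
  - apply: ccontD; apply: ccontM; [exact: ccont_cst| |exact: ccont_cst|].
      by apply: ccontM ccont_idC _; apply: ccontM ccont_idC _; exact: ccontM (ccont_cmn 0 0) cA01.
    by apply: ccontM ccont_idC _; exact: ccontM (ccont_cmn 0 0) (ccont_lin l (cder_Amn q p 0 0)).
  - by apply: rapidX; apply: rapidM (rapid_cmn 0 0) (fun t => cmod_Amn q p 0 1 (l * t)).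
  - apply: rapidD; apply: rapidZ.
      by do 2 apply: rapidX; apply: rapidM (rapid_cmn 0 0) (fun t => cmod_Amn q p 0 1 (l * t)).
    by apply: rapidX; apply: rapidM (rapid_cmn 0 0) (fun t => cmod_Amn q p 0 0 (l * t)).
rewrite cintegralD// in I; last 2 first.
- exact: Cint_scale.
- exact: Cint_scale.
rewrite !cintegralZ// -/(Ul l) in I.
have -> : cintegral pos G = - (2 * ii * z * l%:C) * Ul l.
  have : cintegral pos G - (- (2 * ii * z * l%:C) * Ul l) = (- 2) * (- 2^-1 * cintegral pos G - ii * z * l%:C * Ul l) by field.
  by rewrite -[in X in _ = _ * X]mulNr I mulr0 => /eqP; rewrite subr_eq0 => /eqP.
have e : z * zc = (q ^+ 2 + p ^+ 2)%:C by apply: ceqP; rewrite !cRIE/=; ring.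
rewrite !RCM -e RCnat.
have i2 : ii * ii = -1 :> C := ii2.
transitivity (ii * ii * (2 * (z * zc) * l%:C * Ul l)); first by ring.
by rewrite i2; ring.
Qed.

Lemma V00 : Vmn 0 0 = (4 * pi * Num.sqrt pi * expR (- (q ^+ 2 + p ^+ 2)))%:C.
Proof.
set w := q ^+ 2 + p ^+ 2.
have dE (x : R) : is_derive x 1 (fun l => expR (w * l ^+ 2)) (2 * w * x * expR (w * x ^+ 2)).
  by apply: (is_derive_ext (is_derive_compR (is_derive_expR _) (is_derive_scaleR w (is_derive_mulR (is_derive_idR x) (is_derive_idR x))))) => //; rewrite -expr2; ring.
have F0 := cder0_cst (F := fun l => Ul l * (expR (w * l ^+ 2))%:C).
have /F0 {}F0 : cder (fun l => Ul l * (expR (w * l ^+ 2))%:C) (fun _ => 0).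
  apply: (cder_eq (cderM cder_Ul (cder_real dE))) => // l.
  by rewrite -/w (RCM _ (expR _)); ring.
have E0 : w * 0 ^+ 2 = 0 by rewrite expr0n mulr0.
have E1 : w * 1 ^+ 2 = w by rewrite expr1n mulr1.
have := F0 1; rewrite E0 E1 expR0 Ul0 => h.
have -> : Vmn 0 0 = Ul 1 by apply: eq_cintegral => t _; rewrite mul1r.
have e : expR w * expR (- w) = 1 by rewrite -expRD subrr expR0.
move: (Ul 1) h => u h.
have -> : u = u * (expR w)%:C * (expR (- w))%:C by rewrite -mulrA -RCM e mulr1.
by rewrite h -!RCM mulr1.
Qed.

Lemma VmnE m n : Vmn m n = (4 * pi * Num.sqrt pi * expR (- (q ^+ 2 + p ^+ 2)))%:C *
  ((-1) ^+ m * Gmn m n (2 * z) (- (2 * zc))).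
Proof.
elim: n m => [|n IH] m.
  elim: m => [|m IH]; first by rewrite V00 /= !mulr1.
  by rewrite Vmn_rec_l IH /= !exprS; ring.
rewrite Vmn_rec_r !IH GmnSr.
case: m => [|m]; first by rewrite /= muln0 mul0r; ring.
rewrite [m.+1.-1]/= !exprS; move: (Gmn m.+1 n _ _) (Gmn m n _ _) => g g'; ring.
Qed.

(** Both sides are the same Gaussian times the same value of [Gmn]; only the constants have to be
    matched. *)
Lemma wigner_inversion m n :
  wigner_mn m n q p = (nrm m n / (4 * pi ^+ 2))%:C * Vmn m n.
Proof.
rewrite VmnE wigner_G mulrA -RCM; congr (_%:C * _).
have aux (c k s e : R) : c != 0 -> c^-1 * k * s * e = k / (4 * c ^+ 2) * (4 * c * s * e).
  by move=> c0; field.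
by apply: aux; rewrite gt_eqF// pi_gt0.
Qed.

End Fixed.
End RadialInversion.

(** * Decay of the coefficients *)

Section Decay.
Context {R : realType}.

Lemma exp_ub_nat (x : R) : exists N : nat, x <= N%:R.
Proof. by exists (Num.truncn x).+1; rewrite ltW// truncnS_gt. Qed.

(** For x >= 1, x^j <= (x^r)^N with an integer N >= j / r, and [pow_le_exp] at b x^r absorbs the
    power; for x <= 1 the product is at most 1. *)
Lemma pow_powR_exp (b r : R) (j : nat) : 0 < b -> 0 < r -> exists2 K : R, 0 <= K &
  forall x, 0 <= x -> x ^+ j * expR (- (b * x `^ r)) <= K.
Proof.
move=> b0 r0; have b0w := ltW b0; have r0w := ltW r0; have [N hN] := exp_ub_nat (j%:R / r).
have K0 : 0 <= (N%:R / b) ^+ N :> R by rewrite exprn_ge0// divr_ge0// ltW.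
exists (1 + (N%:R / b) ^+ N); first by rewrite addr_ge0.
move=> x x0; rewrite expRN ler_pdivrMr ?expR_gt0//.
have e1 : 1 <= expR (b * x `^ r) by rewrite -expR0 ler_expR mulr_ge0 ?powR_ge0// ltW.
have [x1|x1] := leP x 1; last have x1w := ltW x1.
  apply: (@le_trans _ _ 1); first exact: exprn_ile1.
  by rewrite -[leLHS]mul1r ler_pM// lerDl.
have xr1 : 1 <= x `^ r by rewrite -(powRr0 x) ler_powR.
apply: (@le_trans _ _ ((x `^ r) ^+ N)).
  rewrite -(powR_mulrn j x0) -(powR_mulrn N (powR_ge0 x r)) -powRrM ler_powR//.
  by rewrite mulrC -ler_pdivrMr.
have := pow_le_exp N (_ : 0 <= b * x `^ r) => /(_ (mulr_ge0 (ltW b0) (powR_ge0 _ _))).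
rewrite exprMn mulrC -ler_pdivlMr ?exprn_gt0// => h; apply: (le_trans h).
rewrite mulrAC -expr_div_n ler_wpM2r ?expR_ge0//.
by rewrite lerDr.
Qed.

Definition wgt (m : nat) : R := (m.+1%:R ^+ 2)^-1.

Lemma wgt_gt0 m : 0 < wgt m.
Proof. by rewrite invr_gt0 exprn_gt0// ltr0n. Qed.

Lemma wgt_ge0 m : 0 <= wgt m. Proof. exact: ltW (wgt_gt0 m). Qed.

(** Consequently a gain of order 4 in m + n + 1 suffices for absolute convergence of the double
    series. *)
Lemma wgt_mul m n : ((m + n).+1%:R ^+ 4)^-1 <= wgt m * wgt n.
Proof.
rewrite /wgt -invfM lef_pV2 ?posrE ?mulr_gt0 ?exprn_gt0 ?ltr0n//.
by rewrite -exprMn -natrM -!natrX ler_nat (expnM _ 2 2) leq_exp2r// -mulnn leq_mul// ltnS ?leq_addr ?leq_addl.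
Qed.

(** x0 is the point where b x^r = c x^2: beyond it the square dominates, below it b x0^r does. *)
Lemma exp_young (b c r : R) : 0 < b -> 0 < c -> 0 < r < 2 -> exists2 M : R, 0 <= M &
  forall x, 0 <= x -> b * x `^ r <= c * x ^+ 2 + M.
Proof.
move=> b0 c0 /andP[r0 r2]; have r20 : 0 < 2 - r by rewrite subr_gt0.
have b0w := ltW b0; have c0w := ltW c0; have r0w := ltW r0; have r20w := ltW r20.
pose x0 := (b / c) `^ (2 - r)^-1.
exists (b * x0 `^ r); first by rewrite mulr_ge0 ?powR_ge0.
move=> x x_ge0; have [xx0|xx0] := leP x x0.
  apply: (@le_trans _ _ (b * x0 `^ r)); last by rewrite lerDr mulr_ge0 ?sqr_ge0.
  by rewrite ler_wpM2l//; apply: ge0_ler_powR; rewrite ?nnegrE ?powR_ge0.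
apply: (@le_trans _ _ (c * x ^+ 2)); last by rewrite lerDl mulr_ge0 ?powR_ge0.
have xp : 0 < x by rewrite (le_lt_trans _ xx0)// powR_ge0.
have -> : x ^+ 2 = x `^ r * x `^ (2 - r).
  by rewrite -powRD ?(gt_eqF xp) ?implybT// addrC subrK powR_mulrn.
rewrite mulrCA mulrC ler_wpM2l ?powR_ge0// mulrC -ler_pdivrMr//.
have -> : b / c = x0 `^ (2 - r).
  by rewrite /x0 -powRrM mulVf ?gt_eqF// powRr1// divr_ge0.
by apply: ge0_ler_powR; rewrite ?nnegrE ?powR_ge0// ltW.
Qed.

(* For r = 2 the best exponent is the value of u / (1 + u) at u = B, as the
   growth e^(u (m + n)) has to be beaten by e^(- B (m + n)). *)
Definition admissible (B r b : R) : Prop :=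
  [/\ 0 < b, 0 < r & (r = 2 /\ b < B / (1 + B)) \/ (r < 2 /\ b < B)].

(** Here k stands for m + n and x for half the frequency. Since [J_herm_bound] holds for every u >
    0, u may be chosen after k and x, while D may not depend on them. *)
Lemma admissible_bound (B r b : R) : 0 < B -> admissible B r b ->
  exists2 D : R, 0 <= D & forall (k : nat) (x : R), 0 <= x -> exists2 u, 0 < u &
  expR (- (B * k%:R `^ (r / 2)) + u * k%:R - x ^+ 2 * (u / (1 + u)))
    <= D * (k.+1%:R ^+ 4)^-1 * expR (- (b * x `^ r)).
Proof.
move=> B0 [b0 r0 [[-> bB]|[r2 bB]]].
  have B1 : 0 < 1 + B by rewrite addr_gt0.
  have b1 : b < 1 by rewrite (lt_le_trans bB)// ler_pdivrMr// mul1r lerDr.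
  have b1' : 0 < 1 - b by rewrite subr_gt0.
  (* Solves u / (1 + u) = b. Then b < B / (1 + B) means u < B, and the surplus e^(- (B - u) k)
     yields the weight (k + 1)^-4. *)
  pose u := b / (1 - b).
  have u0 : 0 < u by rewrite divr_gt0.
  have uB : u < B.
    rewrite /u ltr_pdivrMr//; rewrite ltr_pdivlMr// in bB; nra.
  have eu : u / (1 + u) = b.
    have -> : 1 + u = (1 - b)^-1 by rewrite /u; field; rewrite gt_eqF.
    by rewrite /u invrK mulfVK ?gt_eqF.
  have Bu : 0 < B - u by rewrite subr_gt0.
  have [K K0 hK] := pow_powR_exp 4 Bu ltr01.
  exists (K * expR (B - u)); first by rewrite mulr_ge0// expR_ge0.
  move=> k x x0; exists u => //; rewrite divff// powRr1// eu powR_mulrn//.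
  have := hK k.+1%:R (ler0n _ _); rewrite powRr1// => h.
  have -> : expR (- (B * k%:R) + u * k%:R - x ^+ 2 * b) =
    expR (- (B * k%:R) + u * k%:R) * expR (- (b * x ^+ 2)) by rewrite -expRD [x ^+ 2 * b]mulrC.
  rewrite ler_wpM2r ?expR_ge0//.
  rewrite ler_pdivlMr ?exprn_gt0 ?ltr0n//.
  have -> : expR (- (B * k%:R) + u * k%:R) = expR (- ((B - u) * k.+1%:R)) * expR (B - u).
    by rewrite -expRD; congr expR; rewrite -natr1; ring.
  by rewrite mulrAC ler_wpM2r ?expR_ge0// mulrC.
(* Now r < 2 and B = b + 2 d. The part B1 = b + d of the decay in k is traded for decay in x; the
   other d pays for the weight and for the passage from k to k + 1. *)
have d0 : 0 < (B - b) / 2 by rewrite divr_gt0// subr_gt0.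
set d := (B - b) / 2 in d0 *; pose B1 := b + d.
have B10 : 0 < B1 by rewrite addr_gt0.
have r20 : 0 < r / 2 by rewrite divr_gt0.
have r21 : r / 2 <= 1 by rewrite ler_pdivrMr// mul1r ltW.
(* Defined by B1 th^(r / 2) = b, so that k >= th x^2 implies B1 k^(r / 2) >= b x^r. As b < B1, th <
   1. *)
pose th := (b / B1) `^ (2 / r).
have thE : B1 * th `^ (r / 2) = b.
  rewrite /th -powRrM (_ : 2 / r * (r / 2) = 1); last by field; rewrite gt_eqF.
  by rewrite powRr1 ?divr_ge0 ?ltW// mulrCA divff ?mulr1// gt_eqF.
have th0 : 0 <= th by exact: powR_ge0.
have th1 : th < 1.
  rewrite ltNge; apply/negP => h.
  have : th `^ 0 <= th `^ (r / 2) by apply: ler_powR => //; exact: ltW.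
  by rewrite powRr0 -(ler_pM2l B10) thE mulr1 /B1; lra.
have d20 : 0 < d / 2 by rewrite divr_gt0.
have [K1 K10 hK1] := pow_powR_exp 4 d20 r20.
(* With th = 1 - 2 u and u / (1 + u) >= u (1 - u), the loss u k < u th x^2 still leaves a Gaussian
   exponent u^2 x^2 = c x^2. Half of it beats b x^r by [exp_young], the other half yields the
   weight. *)
pose u := (1 - th) / 2.
have u0 : 0 < u by rewrite divr_gt0// subr_gt0.
have u1 : u <= 1 / 2 by rewrite /u; lra.
pose c := u ^+ 2.
have c0 : 0 < c by rewrite exprn_gt0.
have c20 : 0 < c / 2 by rewrite divr_gt0.
have r02 : 0 < r < 2 by rewrite r0.
have [M M0 hM] := exp_young b0 c20 r02.
have [K2 K20 hK2] := pow_powR_exp 4 c20 (ltr01 : (0 : R) < 1).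
exists (expR 1 * K1 * expR (d / 2) + K2 * expR (c / 2) * expR M).
  by rewrite addr_ge0// !mulr_ge0// expR_ge0.
(* For k >= th x^2 the decay in k suffices and u is chosen to be negligible;
   otherwise k is so small that a fixed u yields Gaussian decay in x. *)
move=> k x x0; have [kx|kx] := leP (th * x ^+ 2) k%:R.
  exists k.+1%:R^-1; first by rewrite invr_gt0 ltr0n.
  rewrite !mulrDl.
  apply: (@le_trans _ _ (expR 1 * K1 * expR (d / 2) / k.+1%:R ^+ 4 * expR (- (b * x `^ r)))); last first.
    by rewrite lerDl !mulr_ge0// ?expR_ge0// invr_ge0 exprn_ge0.
  have h1 : b * x `^ r <= B1 * k%:R `^ (r / 2).
    have -> : x `^ r = (x ^+ 2) `^ (r / 2).
      by rewrite -powR_mulrn// -powRrM; congr (_ `^ _); field.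
    rewrite -thE -mulrA ler_pM2l// -powRM ?sqr_ge0//.
    by apply: ge0_ler_powR; rewrite ?nnegrE ?mulr_ge0 ?sqr_ge0// ltW.
  have h2 : k.+1%:R `^ (r / 2) <= 2 * k%:R `^ (r / 2) + 1 :> R.
    case: (k) => [|l]; first by rewrite powR1 lerDr mulr_ge0// powR_ge0.
    rewrite (@le_trans _ _ ((2 * l.+1%:R) `^ (r / 2)))//.
      apply: ge0_ler_powR; rewrite ?nnegrE ?mulr_ge0 ?(ltW r0)//.
      by rewrite -natrM ler_nat mul2n -addnn addSnnS leq_addl.
    rewrite powRM// (@le_trans _ _ (2 * l.+1%:R `^ (r / 2)))// ?lerDl//.
    rewrite ler_wpM2r ?powR_ge0// -[leRHS]powRr1// ler_powR//.
    by rewrite ler1n.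
  have h3 := hK1 k.+1%:R (ler0n _ _).
  have h4 : expR (- (B * k%:R `^ (r / 2)) + k.+1%:R^-1 * k%:R - x ^+ 2 * (k.+1%:R^-1 / (1 + k.+1%:R^-1))) <=
     expR (- (b * x `^ r) + (1 + d / 2 - d / 2 * k.+1%:R `^ (r / 2))).
    rewrite ler_expR.
    have g1 : k.+1%:R^-1 * k%:R <= 1 :> R by rewrite mulrC ler_pdivrMr ?ltr0n// mul1r ler_nat.
    have g2 : 0 <= x ^+ 2 * (k.+1%:R^-1 / (1 + k.+1%:R^-1)).
      by rewrite mulr_ge0 ?sqr_ge0// divr_ge0 ?addr_ge0// invr_ge0.
    move: g1 g2 h1 h2; rewrite /B1.
    have -> : B = b + 2 * d by rewrite /d; field.
    move: (k%:R `^ _) (k.+1%:R `^ _) (x `^ r) (_^-1 * _) (x ^+ 2 * _) => y1 y2 y3 y4 y5.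
    nra.
  apply: (le_trans h4); rewrite addrC expRD ler_wpM2r ?expR_ge0//.
  rewrite ler_pdivlMr ?exprn_gt0 ?ltr0n//.
  have -> : expR (1 + d / 2 - d / 2 * k.+1%:R `^ (r / 2)) * k.+1%:R ^+ 4 =
     expR 1 * (k.+1%:R ^+ 4 * expR (- (d / 2 * k.+1%:R `^ (r / 2)))) * expR (d / 2).
    by rewrite (expRD (1 + d / 2)) (expRD 1); ring.
  by rewrite ler_wpM2r ?expR_ge0// ler_wpM2l ?expR_ge0.
exists u => //; rewrite !mulrDl.
apply: (@le_trans _ _ (K2 * expR (c / 2) * expR M / k.+1%:R ^+ 4 * expR (- (b * x `^ r)))); last first.
  by rewrite lerDr !mulr_ge0// ?expR_ge0// invr_ge0 exprn_ge0.
have hMx := hM x x0.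
have h1 : expR (- (B * k%:R `^ (r / 2)) + u * k%:R - x ^+ 2 * (u / (1 + u))) <=
   expR (- (b * x `^ r) + (M - c / 2 * x ^+ 2)).
  rewrite ler_expR.
  have g1 : 0 <= B * k%:R `^ (r / 2) by rewrite mulr_ge0 ?powR_ge0// ltW.
  have g2 : u * k%:R <= u * (th * x ^+ 2) by rewrite ler_pM2l// ltW.
  have g3 : u * (1 - u) <= u / (1 + u).
    rewrite ler_pdivlMr ?addr_gt0//; have := exprn_ge0 3 (ltW u0); nra.
  have g4 := ler_wpM2l (sqr_ge0 x) g3.
  have g5 : th = 1 - 2 * u by rewrite /u; field.
  move: g2 g4; rewrite g5 /c; move: (x `^ r) (sqr_ge0 x) hMx g1; rewrite /c.
  move: (x ^+ 2) (B * _) (u * k%:R) => y y1 y2 y3 y0; nra.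
apply: (le_trans h1); rewrite addrC expRD ler_wpM2r ?expR_ge0//.
rewrite ler_pdivlMr ?exprn_gt0 ?ltr0n//.
have h2 := hK2 (1 + x ^+ 2) (addr_ge0 ler01 (sqr_ge0 x)).
rewrite powRr1 ?addr_ge0 ?sqr_ge0// in h2.
have h3 : k.+1%:R ^+ 4 <= (1 + x ^+ 2) ^+ 4.
  rewrite lerXn2r// ?nnegrE ?addr_ge0 ?sqr_ge0// -natr1 addrC lerD2l (le_trans (ltW kx))//.
  by rewrite ler_piMl ?sqr_ge0// ltW.
have -> : expR (M - c / 2 * x ^+ 2) = expR M * expR (c / 2) * expR (- (c / 2 * (1 + x ^+ 2))).
  by rewrite -!expRD; congr expR; ring.
have h4 : k.+1%:R ^+ 4 * expR (- (c / 2 * (1 + x ^+ 2))) <= K2.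
  by apply: le_trans h2; rewrite ler_wpM2r ?expR_ge0.
have e0 : 0 <= expR M * expR (c / 2) by rewrite mulr_ge0// expR_ge0.
apply: (le_trans _ (le_trans (ler_wpM2l e0 h4) _)); rewrite le_eqVlt; apply/orP; left; apply/eqP; ring.
Qed.

(** [J_herm_bound] with the u that [admissible_bound] supplies at k = m + n and x = s / 2. The first
    factor on the left is the bound assumed on |rho_mn|. *)
Lemma fock_decay (B r b : R) : 0 < B -> admissible B r b -> exists2 D : R, 0 <= D &
  forall m n (s : R), 0 <= s ->
  expR (- (B * (m + n)%:R `^ (r / 2))) * (nrm m n * cmod (cmn m n s)) <=
  D * (wgt m * wgt n) * expR (- (b * (s / 2) `^ r)).
Proof.
move=> B0 adm; have [D D0 hD] := admissible_bound B0 adm.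
exists (2 * D); first by rewrite mulr_ge0.
move=> m n s s0; have s20 : 0 <= s / 2 by rewrite divr_ge0.
have [u u0 h] := hD (m + n)%N _ s20.
have h2 : nrm m n * cmod (cmn m n s) <= 2 * expR (u * (m + n)%:R - (s / 2) ^+ 2 * (u / (1 + u))).
  rewrite /nrm ler_pdivrMl ?mulr_gt0 ?hnorm_gt0//.
  have := J_herm_bound m n s u0; rewrite expr_div_n => h2; apply: (le_trans h2).
  have e4 : 2 ^+ 2 = 4 :> R by rewrite expr2 -natrM.
  by rewrite e4 [leRHS]mulrCA [leRHS]mulrA.
apply: (le_trans (ler_wpM2l (expR_ge0 _) h2)).
have -> : 2 * D * (wgt m * wgt n) * expR (- (b * (s / 2) `^ r)) =
  2 * (D * (wgt m * wgt n) * expR (- (b * (s / 2) `^ r))) by rewrite !mulrA.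
rewrite mulrCA -expRD addrA ler_pM2l//.
by apply: (le_trans h); rewrite ler_wpM2r ?expR_ge0// ler_wpM2l// wgt_mul.
Qed.

(** * Absolutely convergent double series *)

Definition wsum N : R := \sum_(m < N) wgt m.

Lemma wsum_le2 N : wsum N <= 2.
Proof.
suff : wsum N <= 2 - 2 / N.+1%:R by move=> h; rewrite (le_trans h)// lerBlDr lerDl divr_ge0.
elim: N => [|N IH]; first by rewrite /wsum big_ord0 divr1 subrr.
rewrite /wsum big_ord_recr/= -/(wsum N).
have : wgt N <= 2 / N.+1%:R - 2 / N.+2%:R.
  have n1 : (0 : R) < N.+1%:R by rewrite ltr0n.
  have n2 : (1 : R) <= N.+1%:R by rewrite ler1n.
  rewrite /wgt -[N.+2%:R]natr1; move: (N.+1%:R : R) n2 n1 => x x1 x0.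
  have x1' : 0 < x + 1 by rewrite addr_gt0.
  have -> : 2 / x - 2 / (x + 1) = 2 / (x * (x + 1)) by field; rewrite !gt_eqF.
  rewrite -[leLHS]mul1r ler_pdivlMr ?mulr_gt0// mulrAC mul1r ler_pdivrMr ?exprn_gt0//.
  by nra.
by move=> h; rewrite (le_trans (lerD IH h))// addrA subrK.
Qed.

Lemma wsum_ge0 N : 0 <= wsum N.
Proof. by apply: sumr_ge0 => i _; exact: wgt_ge0. Qed.

(** Sums over squares, to match the limit that defines [wigner]. *)
Definition dsum (a : nat -> nat -> R) N : R := \sum_(m < N) \sum_(n < N) a m n.

Lemma dsumS a N : dsum a N.+1 = dsum a N + (\sum_(m < N) a m N + \sum_(n < N) a N n + a N N).
Proof.
rewrite /dsum big_ord_recr/= (eq_bigr (fun m : 'I_N => \sum_(n < N) a m n + a m N)).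
  by rewrite big_split/= big_ord_recr/=; ring.
by move=> i _; rewrite big_ord_recr.
Qed.

Lemma dsum_wgt K N : dsum (fun m n => K * (wgt m * wgt n)) N = K * wsum N ^+ 2.
Proof.
rewrite /dsum /wsum expr2 mulr_suml mulr_sumr; apply: eq_bigr => m _.
by rewrite mulr_sumr mulr_sumr; apply: eq_bigr => n _.
Qed.

Lemma dsum_bound (a : nat -> nat -> R) K N : 0 <= K ->
  (forall m n, `|a m n| <= K * (wgt m * wgt n)) -> `|dsum a N| <= 4 * K.
Proof.
move=> K0 h; rewrite (@le_trans _ _ (K * wsum N ^+ 2))//.
  rewrite -dsum_wgt /dsum (le_trans (ler_norm_sum _ _ _))// ler_sum// => m _.
  by rewrite (le_trans (ler_norm_sum _ _ _))// ler_sum.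
rewrite mulrC ler_wpM2r//; have := wsum_le2 N; have := wsum_ge0 N; nra.
Qed.

(** a is the difference of a + K w w and K w w; both are nonnegative, and their square sums are
    nondecreasing and bounded. *)
Lemma dsum_cvg (a : nat -> nat -> R) K : 0 <= K ->
  (forall m n, `|a m n| <= K * (wgt m * wgt n)) -> cvgn (dsum a).
Proof.
move=> K0 h.
have mono (f : nat -> nat -> R) : (forall m n, 0 <= f m n) -> nondecreasing_seq (dsum f).
  move=> f0; apply/nondecreasing_seqP => n; rewrite dsumS lerDl.
  by rewrite !addr_ge0// sumr_ge0.
have cv (f : nat -> nat -> R) L : 0 <= L -> (forall m n, 0 <= f m n <= L * (wgt m * wgt n)) -> cvgn (dsum f).
  move=> L0 f0; apply: nondecreasing_is_cvgn.
    by apply: mono => m n; have /andP[] := f0 m n.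
  exists (4 * L) => _ [n _ <-]; rewrite (le_trans (ler_norm _))//.
  by apply: dsum_bound => // m l; have /andP[h1 h2] := f0 m l; rewrite ger0_norm.
pose f1 m n := a m n + K * (wgt m * wgt n); pose f2 m n := K * (wgt m * wgt n).
have E : dsum a = dsum f1 \- dsum f2.
  apply/funext => N; rewrite /= /dsum -sumrB; apply: eq_bigr => m _.
  by rewrite -sumrB; apply: eq_bigr => n _; rewrite /f1 /f2 addrK.
rewrite E; apply: is_cvgB.
  apply: (cv _ (2 * K)); first by rewrite mulr_ge0.
  by move=> m n; have := h m n; rewrite ler_norml /f1 => /andP[h1 h2]; apply/andP; split; lra.
apply: (cv _ K) => // m n; by rewrite /f2 lexx andbT !mulr_ge0 ?wgt_ge0.
Qed.

End Decay.

Section SumsOfIntegrals.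
Context d (T : measurableType d) (R : realType).
Variable mu : {measure set T -> \bar R}.

Lemma Rintegral_dsum (D : set T) N (f : nat -> nat -> T -> R) : measurable D ->
  (forall m n, mu.-integrable D (EFin \o f m n)) ->
  mu.-integrable D (EFin \o (fun x => dsum (fun m n => f m n x) N)) /\
  \int[mu]_(x in D) dsum (fun m n => f m n x) N = dsum (fun m n => \int[mu]_(x in D) f m n x) N.
Proof.
move=> mD fi; have h m := Rintegral_sumR (index_enum 'I_N) mD (fun n : 'I_N => fi m n).
have [h1 h2] := Rintegral_sumR (index_enum 'I_N) mD (fun m : 'I_N => (h m).1).
split=> //; rewrite /dsum h2; apply: eq_bigr => m _.
by rewrite (h m).2.
Qed.

End SumsOfIntegrals.

Section ComplexMeasurability.
Context d (T : measurableType d) (R : realType).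
Local Notation C := R[i].

Definition cmeas (f : T -> C) := measurable_fun setT (fun z => complex.Re (f z)) /\
  measurable_fun setT (fun z => complex.Im (f z)).

Lemma cmeasD f g : cmeas f -> cmeas g -> cmeas (fun z => f z + g z).
Proof.
move=> [h1 h2] [h3 h4]; split.
  by rewrite (_ : (fun _ => _) = (fun z => complex.Re (f z) + complex.Re (g z))); [exact: measurable_funD|apply/funext => z; rewrite cRIE].
by rewrite (_ : (fun _ => _) = (fun z => complex.Im (f z) + complex.Im (g z))); [exact: measurable_funD|apply/funext => z; rewrite cRIE].
Qed.

Lemma cmeasM f g : cmeas f -> cmeas g -> cmeas (fun z => f z * g z).
Proof.
move=> [h1 h2] [h3 h4]; split.
  rewrite (_ : (fun _ => _) = (fun z => complex.Re (f z) * complex.Re (g z) - complex.Im (f z) * complex.Im (g z))); last by apply/funext => z; rewrite cRIE.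
  by apply: measurable_funB; exact: measurable_funM.
rewrite (_ : (fun _ => _) = (fun z => complex.Re (f z) * complex.Im (g z) + complex.Im (f z) * complex.Re (g z))); last by apply/funext => z; rewrite cRIE.
by apply: measurable_funD; exact: measurable_funM.
Qed.

Lemma cmeas_cst c : cmeas (fun _ => c).
Proof. by split; exact: measurable_cst. Qed.

Lemma cmeas_complex (f g : T -> R) : measurable_fun setT f -> measurable_fun setT g ->
  cmeas (fun z => f z +i* g z).
Proof. by []. Qed.

Lemma cmeas_real (f : T -> R) : measurable_fun setT f -> cmeas (fun z => (f z)%:C).
Proof. by move=> h; split => //; exact: measurable_cst. Qed.

Lemma cmeasX f n : cmeas f -> cmeas (fun z => f z ^+ n).
Proof.
move=> h; elim: n => [|n IH]; first exact: cmeas_cst.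
rewrite (_ : (fun _ => _) = (fun z => f z * f z ^+ n)); first exact: cmeasM.
by apply/funext => z; rewrite exprS.
Qed.

Lemma cmeas_Gmn m n (a b : T -> C) : cmeas a -> cmeas b -> cmeas (fun z => Gmn m n (a z) (b z)).
Proof.
move=> ha hb; elim: n m => [|n IH] m /=; first exact: cmeasX.
by apply: cmeasD; apply: cmeasM => //; exact: cmeas_cst.
Qed.

Lemma cmeas_cexpi (f : T -> R) : measurable_fun setT f -> cmeas (fun z => cexpi (f z)).
Proof.
move=> h; apply: cmeas_complex; apply: measurableT_comp => //; apply: continuous_measurable_fun.
  exact: continuous_cos.
exact: continuous_sin.
Qed.

End ComplexMeasurability.

(** * Wigner function, Radon transform and Fourier transform of a state *)

Section PartialSums.
Context {R : realType}.
Local Notation leb := (@lebesgue_measure R).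
Local Notation C := R[i].
Local Notation Re := complex.Re.
Local Notation measR := (@measurable _ (measurableTypeR R)).
Local Notation ii := (Complex 0 1 : C).
Local Notation pos := (`[0, +oo[%classic : set R).

Lemma conjcM (x y : C) : conjc (x * y) = conjc x * conjc y.
Proof. by case: x y => [a b] [c d]; apply: ceqP; rewrite /=; ring. Qed.

Lemma conjcD (x y : C) : conjc (x + y) = conjc x + conjc y.
Proof. by case: x y => [a b] [c d]; apply: ceqP; rewrite /=; ring. Qed.

(** H_m H_n has the parity of m + n, so c_mn is real or purely imaginary. This is what produces the
    opposite direction of [Efun] when a real part is taken. *)
Lemma conj_cmn m n (t : R) : conjc (cmn m n t) = (-1) ^+ (m + n) * cmn m n t.
Proof.
have ci : conjc (ii * t%:C) = - (ii * t%:C) by apply: ceqP; rewrite !cRIE/=; ring.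
have cn k : conjc (k%:R : C) = k%:R by rewrite -RCnat; apply: ceqP; rewrite /= ?oppr0.
have c0 m0 : conjc (cmn m0 0 t) = (-1) ^+ (m0 + 0) * cmn m0 0 t.
  elim: m0 => [|k IH].
    have -> : cmn 0 0 t = J 1 0 1 * (expR (- (t ^+ 2 / (4 * 1))))%:C.
      by rewrite -J_one ?ltr01// /cmn /= mulr1.
    rewrite expr0 mul1r J1_0; apply: ceqP; rewrite /= ?oppr0 ?mulr0 ?mul0r ?addr0 ?oppr0//; ring.
  by rewrite cmnSl muln0 mul0r addr0 conjcM IH ci !addn0 exprS; ring.
elim: n m => [|n IH] m //.
rewrite cmnSr conjcD conjcM [conjc (_ * cmn _.-1 _ _)]conjcM !IH ci cn addnS exprS.
case: m => [|m] /=; first by rewrite muln0; ring.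
by rewrite !addSn !exprS; ring.
Qed.

Lemma double_radius_ge0 (q p : R) : 0 <= 2 * Num.sqrt (q ^+ 2 + p ^+ 2).
Proof. by rewrite mulr_ge0// sqrtr_ge0. Qed.

(** (1 + q^2) (1 + p^2) <= 1 + 2 |z|^2 + |z|^4, and the exponential absorbs each of these powers of
    |z|. *)
Lemma exp_lor2 (b r : R) : 0 < b -> 0 < r -> exists2 L : R, 0 <= L &
  forall q p : R, expR (- (b * Num.sqrt (q ^+ 2 + p ^+ 2) `^ r)) <= L * (lor q * lor p).
Proof.
move=> b0 r0.
have [K0 K00 h0] := pow_powR_exp 0 b0 r0; have [K2 K20 h2] := pow_powR_exp 2 b0 r0.
have [K4 K40 h4] := pow_powR_exp 4 b0 r0.
exists (K0 + 2 * K2 + K4); first by rewrite !addr_ge0// mulr_ge0.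
move=> q p; set x := Num.sqrt _.
have x0 : 0 <= x by exact: sqrtr_ge0.
have x2 : x ^+ 2 = q ^+ 2 + p ^+ 2 by rewrite sqr_sqrtr// addr_ge0// sqr_ge0.
rewrite /lor -invfM ler_pdivlMr; last by rewrite mulr_gt0// ltr_pwDl// sqr_ge0.
have := h0 x x0; have := h2 x x0; have := h4 x x0; rewrite expr0 mul1r.
have -> : x ^+ 4 = (x ^+ 2) ^+ 2 by rewrite -exprM.
rewrite x2; have := expR_ge0 (- (b * x `^ r)); move: (expR _) => e e0.
have := sqr_ge0 q; have := sqr_ge0 p; move: (q ^+ 2) (p ^+ 2) => u v v0 u0 g4 g2 g0.
have uv : 0 <= u * v by rewrite mulr_ge0.
have : e * ((1 + u) * (1 + v)) <= e * (1 + 2 * (u + v) + (u + v) ^+ 2).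
  by rewrite ler_wpM2l//; nra.
by nra.
Qed.

Variables (rho : nat -> nat -> C) (B r b D : R).
Hypotheses (b0 : 0 < b) (r0 : 0 < r) (D0 : 0 <= D).
Hypothesis Hrho : forall m n, cmod (rho m n) <= expR (- (B * (m + n)%:R `^ (r / 2))).
Hypothesis HD : forall m n (s : R), 0 <= s ->
  expR (- (B * (m + n)%:R `^ (r / 2))) * (nrm m n * cmod (cmn m n s)) <=
  D * (wgt m * wgt n) * expR (- (b * (s / 2) `^ r)).

Lemma rho_cmn m n (s : R) : 0 <= s ->
  cmod (rho m n) * (nrm m n * cmod (cmn m n s)) <=
  D * (wgt m * wgt n) * expR (- (b * (s / 2) `^ r)).
Proof.
move=> s0; apply: (le_trans _ (HD m n s0)); rewrite ler_wpM2r//.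
by rewrite mulr_ge0 ?cmod_ge0// ltW// nrm_gt0.
Qed.

Definition Wt m n (q p : R) : R := Re (rho m n * wigner_mn m n q p).
Definition WN N (q p : R) : R := dsum (fun m n => Wt m n q p) N.
Definition ez (q p : R) : R := expR (- (b * Num.sqrt (q ^+ 2 + p ^+ 2) `^ r)).

(** In [cmod_wigner] the frequency is 2 |z|, so the quantity s / 2 in the decay is |z| itself. *)
Lemma Wt_bound m n q p : `|Wt m n q p| <= pi^-1 * D * ez q p * (wgt m * wgt n).
Proof.
rewrite (le_trans (cmod_Re _))// cmodM cmod_wigner.
have := rho_cmn m n (double_radius_ge0 q p).
have -> : 2 * Num.sqrt (q ^+ 2 + p ^+ 2) / 2 = Num.sqrt (q ^+ 2 + p ^+ 2) by field.
rewrite -/(cmn m n _) -/(ez q p) => h.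
have -> : cmod (rho m n) * (pi^-1 * nrm m n * cmod (cmn m n (2 * Num.sqrt (q ^+ 2 + p ^+ 2)))) =
  pi^-1 * (cmod (rho m n) * (nrm m n * cmod (cmn m n (2 * Num.sqrt (q ^+ 2 + p ^+ 2))))) by ring.
have -> : pi^-1 * D * ez q p * (wgt m * wgt n) = pi^-1 * (D * (wgt m * wgt n) * ez q p) by ring.
by rewrite ler_wpM2l// invr_ge0 pi_ge0.
Qed.

Lemma Kz_ge0 q p : 0 <= pi^-1 * D * ez q p.
Proof. by rewrite !mulr_ge0// ?invr_ge0 ?pi_ge0 ?expR_ge0. Qed.

Lemma WN_bound N q p : `|WN N q p| <= 4 * (pi^-1 * D) * ez q p.
Proof.
rewrite -mulrA; apply: dsum_bound; first exact: Kz_ge0.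
by move=> m n; exact: Wt_bound.
Qed.

Definition Wlim (q p : R) : R := limn (fun N : nat => Re (\sum_(m < N) \sum_(n < N)
    rho m n * wigner_mn m n q p)).

Lemma WlimE q p : Wlim q p = limn (fun N => WN N q p).
Proof.
congr (limn _); apply/funext => N; rewrite /WN /dsum cRe_sum; apply: eq_bigr => m _.
by rewrite cRe_sum.
Qed.

Lemma WN_cvg q p : WN N q p @[N --> \oo] --> Wlim q p.
Proof.
rewrite WlimE; apply: (dsum_cvg (Kz_ge0 q p)) => m n; exact: Wt_bound.
Qed.

Lemma Wlim_bound q p : `|Wlim q p| <= 4 * (pi^-1 * D) * ez q p.
Proof.
have cn : `|WN N q p| @[N --> \oo] --> `|Wlim q p| by apply: cvg_norm; exact: WN_cvg.
rewrite -(cvg_lim _ cn)//; apply: limr_le; first by apply/cvg_ex; eexists; exact: cn.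
by apply: nearW => N; exact: WN_bound.
Qed.

Lemma measurable_Wt m n : measurable_fun setT (fun z : R * R => Wt m n z.1 z.2).
Proof.
have h : cmeas (fun z : R * R => rho m n * wigner_mn m n z.1 z.2).
  rewrite (_ : (fun _ => _) = (fun z : R * R => rho m n *
    ((pi^-1 * nrm m n * Num.sqrt pi * expR (- (z.1 ^+ 2 + z.2 ^+ 2)))%:C * ((-1) ^+ m *
    Gmn m n ((2 : C) * (z.1 +i* z.2)) ((- 2 : C) * (z.1 +i* (- z.2))))))); last first.
    by apply/funext => z; rewrite wigner_G mulNr.
  apply: cmeasM; first exact: cmeas_cst.
  apply: cmeasM.
    apply: cmeas_real; apply: measurable_funM; first exact: measurable_cst.
    apply: measurableT_comp => //; apply: measurableT_comp => //.
    by apply: measurable_funD; apply: measurable_funX.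
  apply: cmeasM; first exact: cmeas_cst.
  apply: cmeas_Gmn; apply: cmeasM; try exact: cmeas_cst.
    by apply: cmeas_complex.
  by apply: cmeas_complex => //; apply: measurableT_comp.
by have [] := h.
Qed.

Lemma measurable_dsum d (T : measurableType d) (f : nat -> nat -> T -> R) N :
  (forall m n, measurable_fun setT (f m n)) -> measurable_fun setT (fun z => dsum (fun m n => f m n z) N).
Proof.
by move=> h; apply: measurable_sum => m; apply: measurable_sum => n.
Qed.

Lemma measurable_WN N : measurable_fun setT (fun z : R * R => WN N z.1 z.2).
Proof. by apply: measurable_dsum => m n; exact: measurable_Wt. Qed.

Lemma measurable_Wlim : measurable_fun setT (fun z : R * R => Wlim z.1 z.2).
Proof.
apply: (measurable_fun_cvg (h := fun N (z : R * R) => WN N z.1 z.2)).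
  by move=> N; exact: measurable_WN.
by move=> z _; exact: WN_cvg.
Qed.

(** The Radon transform of one term: the phase comes from [wigner_rot], the product of Fock
    functions from [cintegral_wigner]. *)
Definition Pt m n (x phi : R) : R :=
  Re (rho m n * (cexpi ((n%:R - m%:R) * phi) * (fock m x * fock n x)%:C)).
Definition PN N (x phi : R) : R := dsum (fun m n => Pt m n x phi) N.
Definition rotq (x phi t : R) := x * cos phi - t * sin phi.
Definition rotp (x phi t : R) := x * sin phi + t * cos phi.
Definition Plim (x phi : R) : R := \int[leb]_t Wlim (rotq x phi t) (rotp x phi t).

Lemma ez_rot x phi t : ez (rotq x phi t) (rotp x phi t) = ez x t.
Proof.
rewrite /ez /rotq /rotp; congr (expR (- (b * Num.sqrt _ `^ r))).
have e := cos2Dsin2 phi.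
transitivity ((x ^+ 2 + t ^+ 2) * (cos phi ^+ 2 + sin phi ^+ 2)); first by ring.
by rewrite e mulr1.
Qed.

Lemma Wt_rot m n x phi t : Wt m n (rotq x phi t) (rotp x phi t) =
  Re (rho m n * cexpi ((n%:R - m%:R) * phi) * wigner_mn m n x t).
Proof. by rewrite /Wt /rotq /rotp wigner_rot mulrA. Qed.

Lemma Cint_wigner m n (x : R) : Cint setT (fun t => wigner_mn m n x t).
Proof.
have i := Cint_scale (pi^-1 * (nrm m n * expR (- x ^+ 2)))%:C measurableT (Cint_J2 (wpoly m n x)).
have E : wigner_mn m n x = (fun t => (pi^-1 * (nrm m n * expR (- x ^+ 2)))%:C * J 1 (2 * t) (wpoly m n x)).
  by apply/funext => t; exact: wigner_J.
by rewrite /Cint E; exact: i.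
Qed.

Lemma Wt_rot_int m n x phi :
  leb.-integrable setT (EFin \o (fun t => Wt m n (rotq x phi t) (rotp x phi t))) /\
  \int[leb]_t Wt m n (rotq x phi t) (rotp x phi t) = Pt m n x phi.
Proof.
set c := rho m n * cexpi ((n%:R - m%:R) * phi).
have ci := Cint_scale c measurableT (Cint_wigner m n x).
split.
  rewrite (_ : (fun t => _) = (fun t => Re (c * wigner_mn m n x t))); first exact: ci.1.
  by apply/funext => t; exact: Wt_rot.
transitivity (Re (cintegral setT (fun t => c * wigner_mn m n x t))).
  by apply: eq_Rintegral => t _; rewrite Wt_rot.
by rewrite cintegralZ//; [rewrite cintegral_wigner /Pt mulrA|exact: Cint_wigner].
Qed.

Variable L : R.
Hypotheses (L0 : 0 <= L) (HL : forall q p : R, ez q p <= L * (lor q * lor p)).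

Definition K1 : R := 4 * (pi^-1 * D) * L.
Lemma K1_ge0 : 0 <= K1. Proof. by rewrite !mulr_ge0// invr_ge0 pi_ge0. Qed.

Lemma WN_rot_lor N x phi t : `|WN N (rotq x phi t) (rotp x phi t)| <= K1 * lor x * lor t.
Proof.
rewrite (le_trans (WN_bound _ _ _))// ez_rot /K1 -[X in _ <= X]mulrA -[X in _ <= X]mulrA.
by apply: ler_wpM2l; [rewrite !mulr_ge0// invr_ge0 pi_ge0|exact: HL].
Qed.

Lemma PN_int N x phi : PN N x phi = \int[leb]_t WN N (rotq x phi t) (rotp x phi t) /\
  leb.-integrable setT (EFin \o (fun t => WN N (rotq x phi t) (rotp x phi t))).
Proof.
have [h1 h2] := Rintegral_dsum N measurableT (fun m n => (Wt_rot_int m n x phi).1).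
split=> //; rewrite /WN h2 /PN; apply: eq_bigr => m _; apply: eq_bigr => n _.
by rewrite (Wt_rot_int m n x phi).2.
Qed.

Definition K2 : R := K1 * \int[leb]_t lor t.

Lemma K2_ge0 : 0 <= K2.
Proof. by rewrite mulr_ge0 ?K1_ge0// Rintegral_ge0// => x _; exact: lor_ge0. Qed.

Lemma PN_bound N x phi : `|PN N x phi| <= K2 * lor x.
Proof.
have [-> h] := PN_int N x phi.
rewrite (le_trans (le_normr_Rintegral measurableT h))//.
have -> : K2 * lor x = \int[leb]_t (K1 * lor x * lor t).
  by rewrite RintegralZl//; [rewrite /K2 mulrAC|exact: integrable_lor].
apply: le_Rintegral => //.
- exact: integrable_abse h.
- exact: integrable_lorZ.
- by move=> t _; exact: WN_rot_lor.
Qed.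

Lemma PN_cvg x phi : PN N x phi @[N --> \oo] --> Plim x phi.
Proof.
rewrite (_ : (fun N => _) = (fun N => \int[leb]_t WN N (rotq x phi t) (rotp x phi t))); last first.
  by apply/funext => N; rewrite (PN_int N x phi).1.
apply: (@dominated_cvgR _ _ _ leb setT _ _ (fun t => K1 * lor x * lor t)) => //.
- by move=> N; have := (PN_int N x phi).2 => /integrableP[/measurable_EFinP].
- by move=> t _; exact: WN_cvg.
- exact: integrable_lorZ.
- by move=> N t _; exact: WN_rot_lor.
Qed.

Lemma Plim_bound x phi : `|Plim x phi| <= K2 * lor x.
Proof.
have cn : `|PN N x phi| @[N --> \oo] --> `|Plim x phi| by apply: cvg_norm; exact: PN_cvg.
rewrite -(cvg_lim _ cn)//; apply: limr_le; first by apply/cvg_ex; eexists; exact: cn.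
by apply: nearW => N; exact: PN_bound.
Qed.

Lemma measurable_hermp n : measurable_fun setT (fun x : R => (hermp R n).[x]).
Proof.
apply: continuous_measurable_fun => x.
by apply: (is_derive_continuous (f := fun x => (hermp R n)^`().[x])) => y; exact: is_derive_poly.
Qed.

Lemma measurable_fock n : measurable_fun setT (fun x : R => fock n x).
Proof.
rewrite (_ : (fun _ => _) = (fun x : R => (hnorm n)^-1 * (hermp R n).[x] * expR (- (x ^+ 2 / 2)))); last first.
  by apply/funext => x; rewrite fockE.
apply: measurable_funM.
  by apply: measurable_funM; [exact: measurable_cst|exact: measurable_hermp].
apply: measurableT_comp => //; apply: measurableT_comp => //.
by apply: measurable_funM => //; exact: measurable_funX.
Qed.

Lemma measurable_Pt m n : measurable_fun setT (fun z : R * R => Pt m n z.1 z.2).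
Proof.
have h : cmeas (fun z : R * R => rho m n * (cexpi ((n%:R - m%:R) * z.2) * (fock m z.1 * fock n z.1)%:C)).
  apply: cmeasM; first exact: cmeas_cst.
  apply: cmeasM; first by apply: cmeas_cexpi; exact: measurable_funM.
  apply: cmeas_real; apply: measurable_funM.
    exact: (measurableT_comp (measurable_fock m)).
  exact: (measurableT_comp (measurable_fock n)).
by have [] := h.
Qed.

Lemma measurable_PN N : measurable_fun setT (fun z : R * R => PN N z.1 z.2).
Proof. by apply: measurable_dsum => m n; exact: measurable_Pt. Qed.

Lemma measurable_Plim : measurable_fun setT (fun z : R * R => Plim z.1 z.2).
Proof.
apply: (measurable_fun_cvg (h := fun N (z : R * R) => PN N z.1 z.2)).
  by move=> N; exact: measurable_PN.
by move=> z _; exact: PN_cvg.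
Qed.

(** * Radial Fourier representation at a point of the plane *)

Section FixedPoint.
Variables q p : R.
Local Notation a := (pj q p).

Definition Tmn m n (t : R) : R := Re (rho m n * ((nrm m n)%:C * (cmn m n t * Amn q p m n t))).
Definition TN N (t : R) : R := dsum (fun m n => Tmn m n t) N.

Lemma Tmn_bound m n t : 0 <= t ->
  `|Tmn m n t| <= 4 * pi * D * expR (- (b * (t / 2) `^ r)) * (wgt m * wgt n).
Proof.
move=> t0; rewrite (le_trans (cmod_Re _))// !cmodM cmod_real ger0_norm ?(ltW (nrm_gt0 _ _))//.
have h := rho_cmn m n t0; have hA := cmod_Amn q p m n t.
have -> : cmod (rho m n) * (nrm m n * (cmod (cmn m n t) * cmod (Amn q p m n t))) =
  cmod (Amn q p m n t) * (cmod (rho m n) * (nrm m n * cmod (cmn m n t))) by ring.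
have -> : 4 * pi * D * expR (- (b * (t / 2) `^ r)) * (wgt m * wgt n) =
  4 * pi * (D * (wgt m * wgt n) * expR (- (b * (t / 2) `^ r))) by ring.
have g := ltW (nrm_gt0 (R:=R) m n).
by apply: ler_pM => //; rewrite ?cmod_ge0// !mulr_ge0// cmod_ge0.
Qed.

Lemma TN_bound N t : 0 <= t -> `|TN N t| <= 16 * pi * D * expR (- (b * (t / 2) `^ r)).
Proof.
move=> t0; have -> : 16 * pi * D * expR (- (b * (t / 2) `^ r)) = 4 * (4 * pi * D * expR (- (b * (t / 2) `^ r))).
  have -> : (16 : R) = 4 * 4 by rewrite -natrM. by ring.
apply: dsum_bound; first by rewrite !mulr_ge0// ?pi_ge0 ?expR_ge0.
by move=> m n; exact: Tmn_bound.
Qed.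

Lemma Tmn_ccont m n : ccont (fun t => rho m n * ((nrm m n)%:C * (cmn m n t * Amn q p m n t))).
Proof.
apply: ccontM (ccont_cst _) _; apply: ccontM (ccont_cst _) _.
exact: ccontM (ccont_cmn m n) (ccont_A q p m n).
Qed.

Lemma measurable_TN N : measurable_fun setT (TN N).
Proof.
apply: measurable_dsum => m n; apply: continuous_measurable_fun.
by have [] := Tmn_ccont m n.
Qed.

Lemma Wt_Tmn m n : leb.-integrable pos (EFin \o (fun t => t * Tmn m n t)) /\
  Wt m n q p = (4 * pi ^+ 2)^-1 * \int[leb]_(t in pos) (t * Tmn m n t).
Proof.
have mp : measR pos by [].
have i := Cint_scale (rho m n * (nrm m n)%:C) mp (Cint_tcA q p m n m n).
have E t : t * Tmn m n t = Re (rho m n * (nrm m n)%:C * (t%:C * (cmn m n t * Amn q p m n t))).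
  rewrite /Tmn.
  have -> : rho m n * (nrm m n)%:C * (t%:C * (cmn m n t * Amn q p m n t)) =
    t%:C * (rho m n * ((nrm m n)%:C * (cmn m n t * Amn q p m n t))) by ring.
  by rewrite [in RHS]cReM /= mul0r subr0.
split; first by have [i1 _] := i; move: i1; apply: eq_integrable => // t _ /=; rewrite E.
have -> : \int[leb]_(t in pos) (t * Tmn m n t) = Re (rho m n * (nrm m n)%:C * Vmn q p m n).
  rewrite -(cintegralZ _ mp (Cint_tcA q p m n m n)).
  by apply: eq_Rintegral => t _; rewrite E.
rewrite /Wt wigner_inversion.
have -> : rho m n * ((nrm m n / (4 * pi ^+ 2))%:C * Vmn q p m n) =
  ((4 * pi ^+ 2)^-1)%:C * (rho m n * (nrm m n)%:C * Vmn q p m n) by rewrite RCM; ring.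
by rewrite [in LHS]cReM /= mul0r subr0.
Qed.

Lemma WN_TN N : leb.-integrable pos (EFin \o (fun t => t * TN N t)) /\
  WN N q p = (4 * pi ^+ 2)^-1 * \int[leb]_(t in pos) (t * TN N t).
Proof.
have mp : measR pos by [].
have [h1 h2] := Rintegral_dsum N mp (fun m n => (Wt_Tmn m n).1).
have E t : dsum (fun m n => t * Tmn m n t) N = t * TN N t.
  by rewrite /TN /dsum mulr_sumr; apply: eq_bigr => m _; rewrite mulr_sumr.
split; first by move: h1; apply: eq_integrable => // t _ /=; rewrite E.
have -> : \int[leb]_(t in pos) (t * TN N t) = dsum (fun m n => \int[leb]_(t in pos) (t * Tmn m n t)) N.
  by rewrite -h2; apply: eq_Rintegral => t _; rewrite E.
rewrite /WN /dsum mulr_sumr; apply: eq_bigr => m _; rewrite mulr_sumr; apply: eq_bigr => n _.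
by rewrite (Wt_Tmn m n).2.
Qed.

Lemma fock_fourier m n (t : R) :
  Cint setT (fun x => cexpi (t * x) * (fock m x * fock n x)%:C) /\
  cintegral setT (fun x => cexpi (t * x) * (fock m x * fock n x)%:C) = (nrm m n)%:C * cmn m n t.
Proof.
have E x : cexpi (t * x) * (fock m x * fock n x)%:C =
  (nrm m n)%:C * ((hermp C m * hermp C n).[x%:C] * gw 1 t x).
  have e : expR (- (x ^+ 2 / 2)) * expR (- (x ^+ 2 / 2)) = expR (- (1 * x ^+ 2)).
    by rewrite -expRD; congr expR; field.
  rewrite hornerM !hermp_real /gw -e !fockE /nrm invfM !RCM; ring.
have i := Cint_scale (nrm m n)%:C measurableT (J_int ltr01 t (hermp C m * hermp C n)).
split.
  move: i => [i1 i2]; split.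
    by move: i1; apply: eq_integrable => // x _; rewrite /comp E.
  by move: i2; apply: eq_integrable => // x _; rewrite /comp E.
rewrite (eq_cintegral (fun x _ => E x)) cintegralZ//; exact: J_int.
Qed.

(** The cosine is the real part of a character, so the integral is k Re(w c). By [conj_cmn], 2 Re(w
    c) is c times the sum over both directions, which gives [Efun]: integrating over [0, pi] then
    covers the whole circle. *)
Lemma Pt_fourier m n (t phi : R) :
  leb.-integrable setT (EFin \o (fun x => cos (t * (a phi - x)) * Pt m n x phi)) /\
  \int[leb]_x (cos (t * (a phi - x)) * Pt m n x phi) =
  2^-1 * Re (rho m n * ((nrm m n)%:C * (cmn m n t * Efun q p m n t phi))).
Proof.
have [i1 i2] := fock_fourier m n t.
set w := cexpi (- (t * a phi)).
have iw := Cint_scale w measurableT i1.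
set k := Re (rho m n * cexpi ((n%:R - m%:R) * phi)).
have E x : cos (t * (a phi - x)) * Pt m n x phi = k * Re (w * (cexpi (t * x) * (fock m x * fock n x)%:C)).
  have -> : Pt m n x phi = k * (fock m x * fock n x).
    by rewrite /Pt mulrA cReM /= mulr0 subr0.
  have -> : w * (cexpi (t * x) * (fock m x * fock n x)%:C) = cexpi (- (t * (a phi - x))) * (fock m x * fock n x)%:C.
    by rewrite mulrA -cexpiD; congr (cexpi _ * _); ring.
  by rewrite [in RHS]cReM /= cosN mulr0 subr0; ring.
split.
  have := integrableR_scale k measurableT iw.1; apply: eq_integrable => // x _ /=.
  by rewrite E.
have -> : \int[leb]_x (cos (t * (a phi - x)) * Pt m n x phi) =
   k * Re (w * ((nrm m n)%:C * cmn m n t)).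
  rewrite -i2 -cintegralZ// -RintegralZl//; last by exact: iw.1.
  by apply: eq_Rintegral => x _; rewrite E.
set c := (nrm m n)%:C * cmn m n t.
have cc : conjc (w * c) = (-1) ^+ (m + n) * (cexpi (t * a phi) * c).
  rewrite conjcM /c conjcM conj_cmn.
  have -> : conjc w = cexpi (t * a phi) by apply: ceqP; rewrite /= ?cosN ?sinN ?opprK.
  have -> : conjc ((nrm m n)%:C) = (nrm m n)%:C :> C by apply: ceqP; rewrite /= ?oppr0.
  by ring.
have h : (Re (w * c))%:C = 2^-1 * (c * (w + (-1) ^+ (m + n) * cexpi (t * a phi))).
  by rewrite ReJ_add cc; ring.
have -> : k * Re (w * c) = Re (rho m n * cexpi ((n%:R - m%:R) * phi) * (Re (w * c))%:C).
  by rewrite [in RHS]cReM /= mulr0 subr0.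
rewrite h.
have -> : rho m n * cexpi ((n%:R - m%:R) * phi) *
    (2^-1 * (c * (w + (-1) ^+ (m + n) * cexpi (t * a phi)))) =
  (2^-1)%:C * (rho m n * ((nrm m n)%:C * (cmn m n t * Efun q p m n t phi))).
  by rewrite /Efun -/w /c (RCV 2) RCnat; ring.
by rewrite [in LHS]cReM /= mul0r subr0.
Qed.

Lemma PN_fourier N (t phi : R) :
  \int[leb]_x (cos (t * (a phi - x)) * PN N x phi) =
  2^-1 * dsum (fun m n => Re (rho m n * ((nrm m n)%:C * (cmn m n t * Efun q p m n t phi)))) N.
Proof.
have [h1 h2] := Rintegral_dsum N measurableT (fun m n => (Pt_fourier m n t phi).1).
have -> : \int[leb]_x (cos (t * (a phi - x)) * PN N x phi) =
    \int[leb]_x dsum (fun m n => cos (t * (a phi - x)) * Pt m n x phi) N.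
  apply: eq_Rintegral => x _; rewrite /PN /dsum mulr_sumr; apply: eq_bigr => m _.
  by rewrite mulr_sumr.
rewrite h2 /dsum mulr_sumr; apply: eq_bigr => m _; rewrite mulr_sumr; apply: eq_bigr => n _.
by rewrite (Pt_fourier m n t phi).2.
Qed.

Lemma PN_TN N (t : R) :
  \int[leb]_(phi in `[0, pi]) \int[leb]_x (cos (t * (a phi - x)) * PN N x phi) = 2^-1 * TN N t.
Proof.
have mI : measR `[0, pi] by [].
have i m n := Cint_scale (rho m n * ((nrm m n)%:C * cmn m n t)) mI (Cint_Efun q p m n t).
have E m n phi : rho m n * ((nrm m n)%:C * (cmn m n t * Efun q p m n t phi)) =
  rho m n * ((nrm m n)%:C * cmn m n t) * Efun q p m n t phi by ring.
have i' m n : leb.-integrable `[0, pi] (EFin \o (fun phi => Re (rho m n * ((nrm m n)%:C * (cmn m n t * Efun q p m n t phi))))).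
  by have [i1 _] := i m n; move: i1; apply: eq_integrable => // phi _ /=; rewrite E.
have [h1 h2] := Rintegral_dsum N mI i'.
transitivity (\int[leb]_(phi in `[0, pi]) (2^-1 * dsum (fun m n => Re (rho m n * ((nrm m n)%:C * (cmn m n t * Efun q p m n t phi)))) N)).
  by apply: eq_Rintegral => phi _; rewrite PN_fourier.
rewrite RintegralZl// h2; congr (_ * _); apply: eq_bigr => m _; apply: eq_bigr => n _.
rewrite /Tmn [in RHS](mulrA (nrm m n)%:C) [in RHS](mulrA (rho m n)) -(cintegralZ _ mI (Cint_Efun q p m n t)).
by apply: eq_Rintegral => phi _; rewrite E.
Qed.

End FixedPoint.
End PartialSums.

(** * Laws and independence *)

Section Laws.
Variable R : realType.

(* Layer-cake approximation of y by indicators of rays. *)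
Definition stair N (y : R) : R := \sum_(k < N) (k.+1%:R <= y)%R%:R.

Lemma stair_bounds N (y : R) : 0 <= y -> y <= N%:R -> y - 1 <= stair N y <= y.
Proof.
move=> y0 yN.
(* The third clause, saturation at N once y >= N, carries the induction. *)
suff [h1 [h2 h3]] : stair N y <= y /\ (y <= N%:R -> y - 1 <= stair N y) /\ (N%:R <= y -> stair N y = N%:R).
  by rewrite h2.
elim: N {yN} => [|N [h1 [h2 h3]]]; rewrite /stair ?big_ord0 ?big_ord_recr/=.
  by split=> //; split=> // h; lra.
rewrite -/(stair N y); have e : N.+1%:R = N%:R + 1 :> R by rewrite -natr1.
case: (lerP N.+1%:R y) => /= hy; rewrite ?mulr1n ?addr0.
  have g := h3 (ltac:(rewrite e in hy; lra)); rewrite g e in hy *.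
  by split=> //; split=> // h; lra.
split=> //; split=> h; last by rewrite e in hy h *; lra.
case: (lerP y N%:R) => hn; first exact: h2.
by rewrite h3 ?ltW//; rewrite e in hy; lra.
Qed.

Lemma stair_cvg (y : R) : 0 <= y <= 1 -> N%:R^-1 * stair N (N%:R * y) @[N --> \oo] --> y.
Proof.
move=> /andP[y0 y1].
have h1 : y - N%:R^-1 @[N --> \oo] --> y.
  rewrite -[X in _ --> X]subr0; apply: cvgB; first exact: cvg_cst.
  by rewrite -cvg_shiftS; exact: cvg_harmonic.
apply: (squeeze_cvgr _ h1 (cvg_cst y)); exists 1%N => // N /= N0.
have N0' : 0 < (N%:R : R) by rewrite ltr0n.
have /andP[a1 a2] : N%:R * y - 1 <= stair N (N%:R * y) <= N%:R * y.
  by apply: stair_bounds; [rewrite mulr_ge0|rewrite ler_piMr].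
rewrite [X in _ <= X <= _]mulrC ler_pdivlMr// ler_pdivrMr//.
by rewrite mulrBl mulVf ?gt_eqF// [y * _]mulrC a1 a2.
Qed.

Let measurable_ray (a b : R) : @measurable _ (measurableTypeR R) [set y : R | b <= a * y].
Proof.
rewrite (_ : [set y | _] = (fun y => a * y) @^-1` `[b, +oo[); last first.
  by apply/seteqP; split => y /=; rewrite in_itv/= andbT.
by rewrite -[X in _ X]setTI; apply: measurable_funM => //; exact: measurable_cst.
Qed.

Let measurable_stair N : measurable_fun setT (fun y : R => stair N (N%:R * y)).
Proof.
apply: measurable_sum => k.
rewrite (_ : (fun _ => _) = \1_[set y | k.+1%:R <= N%:R * y]); last first.
  by apply/funext => y; rewrite indicE; congr ((nat_of_bool _)%:R); apply/idP/idP => [h|/set_mem//]; exact/mem_set.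
by apply: measurable_indic; exact: measurable_ray.
Qed.

Context d1 d2 d (X1 : measurableType d1) (X2 : measurableType d2) (T : measurableType d).
Variables (m1 : {measure set X1 -> \bar R}) (m2 : {measure set X2 -> \bar R}).
Variables (phi1 : X1 -> T) (phi2 : X2 -> T) (p1 : X1 -> R) (p2 : X2 -> R).
Hypotheses (mphi1 : measurable_fun setT phi1) (mphi2 : measurable_fun setT phi2).
Hypotheses (ip1 : m1.-integrable setT (EFin \o p1)) (ip2 : m2.-integrable setT (EFin \o p2)).
Hypothesis eqlaw : forall A, measurable A ->
  \int[m1]_(x in phi1 @^-1` A) p1 x = \int[m2]_(x in phi2 @^-1` A) p2 x.

Lemma integrable_bounded_density dX (X : measurableType dX) (m : {measure set X -> \bar R})
  (g : X -> R) (p : X -> R) (c : R) : measurable_fun setT g -> (forall x, `|g x| <= c) ->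
  m.-integrable setT (EFin \o p) -> m.-integrable setT (EFin \o (fun x => g x * p x)).
Proof.
move=> mg gc ip.
have mp : measurable_fun setT p by have /integrableP[/measurable_EFinP] := ip.
apply: (@integrable_dom _ _ _ m setT _ (fun x => c * `|p x|)) => //.
- exact: measurable_funM.
- by apply: integrableR_scale => //; have := integrable_abse ip.
- by move=> x _; rewrite normrM ler_wpM2r.
Qed.

Let stair_int dX (X : measurableType dX) (m : {measure set X -> \bar R}) (phi : X -> T) (p : X -> R)
  (f : T -> R) N : measurable_fun setT phi -> m.-integrable setT (EFin \o p) -> measurable_fun setT f ->
  \int[m]_x (N%:R^-1 * stair N (N%:R * f (phi x)) * p x) =
  N%:R^-1 * \sum_(k < N) \int[m]_(x in phi @^-1` (f @^-1` [set y | k.+1%:R <= N%:R * y])) p x.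
Proof.
move=> mphi ip mf.
have mS k : measurable (f @^-1` [set y | k.+1%:R <= N%:R * y]).
  by rewrite -[X in measurable X]setTI; apply: mf => //; exact: measurable_ray.
have mS' k : measurable (phi @^-1` (f @^-1` [set y | k.+1%:R <= N%:R * y])).
  by rewrite -[X in measurable X]setTI; exact: mphi.
pose g k x := \1_(phi @^-1` (f @^-1` [set y | k.+1%:R <= N%:R * y])) x * p x.
have ig k : m.-integrable setT (EFin \o g k).
  apply: (integrable_bounded_density (g := \1_(phi @^-1` (f @^-1` [set y | k.+1%:R <= N%:R * y]))) (c := 1)) ip => //.
  by move=> x; rewrite indicE normr_nat; case: (_ \in _).
have [h1 h2] := Rintegral_sumR (index_enum 'I_N) measurableT (fun k : 'I_N => ig k).
transitivity (\int[m]_x (N%:R^-1 * \sum_(k < N) g k x)).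
  apply: eq_Rintegral => x _; rewrite -mulrA; congr (_ * _); rewrite /stair mulr_suml.
  apply: eq_bigr => k _; rewrite /g indicE; congr ((nat_of_bool _)%:R * _).
  by apply/idP/idP => [h|/set_mem//]; exact/mem_set.
rewrite RintegralZl// h2; congr (_ * _); apply: eq_bigr => k _.
rewrite [RHS]Rintegral_mkcond; apply: eq_Rintegral => x _.
by rewrite /g indicE patchE; case: (_ \in _); rewrite ?mul1r ?mul0r.
Qed.

(** f is a limit of normalised sums of indicators of its superlevel sets, on which [eqlaw] applies;
    the densities dominate. *)
Let eqlaw01 (f : T -> R) : measurable_fun setT f -> (forall x, 0 <= f x <= 1) ->
  \int[m1]_x (f (phi1 x) * p1 x) = \int[m2]_x (f (phi2 x) * p2 x).
Proof.
move=> mf f01.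
have cv dX (X : measurableType dX) (m : {measure set X -> \bar R}) (phi : X -> T) (p : X -> R) :
   measurable_fun setT phi -> m.-integrable setT (EFin \o p) ->
   \int[m]_x (N%:R^-1 * stair N (N%:R * f (phi x)) * p x) @[N --> \oo] --> \int[m]_x (f (phi x) * p x).
  move=> mphi ip.
  have mp : measurable_fun setT p by have /integrableP[/measurable_EFinP] := ip.
  apply: (@dominated_cvgR _ _ _ m setT _ _ (fun x => `|p x|)) => //.
  - move=> N; apply: measurable_funM => //; apply: measurable_funM => //.
    exact: (measurableT_comp (measurable_stair N) (measurableT_comp mf mphi)).
  - by move=> x _; apply: cvgM; [exact: stair_cvg|exact: cvg_cst].
  - by have := integrable_abse ip.
  - move=> N x _; rewrite normrM ler_piMl//.
    have [->|N0] := eqVneq N 0%N; first by rewrite invr0 mul0r normr0.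
    have N0' : 0 < (N%:R : R) by rewrite ltr0n lt0n.
    have /andP[y0 y1] := f01 (phi x).
    have /andP[a1 a2] : N%:R * f (phi x) - 1 <= stair N (N%:R * f (phi x)) <= N%:R * f (phi x).
      by apply: stair_bounds; [rewrite mulr_ge0|rewrite ler_piMr// ltW].
    have s0 : 0 <= stair N (N%:R * f (phi x)) by apply: sumr_ge0 => k _; exact: ler0n.
    rewrite ger0_norm; last by rewrite mulr_ge0// invr_ge0 ltW.
    by rewrite ler_pdivrMl// mulr1 (le_trans a2)// ler_piMr// ltW.
have c1 := cv _ _ _ _ _ mphi1 ip1; have c2 := cv _ _ _ _ _ mphi2 ip2.
apply: (@cvg_unique _ (@Rhausdorff R) _ _ _ _ c1).
suff -> : (fun N => \int[m1]_x (N%:R^-1 * stair N (N%:R * f (phi1 x)) * p1 x)) =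
   (fun N => \int[m2]_x (N%:R^-1 * stair N (N%:R * f (phi2 x)) * p2 x)) by exact: c2.
apply/funext => N; rewrite !stair_int//; congr (_ * _); apply: eq_bigr => k _; apply: eqlaw.
by rewrite -[X in measurable X]setTI; apply: mf => //; exact: measurable_ray.
Qed.

(* The densities p1 and p2 may change sign: the Radon transform need not be known
   to be nonnegative. *)
Lemma eq_Rintegral_law (f : T -> R) (c : R) : measurable_fun setT f -> (forall x, `|f x| <= c) ->
  \int[m1]_x (f (phi1 x) * p1 x) = \int[m2]_x (f (phi2 x) * p2 x).
Proof.
move=> mf fc0; pose c1 := `|c| + 1.
have c10 : 0 < c1 by rewrite ltr_wpDl.
have fc x : `|f x| <= c1 by rewrite (le_trans (fc0 x))// (le_trans (ler_norm _))// lerDl.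
pose g x := (f x + c1) / (2 * c1).
have mg : measurable_fun setT g.
  by apply: measurable_funM => //; apply: measurable_funD.
have g01 x : 0 <= g x <= 1.
  by have := fc x; rewrite ler_norml /g => /andP[a1 a2]; rewrite ler_pdivlMr ?ler_pdivrMr ?mulr_gt0//; lra.
have E dX (X : measurableType dX) (m : {measure set X -> \bar R}) (phi : X -> T) (p : X -> R) :
   measurable_fun setT phi -> m.-integrable setT (EFin \o p) ->
   \int[m]_x (f (phi x) * p x) = 2 * c1 * \int[m]_x (g (phi x) * p x) - c1 * \int[m]_x p x.
  move=> mphi ip.
  have ig : m.-integrable setT (EFin \o (fun x => g (phi x) * p x)).
    apply: (integrable_bounded_density (c := 1)) => //; first exact: measurableT_comp.
    by move=> x; have /andP[a1 a2] := g01 (phi x); rewrite ger0_norm.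
  rewrite -RintegralZl// -RintegralZl// -RintegralB//; [|exact: integrableR_scale..].
  apply: eq_Rintegral => x _; rewrite /g; field; exact: lt0r_neq0.
rewrite !E// eqlaw01//; congr (_ - _ * _).
by have := eqlaw measurableT; rewrite !preimage_setT.
Qed.

End Laws.

(** * Independence as factorisation of integrals *)

Section Independence.
Context d (Omega : measurableType d) (R : realType) (P : probability Omega R).

Lemma bounded_integrable (f : Omega -> R) (c : R) : measurable_fun setT f ->
  (forall w, `|f w| <= c) -> P.-integrable setT (EFin \o f).
Proof.
move=> mf fc; apply: (@integrable_dom _ _ _ P setT _ (fun _ => c)) => //.
by apply: finite_measure_integrable_cst.
Qed.

Context d1 d2 (T1 : measurableType d1) (T2 : measurableType d2).
Variables (U : Omega -> T1) (V : Omega -> T2).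
Hypotheses (mU : measurable_fun setT U) (mV : measurable_fun setT V).
Hypothesis indepUV : forall A B, measurable A -> measurable B ->
  (P (U @^-1` A `&` V @^-1` B) = P (U @^-1` A) * P (V @^-1` B))%E.

Let mpre d' (T : measurableType d') (X : Omega -> T) A : measurable_fun setT X ->
  measurable A -> measurable (X @^-1` A).
Proof. by move=> mX mA; rewrite -[X in measurable X]setTI; exact: mX. Qed.

Let Rint_indic (A B : set Omega) : measurable A -> measurable B ->
  \int[P]_(w in A) \1_B w = fine (P (A `&` B)).
Proof.
by move=> mA mB; rewrite /Rintegral integral_indic// setIC.
Qed.

(** [eq_Rintegral_law] is used twice. By independence V has the same law under the density 1_(U in
    A) as under the constant P(U in A); hence U has the same law under the signed density g(V) as
    under the constant E[g(V)]. *)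
Lemma Rintegral_indep (f : T1 -> R) (g : T2 -> R) (c c' : R) :
  measurable_fun setT f -> measurable_fun setT g ->
  (forall x, `|f x| <= c) -> (forall x, `|g x| <= c') ->
  \int[P]_w (f (U w) * g (V w)) = \int[P]_w f (U w) * \int[P]_w g (V w).
Proof.
move=> mf mg fc gc.
have ig : P.-integrable setT (EFin \o (fun w => g (V w))).
  by apply: (bounded_integrable (c := c')) => //; exact: measurableT_comp.
have i1 (k : R) : P.-integrable setT (EFin \o (fun _ : Omega => k)).
  by apply: finite_measure_integrable_cst.
have ii' A : measurable A -> P.-integrable setT (EFin \o (\1_A : Omega -> R)).
  move=> mA; apply: (bounded_integrable (c := 1)); first exact: measurable_indic.
  by move=> w; rewrite indicE normr_nat; case: (_ \in _).
have s1 A : measurable A -> \int[P]_(w in U @^-1` A) g (V w) = fine (P (U @^-1` A)) * \int[P]_w g (V w).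
  move=> mA; have mUA := mpre mU mA.
  have := @eq_Rintegral_law R _ _ _ _ _ _ P P V V (\1_(U @^-1` A)) (fun=> fine (P (U @^-1` A))) mV mV
     (ii' _ mUA) (i1 _) _ g c' mg gc.
  have -> : \int[P]_w (g (V w) * \1_(U @^-1` A) w) = \int[P]_(w in U @^-1` A) g (V w).
    rewrite [RHS]Rintegral_mkcond; apply: eq_Rintegral => w _.
    by rewrite indicE patchE; case: (_ \in _); rewrite ?mulr1 ?mulr0.
  move=> ->; first by rewrite RintegralZr// mulrC.
  move=> B mB; rewrite Rint_indic//; last exact: mpre.
  rewrite Rintegral_cst; last exact: mpre.
  by rewrite setIC indepUV// fineM// fin_num_measure//; exact: mpre.
have := @eq_Rintegral_law R _ _ _ _ _ _ P P U U (fun w => g (V w)) (fun=> \int[P]_w g (V w)) mU mU ig (i1 _) _ f c mf fc.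
move=> ->; first by rewrite RintegralZr//; apply: (bounded_integrable (c := c)) => //; exact: measurableT_comp.
by move=> A mA; rewrite s1// Rintegral_cst; [rewrite mulrC|exact: mpre].
Qed.

End Independence.

Section Rectangles.
Context d1 d2 (T1 : measurableType d1) (T2 : measurableType d2) (R : realType).

Lemma measure_eq_rect (m1 m2 : {measure set (T1 * T2) -> \bar R}) :
  (m1 setT < +oo)%E ->
  (forall A B, measurable A -> measurable B -> m1 (A `*` B) = m2 (A `*` B)) ->
  forall E, measurable E -> m1 E = m2 E.
Proof.
move=> fin m12 X mX.
pose C : set (set (T1 * T2)) :=
  [set C | exists A, measurable A /\ exists B, measurable B /\ C = A `*` B].
apply: (@measure_unique _ _ _ C (fun _ => setT)) => //.
- rewrite measurable_prod_measurableType //; congr (<<s _ >>).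
  rewrite predeqE; split => [[A mA [B mB <-]]|[A [mA [B [mB ->]]]]].
    by exists A; split => //; exists B.
  by exists A => //; exists B.
- move=> /= _ _ [X1 [mX1 [X2 [mX2 ->]]]] [Y1 [mY1 [Y2 [mY2 ->]]]].
  rewrite -setXI; exists (X1 `&` Y1); split; first exact: measurableI.
  by exists (X2 `&` Y2); split => //; exact: measurableI.
- by move=> _; exists setT; split => //; exists setT; split => //; rewrite setXTT.
- by rewrite bigcup_const.
- by move=> A [A1 [mA1 [A2 [mA2 ->]]]]; exact: m12.
Qed.

End Rectangles.

(** * The deconvolution kernel and the noise *)

Section Kernel.
Context {R : realType}.
Local Notation leb := (@lebesgue_measure R).
Local Notation C := R[i].
Local Notation measR := (@measurable _ (measurableTypeR R)).

Lemma Rintegral_even (g : R -> R) (a : R) : 0 < a -> continuous g ->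
  (forall x, g (- x) = g x) ->
  \int[leb]_(x in `[- a, a]) g x = 2 * \int[leb]_(x in `[0, a]) g x.
Proof.
move=> a0 cg eg.
have a0' : - a < 0 by rewrite oppr_lt0.
have ig : leb.-integrable `[- a, a] (EFin \o g) := continuous_integrable_seg _ _ cg.
have e : (`[- a, a]%classic : set R) = `[- a, 0[%classic `|` `[0, a]%classic.
  apply/seteqP; split => x /=; rewrite !in_itv/=.
    by move=> /andP[h1 h2]; case: (ltrP x 0) => h; [left|right]; rewrite ?h1 ?h2.
  move=> [/andP[h1 h2]|/andP[h1 h2]]; rewrite ?h1 ?h2/= ?andbT.
    by rewrite ltW// (lt_trans h2).
  by rewrite (le_trans _ h1)// ltW.
rewrite e Rintegral_setU//; last 2 first.
- by rewrite -e.
- by apply/disj_setPS => x [/=]; rewrite !in_itv/= => /andP[_ h1] /andP[h2 _]; lra.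
rewrite Rintegral_itv_bndo_bndc; last first.
  by apply: integrableS ig => //; rewrite e; exact: subsetUl.
have -> : \int[leb]_(x in `[- a, 0]) g x = \int[leb]_(x in `[0, a]) g x.
  have := integration_by_substitution_oppr (G := g) (ltW a0) (continuous_subspaceT (fun x => cg x)).
  rewrite oppr0 /Rintegral => ->; congr fine.
  by apply: eq_integral => x _ /=; rewrite eg.
by rewrite mulr_natl mulr2n.
Qed.

Lemma dexpsq (gam x : R) : is_derive x 1 (fun y : R => expR (gam * y ^+ 2)) (2 * gam * x * expR (gam * x ^+ 2)).
Proof.
apply: (is_derive_ext (is_derive_compR (is_derive_expR _) (is_derive_scaleR gam (is_derive_mulR (is_derive_idR x) (is_derive_idR x))))) => [y|]; first by rewrite expr2.
by rewrite expr2; ring.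
Qed.

Definition kw (gam t : R) : R := `|t| * expR (gam * t ^+ 2).

(** The deconvolution kernel at a = 1 / h, after the even integrand has been folded onto [0, a],
    whence 1 / (2 pi) in place of 1 / (4 pi). *)
Definition kern (gam a u : R) : R :=
  (2 * pi)^-1 * \int[leb]_(t in `[0, a]) (cos (u * t) * kw gam t).

Lemma continuous_kw gam : continuous (kw gam).
Proof.
move=> t; apply: cvgM; first by apply: cvg_norm; exact: cvg_id.
exact: (is_derive_continuous (dexpsq gam)).
Qed.

Lemma continuous_coskw gam u : continuous (fun t : R => cos (u * t) * kw gam t).
Proof.
move=> t; apply: cvgM; last exact: continuous_kw.
apply: (@continuous_comp _ _ _ (fun t => u * t) cos); last exact: continuous_cos.
by apply: cvgM; [exact: cvg_cst|exact: cvg_id].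
Qed.

Lemma kernelK_kern (eta h u : R) : 0 < eta < 1 -> 0 < h ->
  kernelK eta h u = kern ((1 - eta) / (4 * eta)) h^-1 u.
Proof.
move=> /andP[e0 e1] h0; set gam := (1 - eta) / _.
rewrite /kernelK cReM /= mul0r subr0 /kern.
have E t : complex.Re (cexpi (- (u * t)) * (`|t| / noise_ft eta (t / Num.sqrt eta))%:C) = cos (u * t) * kw gam t.
  rewrite cReM /= mulr0 subr0 cosN /kw; congr (_ * (_ * _)).
  rewrite /noise_ft -expRN; congr expR; rewrite opprK expr_div_n sqr_sqrtr ?ltW// /gam.
  by field; exact: lt0r_neq0.
have -> : \int[leb]_(t in `[- h^-1, h^-1]) complex.Re (cexpi (- (u * t)) * (`|t| / noise_ft eta (t / Num.sqrt eta))%:C) =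
  \int[leb]_(t in `[- h^-1, h^-1]) (cos (u * t) * kw gam t) by apply: eq_Rintegral => t _; exact: E.
rewrite Rintegral_even ?invr_gt0//; first last.
- by move=> t; rewrite /kw normrN sqrrN mulrN cosN.
- exact: continuous_coskw.
have p0 := lt0r_neq0 (@pi_gt0 R); move: (\int[_]_(_ in _) _) (pi) p0 => I q q0.
by field.
Qed.

Variable gam : R.
Hypothesis gam0 : 0 < gam.
Variable a : R.
Hypothesis a0 : 0 < a.

(** From int_0^a t e^(gam t^2) dt <= e^(gam a^2) / (2 gam). *)
Definition kernM : R := (4 * pi * gam)^-1 * expR (gam * a ^+ 2).

Lemma kernM_ge0 : 0 <= kernM.
Proof. by rewrite mulr_ge0 ?expR_ge0// invr_ge0 !mulr_ge0 ?pi_ge0// ltW. Qed.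

Lemma kern_bound u : `|kern gam a u| <= kernM.
Proof.
rewrite /kern /kernM normrM ger0_norm; last by rewrite invr_ge0 mulr_ge0// pi_ge0.
have ic := continuous_integrable_seg 0 a (@continuous_coskw gam u).
have mI : measR `[0, a] by [].
have cF : continuous (fun t : R => t * expR (gam * t ^+ 2)).
  move=> t; apply: cvgM; first exact: cvg_id.
  exact: (is_derive_continuous (dexpsq gam)).
have iF := continuous_integrable_seg 0 a cF.
have h1 : `|\int[leb]_(t in `[0, a]) (cos (u * t) * kw gam t)| <= \int[leb]_(t in `[0, a]) (t * expR (gam * t ^+ 2)).
  rewrite (le_trans (le_normr_Rintegral mI ic))//.
  apply: le_Rintegral => //; first exact: integrable_abse ic.
  move=> t /=; rewrite in_itv/= => /andP[t0 ta].
  rewrite normrM /kw (ger0_norm t0) (ger0_norm (_ : 0 <= t * _)) ?mulr_ge0 ?expR_ge0//.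
  by rewrite ler_piMl ?mulr_ge0 ?expR_ge0// cos_max.
have h2 : \int[leb]_(t in `[0, a]) (t * expR (gam * t ^+ 2)) = (2 * gam)^-1 * expR (gam * a ^+ 2) - (2 * gam)^-1 * expR (gam * 0 ^+ 2).
  apply: (Rintegral_FTC2 (F := fun t => (2 * gam)^-1 * expR (gam * t ^+ 2))) => // x.
  apply: (is_derive_ext (is_derive_scaleR (2 * gam)^-1 (dexpsq gam x))) => //.
  by field; exact: lt0r_neq0.
rewrite h2 in h1.
have pp := @pi_gt0 R.
have -> : (4 * pi * gam)^-1 = (2 * pi)^-1 * (2 * gam)^-1 :> R by rewrite -invfM; congr (_^-1); ring.
rewrite -mulrA; apply: ler_wpM2l; first by rewrite invr_ge0 mulr_ge0// ltW.
by rewrite (le_trans h1)// gerBl mulr_ge0 ?expR_ge0// invr_ge0 mulr_ge0// ltW//.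
Qed.

Lemma measurable_kern : measurable_fun setT (kern gam a).
Proof.
have mI : measR `[0, a] by [].
apply: continuous_measurable_fun.
suff h : continuous (fun u : R => \int[leb]_(t in `[0, a]) (cos (u * t) * kw gam t)).
  by move=> u; apply: cvgM; [exact: cvg_cst|exact: h].
have iG : leb.-integrable `[0, a] (EFin \o (fun t => `|t| * kw gam t)).
  apply: (continuous_integrable_seg 0 a) => t; apply: cvgM; last exact: continuous_kw.
  by apply: cvg_norm; exact: cvg_id.
have kw0 t : 0 <= kw gam t by rewrite mulr_ge0 ?expR_ge0.
apply: is_derive_continuous => u.
apply: (is_derive_Rintegral (df := fun s t => - (sin (s * t) * t) * kw gam t) mI _ _ iG).
- by move=> s; apply: continuous_integrable_seg; exact: continuous_coskw.
- move=> s t.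
  apply: (is_derive_ext (is_derive_mulR (is_derive_compR (is_derive_cos _) (is_derive_mulR (is_derive_idR s) (is_derive_cstR t s))) (is_derive_cstR (kw gam t) s))) => //.
  by ring.
- by move=> t; rewrite mulr_ge0.
- move=> s t _ _; rewrite normrM normrN normrM (ger0_norm (kw0 t)); apply: ler_wpM2r => //.
  by rewrite ler_piMl// sin_max.
Qed.

End Kernel.

(** * Characteristic function of the noise *)

Section GaussianNoise.
Context d (Omega : measurableType d) (R : realType) (P : probability Omega R).
Variable xi : Omega -> R.
Hypothesis mxi : measurable_fun setT xi.
Hypothesis hxi : forall A : set R, measurable A -> P (xi @^-1` A) = normal_prob 0 1 A.
Local Notation leb := (@lebesgue_measure R).

Lemma gauss_law (f : R -> R) (c : R) : measurable_fun setT f -> (forall x, `|f x| <= c) ->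
  \int[P]_w f (xi w) = \int[leb]_x (f x * normal_pdf 0 1 x).
Proof.
move=> mf fc.
have i1 : P.-integrable setT (EFin \o (fun _ : Omega => 1 : R)) by exact: finite_measure_integrable_cst.
have := eq_Rintegral_law (m2 := leb) (phi2 := idfun) (p2 := normal_pdf 0 1) mxi _ i1 _ _ mf fc.
move=> <-//; first by apply: eq_Rintegral => w _; rewrite mulr1.
- exact: measurable_id.
- exact: integrable_normal_pdf.
move=> A mA; rewrite Rintegral_cst ?mul1r; last by rewrite -[X in _ X]setTI; exact: mxi.
by rewrite /Rintegral -/(normal_prob 0 1 A); congr fine; exact: hxi.
Qed.

Let pk : R := normal_peak 1.

Let pdfE (x : R) : normal_pdf 0 1 x = pk * expR (- (2^-1 * x ^+ 2)).
Proof.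
rewrite normal_pdfE ?oner_neq0//; congr (_ * expR _).
by rewrite subr0 expr1n mulr2n; field.
Qed.

Let J_pdf (s : R) : cintegral setT (fun x => (normal_pdf 0 1 x)%:C * cexpi (s * x)) =
  (expR (- (s ^+ 2 / 2)))%:C.
Proof.
have c0 : (0 : R) < 2^-1 by rewrite invr_gt0.
have E t : cintegral setT (fun x => (normal_pdf 0 1 x)%:C * cexpi (t * x)) = pk%:C * J 2^-1 t 1.
  rewrite /J -cintegralZ//; last exact: J_int.
  by apply: eq_cintegral => x _; rewrite pdfE hornerC RCM /gw; ring.
rewrite E J_one// mulrA.
(* The product of constants is recognised as the total mass of the density, by evaluating the
   transform at 0. *)
have -> : pk%:C * J 2^-1 0 1 = 1.
  rewrite -E; apply: ceqP => /=.
    rewrite -[RHS]/(fine 1%E) -(integral_normal_pdf 0 1); congr fine.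
    by apply: eq_integral => x _; rewrite mul0r cos0 sin0 mulr1 mulr0 subr0.
  by rewrite /Rintegral integral0_eq// => x _; rewrite mul0r sin0 mulr0 mul0r addr0.
rewrite mul1r; congr ((expR (- _))%:C); by field.
Qed.

Lemma gauss_cos (s : R) : \int[P]_w cos (s * xi w) = expR (- (s ^+ 2 / 2)).
Proof.
have mc : measurable_fun setT (fun x : R => cos (s * x)).
  apply: measurableT_comp; last exact: measurable_funM.
  by apply: continuous_measurable_fun; exact: continuous_cos.
rewrite (gauss_law (f := fun x => cos (s * x)) (c := 1) mc); last first.
  by move=> x; rewrite cos_max.
have := congr1 (@complex.Re R) (J_pdf s) => /= <-.
by apply: eq_Rintegral => x _; rewrite mul0r subr0 mulrC.
Qed.

Lemma gauss_sin (s : R) : \int[P]_w sin (s * xi w) = 0.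
Proof.
have mc : measurable_fun setT (fun x : R => sin (s * x)).
  apply: measurableT_comp; last exact: measurable_funM.
  by apply: continuous_measurable_fun; exact: continuous_sin.
rewrite (gauss_law (f := fun x => sin (s * x)) (c := 1) mc); last first.
  by move=> x; rewrite sin_max.
have /= h := congr1 (@complex.Im R) (J_pdf s); rewrite -[RHS]h.
by apply: eq_Rintegral => x _; rewrite mul0r addr0 mulrC.
Qed.

End GaussianNoise.

(** * Lebesgue measure on the plane *)

Section PlaneMeasure.
Context {R : realType}.
Local Notation leb := (@lebesgue_measure R).
Local Notation leb2 := (@lebesgue_measure R \x @lebesgue_measure R)%E.

Lemma square_measure (a : R) : 0 < a ->
  leb2 (`[- a, a]%classic `*` `[- a, a]%classic : set (measurableTypeR R * measurableTypeR R)) = ((2 * a) ^+ 2)%:E.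
Proof.
move=> a0; have ma : @measurable _ (measurableTypeR R) `[- a, a] by [].
pose I : set (measurableTypeR R) := `[- a, a]%classic.
have e : leb I = (2 * a)%:E.
  by rewrite /I lebesgue_measure_itv/= lte_fin gtrN// -EFinD opprK; congr EFin; ring.
transitivity (leb I * leb I)%E; first exact: product_measure1E.
by rewrite e -EFinM expr2.
Qed.

Lemma sigma_finite_leb2 : sigma_finite setT leb2.
Proof.
exists (fun N : nat => (`[- N.+1%:R, N.+1%:R]%classic `*` `[- N.+1%:R, N.+1%:R]%classic) : set (measurableTypeR R * measurableTypeR R)).
  apply/seteqP; split => // -[x y] _; exists (Num.truncn (`|x| + `|y|)) => //.
  have h := truncnS_gt (`|x| + `|y|).
  have hx : `|x| <= (Num.truncn (`|x| + `|y|)).+1%:R by rewrite (le_trans _ (ltW h))// lerDl.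
  have hy : `|y| <= (Num.truncn (`|x| + `|y|)).+1%:R by rewrite (le_trans _ (ltW h))// lerDr.
  by split; rewrite /= in_itv/= -ler_norml.
move=> N; split; first exact: measurableX.
by rewrite [X in (X < _)%E]square_measure ?ltr0n// ltry.
Qed.

(* The sigma-finite structure of the product is not found by inference. *)
Definition leb2S := HB.pack_for (@SigmaFiniteMeasure.type _ (measurableTypeR R * measurableTypeR R)%type R)
  leb2 (Measure_isSigmaFinite.Build _ _ _ leb2 sigma_finite_leb2).
End PlaneMeasure.

Section IndependencePairs.
Context d (Omega : measurableType d) (R : realType) (P : probability Omega R).

Let mpre d' (T : measurableType d') (X : Omega -> T) A : measurable_fun setT X ->
  measurable A -> measurable (X @^-1` A).
Proof. by move=> mX mA; rewrite -[X in measurable X]setTI; exact: mX. Qed.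

(** For a fixed event G both sides are finite measures in E, so agreement on rectangles is enough.
    [indep_pairs] applies this to one factor after the other. *)
Lemma indep_rect_ext d1 d2 (T1 : measurableType d1) (T2 : measurableType d2)
  (V : Omega -> T1 * T2) (G : set Omega) : measurable_fun setT V -> measurable G ->
  (forall A B, measurable A -> measurable B ->
    (P (V @^-1` (A `*` B) `&` G) = P (V @^-1` (A `*` B)) * P G)%E) ->
  forall E, measurable E -> (P (V @^-1` E `&` G) = P (V @^-1` E) * P G)%E.
Proof.
move=> mV mG h E mE.
have [m1 Hm1] : exists m1 : {measure set (T1 * T2) -> \bar R}, forall A, m1 A = P (V @^-1` A `&` G).
  unshelve eexists; first by unshelve refine (pushforward (mrestr P mG) V : {measure set (T1 * T2) -> \bar R}).
  by [].
have g0 : (0 <= fine (P G))%R by rewrite fine_ge0.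
have [m2 Hm2] : exists m2 : {measure set (T1 * T2) -> \bar R}, forall A, m2 A = (P G * P (V @^-1` A))%E.
  unshelve eexists; first by unshelve refine (pushforward (mscale (NngNum g0) P) V : {measure set (T1 * T2) -> \bar R}).
  by move=> A; rewrite /= /pushforward /mscale /= fineK// fin_num_measure.
rewrite -Hm1 muleC -Hm2; apply: measure_eq_rect => //.
  by rewrite Hm1 (le_lt_trans (probability_le1 P _)) ?ltry//; apply: measurableI => //; exact: mpre.
by move=> A B mA mB; rewrite Hm1 Hm2 h// muleC.
Qed.

Lemma indep_pairs d1 d2 d3 d4 (T1 : measurableType d1) (T2 : measurableType d2)
  (T3 : measurableType d3) (T4 : measurableType d4)
  (V : Omega -> T1 * T2) (W : Omega -> T3 * T4) :
  measurable_fun setT V -> measurable_fun setT W ->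
  (forall A B A' B', measurable A -> measurable B -> measurable A' -> measurable B' ->
    (P (V @^-1` (A `*` B) `&` W @^-1` (A' `*` B')) = P (V @^-1` (A `*` B)) * P (W @^-1` (A' `*` B')))%E) ->
  forall E F, measurable E -> measurable F ->
    (P (V @^-1` E `&` W @^-1` F) = P (V @^-1` E) * P (W @^-1` F))%E.
Proof.
move=> mV mW h E F mE mF.
apply: indep_rect_ext => //; first exact: mpre.
move=> A B mA mB; rewrite setIC muleC; apply: indep_rect_ext => //.
  by apply: mpre => //; exact: measurableX.
by move=> A' B' mA' mB'; rewrite setIC muleC; exact: h.
Qed.

End IndependencePairs.

(** * Risk of the estimator *)

Section MeanSquaredError.
Context d (Omega : measurableType d) (R : realType) (P : probability Omega R).

(** With Y_l = Z_l - c the mean square is the average of all E[Y_l Y_k]. Off the diagonal,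
    independence makes it a product of two biases, at most be^2; on the diagonal it is a squared
    bias plus a variance of at most M^2, and there are n such terms among n^2. *)
Lemma mse_bound n (Z : 'I_n -> Omega -> R) (M c be : R) : (0 < n)%N ->
  (forall l, measurable_fun setT (Z l)) -> (forall l w, `|Z l w| <= M) ->
  (forall l k, l != k -> \int[P]_w (Z l w * Z k w) = \int[P]_w Z l w * \int[P]_w Z k w) ->
  (forall l, `|\int[P]_w Z l w - c| <= be) ->
  \int[P]_w ((n%:R^-1 * \sum_(l < n) Z l w - c) ^+ 2) <= M ^+ 2 / n%:R + be ^+ 2.
Proof.
move=> n0 mZ ZM Zi Zb.
have nn0 : (n%:R : R) != 0 by rewrite pnatr_eq0 -lt0n.
have n0' : 0 < (n%:R : R) by rewrite ltr0n.
pose Y l w := Z l w - c.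
have mY l : measurable_fun setT (Y l) by apply: measurable_funB.
have M0 : 0 <= M.
  have w0 : Omega by exact: point.
  by rewrite (le_trans _ (ZM (Ordinal n0) w0)).
have YM l w : `|Y l w| <= M + `|c| by rewrite (le_trans (ler_normB _ _))// lerD.
have iZ l := bounded_integrable P (mZ l) (ZM l).
have iZZ l k : P.-integrable setT (EFin \o (fun w => Z l w * Z k w)).
  apply: (bounded_integrable P (c := M * M)); first exact: measurable_funM.
  by move=> w; rewrite normrM ler_pM.
have iY l k : P.-integrable setT (EFin \o (fun w => Y l w * Y k w)).
  apply: (bounded_integrable P (c := (M + `|c|) * (M + `|c|))); first exact: measurable_funM.
  by move=> w; rewrite normrM ler_pM.
have ic (u : R) : P.-integrable setT (EFin \o (fun _ : Omega => u)) by exact: finite_measure_integrable_cst.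
have cE (u : R) : \int[P]_w u = u.
  by rewrite /Rintegral integral_cst//= probability_setT mule1.
have EY l k : \int[P]_w (Y l w * Y k w) = \int[P]_w (Z l w * Z k w) - c * \int[P]_w Z l w - c * \int[P]_w Z k w + c ^+ 2.
  have e w : Y l w * Y k w = Z l w * Z k w + (- c * Z l w + (- c * Z k w + c ^+ 2)) by rewrite /Y; ring.
  transitivity (\int[P]_w (Z l w * Z k w + (- c * Z l w + (- c * Z k w + c ^+ 2)))).
    by apply: eq_Rintegral => w _; rewrite e.
  have j1 := integrableR_scale (- c) measurableT (iZ l).
  have j2 := integrableR_scale (- c) measurableT (iZ k).
  have j3 := integrableR_add measurableT j2 (ic (c ^+ 2)).
  have j4 := integrableR_add measurableT j1 j3.
  rewrite (RintegralD measurableT (iZZ l k) j4) (RintegralD measurableT j1 j3).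
  rewrite (RintegralD measurableT j2 (ic (c ^+ 2))) !RintegralZl// cE; ring.
have be0 : 0 <= be by rewrite (le_trans _ (Zb (Ordinal n0))).
have Yb l k : \int[P]_w (Y l w * Y k w) <= be ^+ 2 + (l == k)%:R * M ^+ 2.
  rewrite EY; have b1 := Zb l; have b2 := Zb k.
  have [<-|lk] := eqVneq l k; last first.
    rewrite Zi// mul0r addr0 expr2.
    have -> : \int[P]_w Z l w * \int[P]_w Z k w - c * \int[P]_w Z l w - c * \int[P]_w Z k w + c ^+ 2 =
      (\int[P]_w Z l w - c) * (\int[P]_w Z k w - c) by ring.
    by rewrite (le_trans (ler_norm _))// normrM ler_pM.
  have zz : \int[P]_w (Z l w * Z l w) <= M ^+ 2.
    rewrite -[leRHS]cE; apply: le_Rintegral => // w _.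
    by rewrite (le_trans (ler_norm _))// normrM expr2 ler_pM.
  rewrite mul1r.
  have h : (\int[P]_w Z l w - c) ^+ 2 <= be ^+ 2 by rewrite -real_normK ?num_real// lerXn2r ?nnegrE.
  move: (\int[P]_w Z l w) zz h => u; move: (\int[P]_w _) => v zz h.
  have u2 := sqr_ge0 u.
  have e : (u - c) ^+ 2 = u ^+ 2 - 2 * c * u + c ^+ 2 by ring.
  by lra.
have E w : (n%:R^-1 * \sum_(l < n) Z l w - c) ^+ 2 = n%:R ^- 2 * \sum_(l < n) \sum_(k < n) (Y l w * Y k w).
  have -> : n%:R^-1 * \sum_(l < n) Z l w - c = n%:R^-1 * \sum_(l < n) Y l w.
    rewrite /Y sumrB sumr_const card_ord mulrBr; congr (_ - _).
    by rewrite -[c *+ n]mulr_natl mulrA mulVf// mul1r.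
  rewrite exprMn exprVn; congr (_ * _); rewrite expr2 mulr_suml; apply: eq_bigr => l _.
  by rewrite mulr_sumr.
have S1 l := Rintegral_sumR (mu := P) (index_enum 'I_n) measurableT (iY l).
have S2 := Rintegral_sumR (mu := P) (index_enum 'I_n) measurableT (fun l => (S1 l).1).
have -> : \int[P]_w ((n%:R^-1 * \sum_(l < n) Z l w - c) ^+ 2) =
   n%:R ^- 2 * \sum_(l < n) \sum_(k < n) \int[P]_w (Y l w * Y k w).
  transitivity (\int[P]_w (n%:R ^- 2 * \sum_(l < n) \sum_(k < n) (Y l w * Y k w))).
    by apply: eq_Rintegral => w _; rewrite E.
  rewrite RintegralZl//; last exact: S2.1.
  by congr (_ * _); rewrite S2.2; apply: eq_bigr => l _; rewrite (S1 l).2.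
rewrite ler_pdivrMl ?exprn_gt0//.
apply: (@le_trans _ _ (\sum_(l < n) \sum_(k < n) (be ^+ 2 + (l == k)%:R * M ^+ 2))).
  by apply: ler_sum => l _; apply: ler_sum => k _.
have -> : \sum_(l < n) \sum_(k < n) (be ^+ 2 + (l == k)%:R * M ^+ 2) = n%:R * (n%:R * be ^+ 2 + M ^+ 2).
  rewrite (eq_bigr (fun _ => n%:R * be ^+ 2 + M ^+ 2)) ?sumr_const ?card_ord ?mulr_natl// => l _.
  rewrite big_split/= sumr_const card_ord; congr (_ + _).
  rewrite (bigD1 l)//= eqxx mul1r big1 ?addr0// => k kl.
  by rewrite eq_sym (negbTE kl) mul0r.
by rewrite le_eqVlt; apply/orP; left; apply/eqP; field.
Qed.

End MeanSquaredError.

(** * Independence within the sample *)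

Section SampleIndependence.
Context {R : realType} (T : (R -> R[i]) -> (R -> R[i])) (n : nat)
  d (Omega : measurableType d) (P : probability Omega R)
  (X Phi xi : 'I_n -> {RV P >-> R}).
Hypothesis hs : homodyne_sample T X Phi xi.

Definition Uv (l : 'I_n) (w : Omega) : R * R := (X l w, Phi l w).
Definition Vv (l : 'I_n) (w : Omega) : (R * R) * R := (Uv l w, xi l w).

Lemma measurable_Uv l : measurable_fun setT (Uv l).
Proof. by apply: measurable_fun_pair. Qed.

Lemma measurable_Vv l : measurable_fun setT (Vv l).
Proof. by apply: measurable_fun_pair => //; exact: measurable_Uv. Qed.

Lemma indep_signal_noise l A D : measurable A -> measurable D ->
  (P (Uv l @^-1` A `&` xi l @^-1` D) = P (Uv l @^-1` A) * P (xi l @^-1` D))%E.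
Proof.
move=> mA mD.
pose A' i := if i == l then A else setT; pose D' i := if i == l then D else setT.
have mA' i : measurable (A' i) by rewrite /A'; case: ifP.
have mD' i : measurable (D' i) by rewrite /D'; case: ifP.
have := hs_indep hs mA' mD'.
rewrite (bigD1 l)//= big1 ?mule1; last first.
  by move=> i il; rewrite /A' /D' (negbTE il) preimage_setT !probability_setT mule1.
rewrite /A' /D' eqxx => <-; congr (P _); apply/seteqP; split => w /=.
  by move=> [h1 h2] i; case: eqP => [->|].
by move=> /(_ l); rewrite eqxx.
Qed.

Lemma indep_two_samples l k A D A2 D2 : l != k -> measurable A -> measurable D -> measurable A2 -> measurable D2 ->
  (P (Vv l @^-1` (A `*` D) `&` Vv k @^-1` (A2 `*` D2)) =
   P (Vv l @^-1` (A `*` D)) * P (Vv k @^-1` (A2 `*` D2)))%E.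
Proof.
move=> lk mA mD mA2 mD2.
have -> : P (Vv l @^-1` (A `*` D)) = (P (Uv l @^-1` A) * P (xi l @^-1` D))%E by rewrite -indep_signal_noise.
have -> : P (Vv k @^-1` (A2 `*` D2)) = (P (Uv k @^-1` A2) * P (xi k @^-1` D2))%E by rewrite -indep_signal_noise.
pose A' i := if i == l then A else if i == k then A2 else setT.
pose D' i := if i == l then D else if i == k then D2 else setT.
have mA' i : measurable (A' i) by rewrite /A'; case: ifP => //; case: ifP.
have mD' i : measurable (D' i) by rewrite /D'; case: ifP => //; case: ifP.
have := hs_indep hs mA' mD'; have kl : k != l by rewrite eq_sym.
rewrite (bigD1 l)//= (bigD1 k)//= big1 ?mule1; last first.
  by move=> i /andP[il ik]; rewrite /A' /D' (negbTE il) (negbTE ik) preimage_setT !probability_setT mule1.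
rewrite /A' /D' eqxx (negbTE kl) eqxx => <-; congr (P _); apply/seteqP; split => w /=.
  by move=> [[h1 h2] [h3 h4]] i; case: eqP => [->|_]; [|case: eqP => [->|]].
by move=> h; have := h l; have := h k; rewrite eqxx (negbTE kl) eqxx.
Qed.

Lemma Rintegral_indep2 l k (f : (R * R) * R -> R) (c : R) : l != k ->
  measurable_fun setT f -> (forall v, `|f v| <= c) ->
  \int[P]_w (f (Vv l w) * f (Vv k w)) = \int[P]_w f (Vv l w) * \int[P]_w f (Vv k w).
Proof.
move=> lk mf fc; apply: (Rintegral_indep (P := P) (U := Vv l) (V := Vv k) _ _ _ mf mf fc fc).
- exact: measurable_Vv.
- exact: measurable_Vv.
- by apply: indep_pairs; [exact: measurable_Vv|exact: measurable_Vv|move=> *; exact: indep_two_samples].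
Qed.

Lemma Rintegral_indep1 l (f : R * R -> R) (g : R -> R) (c c' : R) :
  measurable_fun setT f -> measurable_fun setT g ->
  (forall v, `|f v| <= c) -> (forall v, `|g v| <= c') ->
  \int[P]_w (f (Uv l w) * g (xi l w)) = \int[P]_w f (Uv l w) * \int[P]_w g (xi l w).
Proof.
move=> mf mg fc gc; apply: (Rintegral_indep (P := P) (U := Uv l) (V := xi l) _ _ _ mf mg fc gc) => //.
- exact: measurable_Uv.
- by move=> A D mA mD; exact: indep_signal_noise.
Qed.

End SampleIndependence.

(** * Bias and mean squared error of the estimator *)

Section Model.
Context {R : realType}.
Local Notation leb := (@lebesgue_measure R).
Local Notation leb2 := (@lebesgue_measure R \x @lebesgue_measure R)%E.
Local Notation C := R[i].
Local Notation measR := (@measurable _ (measurableTypeR R)).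
Local Notation pos := (`[0, +oo[%classic : set R).

Lemma measurable_cosT d (T : measurableType d) (f : T -> R) :
  measurable_fun setT f -> measurable_fun setT (fun z => cos (f z)).
Proof.
by move=> mf; apply: measurableT_comp => //; apply: continuous_measurable_fun; exact: continuous_cos.
Qed.

Lemma measurable_sinT d (T : measurableType d) (f : T -> R) :
  measurable_fun setT f -> measurable_fun setT (fun z => sin (f z)).
Proof.
by move=> mf; apply: measurableT_comp => //; apply: continuous_measurable_fun; exact: continuous_sin.
Qed.

Lemma measurable_pjT d (T : measurableType d) (q p : R) (f : T -> R) :
  measurable_fun setT f -> measurable_fun setT (fun z => pj q p (f z)).
Proof.
move=> mf; apply: measurable_funD; apply: measurable_funM => //.
  exact: measurable_cosT.
exact: measurable_sinT.
Qed.

Variables (rho : nat -> nat -> C) (B r b D : R).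
Hypotheses (b0 : 0 < b) (r0 : 0 < r) (D0 : 0 <= D).
Hypothesis Hrho : forall m n, cmod (rho m n) <= expR (- (B * (m + n)%:R `^ (r / 2))).
Hypothesis HD : forall m n (s : R), 0 <= s ->
  expR (- (B * (m + n)%:R `^ (r / 2))) * (nrm m n * cmod (cmn m n s)) <=
  D * (wgt m * wgt n) * expR (- (b * (s / 2) `^ r)).
Variable L : R.
Hypotheses (L0 : 0 <= L) (HL : forall q p : R, ez r b q p <= L * (lor q * lor p)).

Variables (T : (R -> C) -> (R -> C)).
Hypothesis rhoT : rho = density_matrix T.
Context (n : nat) d (Omega : measurableType d) (P : probability Omega R)
  (X Phi xi : 'I_n -> {RV P >-> R}).
Hypothesis hs : homodyne_sample T X Phi xi.

Let S : set (R * R) := setT `*` `[0, pi]%classic.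

Let mI : measR `[0, pi]. Proof. by []. Qed.
Let mS : @measurable _ (measurableTypeR R * measurableTypeR R)%type S. Proof. exact: measurableX. Qed.

Let i1 : leb.-integrable `[0, pi] (EFin \o (fun _ : R => 1 : R)).
Proof. by apply: continuous_integrable_seg => x; exact: cvg_cst. Qed.

Let mPlim : measurable_fun setT (fun z : R * R => Plim rho z.1 z.2).
Proof. exact: (measurable_Plim D0 Hrho HD HL). Qed.

Let iPlim : leb2.-integrable S (EFin \o (fun z => Plim rho z.1 z.2)).
Proof.
apply: (integrable_prod_dom (m1 := leb) (m2 := leb) measurableT mI (a := fun x => K2 D L * lor x) (b := fun=> 1) mPlim (integrable_lorZ _) i1).
by move=> x y _ _; rewrite mulr1; exact: (Plim_bound D0 Hrho HD HL).
Qed.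

Let ibd (f g : R * R -> R) (c : R) : measurable_fun setT f -> (forall z, `|f z| <= c) ->
  leb2.-integrable S (EFin \o g) -> leb2.-integrable S (EFin \o (fun z => f z * g z)).
Proof.
move=> mf fc ig.
have mg : measurable_fun S g by have /integrableP[/measurable_EFinP] := ig.
apply: (@integrable_dom _ _ _ leb2 S _ (fun x => c * `|g x|)) => //.
- by apply: measurable_funM => //; exact: measurable_funS mf.
- by apply: integrableR_scale => //; have := integrable_abse ig.
- by move=> x _; rewrite normrM ler_wpM2r.
Qed.

(** [hs_law] gives the probabilities of events as integrals of the Radon transform over the strip S;
    [eq_Rintegral_law] extends this to bounded functions. *)
Lemma expectation_law l (f : R * R -> R) (c : R) : measurable_fun setT f -> (forall z, `|f z| <= c) ->
  \int[P]_w f (Uv X Phi l w) = pi^-1 * \int[leb2]_(z in S) (f z * Plim rho z.1 z.2).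
Proof.
move=> mf fc.
have ip2 : leb2.-integrable setT (EFin \o ((fun z : R * R => pi^-1 * Plim rho z.1 z.2) \_ S)).
  have := integrableR_scale (mu := leb2) pi^-1 mS iPlim => /(integrable_mkcond _ mS).
  by apply: eq_integrable => // z _; rewrite /= restrict_EFin.
have i1' : P.-integrable setT (EFin \o (fun _ : Omega => 1 : R)) by exact: finite_measure_integrable_cst.
have := @eq_Rintegral_law R _ _ _ _ _ _ P leb2 (Uv X Phi l) idfun (fun=> 1) _ (measurable_Uv X Phi l) (@measurable_id _ _ _) i1' ip2 _ f c mf fc.
have -> : \int[P]_w (f (Uv X Phi l w) * 1) = \int[P]_w f (Uv X Phi l w).
  by apply: eq_Rintegral => w _; rewrite mulr1.
move=> ->.
  rewrite -RintegralZl//; last exact: (ibd mf fc iPlim).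
  rewrite [RHS]Rintegral_mkcond; apply: eq_Rintegral => z _ /=.
  by rewrite !patchE; case: ifP => _; rewrite ?mulr0//; ring.
move=> A mA; rewrite Rintegral_cst ?mul1r; last by rewrite -[X in _ X]setTI; exact: measurable_Uv.
rewrite -Rintegral_mkcondr.
apply: (etrans (congr1 fine (hs_law hs l mA))).
rewrite rhoT /Rintegral; congr (fine (integral _ _ _)); congr (_ `&` _).
by apply/seteqP; split => z; rewrite /S /= in_itv/=; [move=> h; split|case].
Qed.

Lemma PN_cos_int q p N t : \int[leb2]_(z in S) (cos (t * (pj q p z.2 - z.1)) * PN rho N z.1 z.2) =
  2^-1 * TN rho q p N t.
Proof.
rewrite -PN_TN.
pose f (x phi : R) : R := cos (t * (pj q p phi - x)) * PN rho N x phi.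
have mf : measurable_fun setT (fun z : R * R => f z.1 z.2).
  apply: measurable_funM; last exact: measurable_PN.
  apply: measurable_cosT; apply: measurable_funM => //; apply: measurable_funB => //.
  exact: measurable_pjT.
have fab x y : [set: R] x -> `[0, pi]%classic y -> `|f x y| <= K2 D L * lor x * 1.
  move=> _ _; rewrite normrM mulr1 -[X in _ <= X]mul1r ler_pM// ?cos_max//.
  exact: (PN_bound D0 Hrho HD HL).
have h1 := FubiniR_prod (m1 := leb) (m2 := leb) measurableT mI mf (integrable_lorZ (K2 D L)) i1 fab.
have h2 := FubiniR (m1 := leb) (m2 := leb) measurableT mI mf (integrable_lorZ (K2 D L)) i1 fab.
by rewrite -[RHS]h2 -[RHS]h1.
Qed.

(** The cosine transform of the noiseless observation; by [chA_cvg] it is the limit of [TN] divided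
    by 2 pi. *)
Definition chA l q p (t : R) : R := \int[P]_w cos (t * (pj q p (Phi l w) - X l w)).

Lemma chA_cvg l q p t : (2 * pi)^-1 * TN rho q p N t @[N --> \oo] --> chA l q p t.
Proof.
have mc : measurable_fun setT (fun z : R * R => cos (t * (pj q p z.2 - z.1))).
  apply: measurable_cosT; apply: measurable_funM => //; apply: measurable_funB => //.
  exact: measurable_pjT.
have -> : chA l q p t = pi^-1 * \int[leb2]_(z in S) (cos (t * (pj q p z.2 - z.1)) * Plim rho z.1 z.2).
  by rewrite -(expectation_law l (f := fun z => cos (t * (pj q p z.2 - z.1))) (c := 1) mc)// => z; exact: cos_max.
have -> : (fun N => (2 * pi)^-1 * TN rho q p N t) = (fun N => pi^-1 *
   \int[leb2]_(z in S) (cos (t * (pj q p z.2 - z.1)) * PN rho N z.1 z.2)).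
  by apply/funext => N; rewrite PN_cos_int mulrA; congr (_ * _); rewrite invfM mulrC.
apply: cvgM; first exact: cvg_cst.
apply: (@dominated_cvgR _ _ _ leb2 S _ _ (fun z => K2 D L * lor z.1)) => //.
- move=> N; apply: measurable_funS (_ : measurable_fun setT _) => //.
  by apply: measurable_funM => //; exact: measurable_PN.
- move=> z _; apply: cvgM; first exact: cvg_cst.
  exact: (PN_cvg D0 Hrho HD HL).
- apply: (integrable_prod_dom (m1 := leb) (m2 := leb) measurableT mI (f := fun x _ => K2 D L * lor x) (a := fun x => K2 D L * lor x) (b := fun=> 1) _ (integrable_lorZ _) i1).
    apply: measurable_funM => //.
    by apply: (measurableT_comp (f := @lor R)) => //; apply: continuous_measurable_fun; exact: continuous_lor.
  by move=> x y _ _; rewrite mulr1 ger0_norm// mulr_ge0 ?K2_ge0 ?lor_ge0.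
- move=> N z _; rewrite normrM -[X in _ <= X]mul1r ler_pM// ?cos_max//.
  exact: (PN_bound D0 Hrho HD HL).
Qed.

Variable eta : R.
Hypothesis heta : 0 < eta < 1.
Local Notation gam := ((1 - eta) / (4 * eta)).
Definition sg : R := Num.sqrt ((1 - eta) / 2) / Num.sqrt eta.

Let gam0 : 0 < gam.
Proof. by case/andP: heta => e0 e1; rewrite divr_gt0 ?subr_gt0// mulr_gt0. Qed.

Lemma sg2 : sg ^+ 2 = 2 * gam.
Proof.
case/andP: heta => e0 e1; rewrite /sg expr_div_n !sqr_sqrtr ?ltW//; last by rewrite divr_gt0// subr_gt0.
by field; exact: lt0r_neq0.
Qed.

Lemma noisy_sg x z : noisy_obs eta x z / Num.sqrt eta = x + sg * z.
Proof.
case/andP: heta => e0 e1; have s0 : Num.sqrt eta != 0 by rewrite sqrtr_eq0 -ltNge.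
by rewrite /noisy_obs /sg; move: (Num.sqrt _) (Num.sqrt _) s0 => s u s0; field.
Qed.

Definition yz q p (v : (R * R) * R) : R := pj q p v.1.2 - v.1.1 - sg * v.2.

Lemma measurable_yz q p : measurable_fun setT (yz q p).
Proof.
apply: measurable_funB; last exact: measurable_funM.
apply: measurable_funB; last exact: measurableT_comp.
by apply: measurable_pjT; exact: measurableT_comp.
Qed.

(** Expand the cosine of the difference. Independence splits each product; the sine of the noise has
    mean 0 and its cosine has mean e^(- gamma t^2), the noise having variance 2 gamma. *)
Lemma E_cos_noise l q p t : \int[P]_w cos (yz q p (Vv X Phi xi l w) * t) = expR (- (gam * t ^+ 2)) * chA l q p t.
Proof.
have mA : measurable_fun setT (fun z : R * R => t * (pj q p z.2 - z.1)).
  by apply: measurable_funM => //; apply: measurable_funB => //; exact: measurable_pjT.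
have mB : measurable_fun setT (fun z : R => t * sg * z) by exact: measurable_funM.
have hc := Rintegral_indep1 hs l (measurable_cosT mA) (measurable_cosT mB) (fun v => cos_max _) (fun v => cos_max _).
have hsn := Rintegral_indep1 hs l (measurable_sinT mA) (measurable_sinT mB) (fun v => sin_max _) (fun v => sin_max _).
have mxi : measurable_fun setT (xi l) by [].
rewrite (gauss_cos mxi (hs_gauss hs l)) in hc.
rewrite (gauss_sin mxi (hs_gauss hs l)) mulr0 in hsn.
transitivity (\int[P]_w (cos (t * (pj q p (Uv X Phi l w).2 - (Uv X Phi l w).1)) * cos (t * sg * xi l w) +
   sin (t * (pj q p (Uv X Phi l w).2 - (Uv X Phi l w).1)) * sin (t * sg * xi l w))).
  apply: eq_Rintegral => w _; rewrite /yz /= -cosB; congr cos; ring.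
have mU := measurable_Uv X Phi l.
rewrite RintegralD//; last 2 first.
- apply: (bounded_integrable P (c := 1)); first by apply: measurable_funM; [exact: (measurableT_comp (measurable_cosT mA) mU)|exact: (measurableT_comp (measurable_cosT mB))].
  by move=> w; rewrite normrM mulr_ile1// cos_max.
- apply: (bounded_integrable P (c := 1)); first by apply: measurable_funM; [exact: (measurableT_comp (measurable_sinT mA) mU)|exact: (measurableT_comp (measurable_sinT mB))].
  by move=> w; rewrite normrM mulr_ile1// sin_max.
rewrite hc hsn addr0 mulrC; congr (expR (- _) * _).
by rewrite exprMn sg2; field; case/andP: heta => e0 _; exact: lt0r_neq0.
Qed.

Lemma E_kern l q p a : 0 < a -> \int[P]_w kern gam a (yz q p (Vv X Phi xi l w)) =
  (2 * pi)^-1 * \int[leb]_(t in `[0, a]) (t * chA l q p t).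
Proof.
move=> a0; have mY := measurableT_comp (measurable_yz q p) (measurable_Vv X Phi xi l).
have ma : measR `[0, a] by [].
have mf : measurable_fun setT (fun z : Omega * R => cos (yz q p (Vv X Phi xi l z.1) * z.2) * kw gam z.2).
  apply: measurable_funM.
    by apply: measurable_cosT; apply: measurable_funM => //; exact: (measurableT_comp mY).
  by apply: (measurableT_comp (f := kw gam)) => //; apply: continuous_measurable_fun; exact: continuous_kw.
have kw0 (t : R) : 0 <= kw gam t by rewrite mulr_ge0 ?expR_ge0.
have ib : leb.-integrable `[0, a] (EFin \o kw gam) by apply: continuous_integrable_seg; exact: continuous_kw.
have ia : P.-integrable setT (EFin \o (fun _ : Omega => 1 : R)) by exact: finite_measure_integrable_cst.
have fab w t : [set: Omega] w -> `[0, a]%classic t -> `|cos (yz q p (Vv X Phi xi l w) * t) * kw gam t| <= 1 * kw gam t.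
  by move=> _ _; rewrite normrM (ger0_norm (kw0 t)) ler_wpM2r// cos_max.
have h := FubiniR (m1 := P) (m2 := leb) measurableT ma mf ia ib fab.
rewrite /kern RintegralZl//; last first.
  exact: (integrable_inner1 (m1 := P) (m2 := leb) measurableT ma mf ia ib fab).
congr (_ * _); apply: (etrans h); apply: eq_Rintegral => t; rewrite inE/= in_itv/= => /andP[t0 _].
rewrite RintegralZr//; last first.
  apply: (bounded_integrable P (c := 1)); last by move=> w; exact: cos_max.
  by apply: measurable_cosT; apply: measurable_funM.
rewrite E_cos_noise /kw ger0_norm// expRN.
have := lt0r_neq0 (expR_gt0 (gam * t ^+ 2)); move: (expR _) => e e0; rewrite mulrC mulrA; congr (_ * _).
by rewrite -mulrA mulfV// mulr1.
Qed.

Lemma E_kern_cvg l q p a : 0 < a ->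
  (4 * pi ^+ 2)^-1 * \int[leb]_(t in `[0, a]) (t * TN rho q p N t) @[N --> \oo] -->
  \int[P]_w kern gam a (yz q p (Vv X Phi xi l w)).
Proof.
move=> a0; have ma : measR `[0, a] by [].
rewrite E_kern//.
have mt N : measurable_fun setT (fun t : R => t * TN rho q p N t).
  by apply: measurable_funM => //; exact: measurable_TN.
have bd N t : 0 <= t <= a -> `|t * TN rho q p N t| <= a * (16 * pi * D).
  move=> /andP[t0 ta]; rewrite normrM ger0_norm//; apply: ler_pM => //.
  rewrite (le_trans (TN_bound D0 Hrho HD q p N t0))// ler_piMr ?mulr_ge0 ?pi_ge0//.
  by rewrite -expR0 ler_expR oppr_le0 mulr_ge0 ?powR_ge0// ltW.
have ic (c : R) : leb.-integrable `[0, a] (EFin \o (fun _ : R => c)).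
  by apply: continuous_integrable_seg => x; exact: cvg_cst.
have -> : (fun N => (4 * pi ^+ 2)^-1 * \int[leb]_(t in `[0, a]) (t * TN rho q p N t)) =
  (fun N => (2 * pi)^-1 * \int[leb]_(t in `[0, a]) (t * ((2 * pi)^-1 * TN rho q p N t))).
  apply/funext => N.
  have -> : \int[leb]_(t in `[0, a]) (t * ((2 * pi)^-1 * TN rho q p N t)) = (2 * pi)^-1 * \int[leb]_(t in `[0, a]) (t * TN rho q p N t).
    rewrite -RintegralZl//; first by apply: eq_Rintegral => t _; ring.
    apply: (integrable_dom (g := fun=> a * (16 * pi * D))) => //; first exact: measurable_funS (mt N).
    by move=> t /=; rewrite in_itv/=; exact: bd.
  by rewrite mulrA -invfM; congr (_^-1 * _); ring.
apply: cvgM; first exact: cvg_cst.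
apply: (@dominated_cvgR _ _ _ leb `[0, a]%classic _ _ (fun _ => (2 * pi)^-1 * (a * (16 * pi * D)))) => //.
- move=> N; apply: measurable_funS (_ : measurable_fun setT _) => //.
  by apply: measurable_funM => //; apply: measurable_funM => //; exact: measurable_TN.
- by move=> t _; apply: cvgM; [exact: cvg_cst|exact: chA_cvg].
- move=> N t /=; rewrite in_itv/= => h; have h' := bd N t h.
  have -> : t * ((2 * pi)^-1 * TN rho q p N t) = (2 * pi)^-1 * (t * TN rho q p N t) by ring.
  have g0 : 0 <= (2 * pi)^-1 :> R by rewrite invr_ge0 mulr_ge0// pi_ge0.
  by rewrite normrM (ger0_norm g0) ler_wpM2l.
Qed.

Variables (b' c' Kt : R).
Hypotheses (bE : b = b' + c') (b'0 : 0 < b') (c'0 : 0 < c').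
Hypothesis HKt : forall t : R, 0 <= t -> t * expR (- (c' * (t / 2) `^ r)) <= Kt * lor t.

Definition biasC : R := 4 * D / pi * (Kt * \int[leb]_t lor t).

Let Kt0 : 0 <= Kt.
Proof.
have := HKt (lexx 0); rewrite mul0r /lor expr0n addr0 invr1 mulr1; exact.
Qed.

(** For each N the difference is minus the integral over t > a, by [WN_TN]. There t / 2 > a / 2
    turns the b' part of the decay into the constant e, and the c' part keeps the integrand below a
    Lorentzian. *)
Lemma bias_bound l q p a : 0 < a ->
  `|\int[P]_w kern gam a (yz q p (Vv X Phi xi l w)) - Wlim rho q p| <= biasC * expR (- (b' * (a / 2) `^ r)).
Proof.
move=> a0; set I := \int[P]_w _.
pose dN N := (4 * pi ^+ 2)^-1 * \int[leb]_(t in `[0, a]) (t * TN rho q p N t) - WN rho N q p.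
have dc : dN N @[N --> \oo] --> I - Wlim rho q p.
  by apply: cvgB; [exact: E_kern_cvg|exact: (WN_cvg D0 Hrho HD)].
have cn : `|dN N| @[N --> \oo] --> `|I - Wlim rho q p| by exact: cvg_norm.
rewrite -(cvg_lim _ cn)//; apply: limr_le; first by apply/cvg_ex; eexists; exact: cn.
apply: nearW => N.
have [iT WE] := WN_TN rho q p N.
have pp := @pi_gt0 R.
have p2 : 0 < (4 * pi ^+ 2)^-1 :> R by rewrite invr_gt0 mulr_gt0// exprn_gt0.
have tE : \int[leb]_(t in pos) (t * TN rho q p N t) - \int[leb]_(t in `[0, a]) (t * TN rho q p N t) =
   \int[leb]_(t in `]a, +oo[) (t * TN rho q p N t) by apply: Rintegral_itvB => //; rewrite bnd_simp ltW.
have -> : dN N = - ((4 * pi ^+ 2)^-1 * \int[leb]_(t in `]a, +oo[) (t * TN rho q p N t)).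
  by rewrite /dN WE -tE; ring.
rewrite normrN normrM (gtr0_norm p2).
have ma : measR `]a, +oo[ by [].
have sub : (`]a, +oo[%classic : set R) `<=` pos.
  by move=> t /=; rewrite !in_itv/= !andbT => h; rewrite ltW// (lt_trans a0).
have mp : measR pos by [].
have iTa := integrableS mp ma sub iT.
set e := expR _; have e0 : 0 <= e by exact: expR_ge0.
have il := integrable_lorZ (16 * pi * D * e * Kt).
have h1 : `|\int[leb]_(t in `]a, +oo[) (t * TN rho q p N t)| <= \int[leb]_(t in `]a, +oo[) (16 * pi * D * e * Kt * lor t).
  rewrite (le_trans (le_normr_Rintegral ma iTa))//; apply: le_Rintegral => //.
  - exact: integrable_abse iTa.
  - exact: integrableS il.
  move=> t /=; rewrite in_itv/= andbT => ta; have t0 : 0 <= t by rewrite ltW// (lt_trans a0).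
  rewrite normrM ger0_norm//.
  have hT := TN_bound D0 Hrho HD q p N t0.
  have he : expR (- (b * (t / 2) `^ r)) <= e * expR (- (c' * (t / 2) `^ r)).
    rewrite -expRD ler_expR -opprD lerN2 bE mulrDl lerD2r ler_wpM2l ?(ltW b'0)//.
    apply: ge0_ler_powR; rewrite ?nnegrE ?divr_ge0// ?(ltW r0) ?(ltW a0)//.
    by rewrite ler_pM2r ?invr_gt0// ltW.
  apply: (le_trans (ler_wpM2l t0 hT)).
  have k0 : 0 <= 16 * pi * D * e by rewrite !mulr_ge0// ltW.
  apply: (@le_trans _ _ (16 * pi * D * e * (t * expR (- (c' * (t / 2) `^ r))))); last first.
    by rewrite -[X in _ <= X]mulrA ler_wpM2l// HKt.
  rewrite (_ : t * (16 * pi * D * _) = 16 * pi * D * t * expR (- (b * (t / 2) `^ r))); last by ring.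
  rewrite (_ : 16 * pi * D * e * _ = 16 * pi * D * t * (e * expR (- (c' * (t / 2) `^ r)))); last by ring.
  have k1 : 0 <= 16 * pi * D * t by apply: mulr_ge0 => //; apply: mulr_ge0 => //; apply: mulr_ge0 => //; exact: ltW.
  exact: (ler_wpM2l k1 he).
have h2 : \int[leb]_(t in `]a, +oo[) (16 * pi * D * e * Kt * lor t) <= 16 * pi * D * e * Kt * \int[leb]_t lor t.
  rewrite -RintegralZl//; last exact: integrable_lor.
  rewrite /Rintegral fine_le//.
  - exact: (integrable_fin_num ma (integrableS measurableT ma (@subsetT _ _) il)).
  - exact: (integrable_fin_num measurableT il).
  apply: ge0_subset_integral => //.
  - by have /integrableP[] := il.
  - by move=> t _; rewrite lee_fin !mulr_ge0 ?lor_ge0// ltW.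
have h := le_trans h1 h2.
apply: (@le_trans _ _ ((4 * pi ^+ 2)^-1 * (16 * pi * D * e * Kt * \int[leb]_t lor t))).
  by rewrite ler_wpM2l// ltW.
rewrite /biasC le_eqVlt; apply/orP; left; apply/eqP; have pn := lt0r_neq0 pp.
by move: (\int[leb]_t _) (pi) pn => u v v0; field.
Qed.

Variable L' : R.
Hypotheses (HL' : forall q p : R, ez r c' q p <= L' * (lor q * lor p)).

Definition truncF (a : R) (w : Omega) (z : R * R) : R :=
  (if Num.sqrt (z.1 ^+ 2 + z.2 ^+ 2) <= a
   then n%:R^-1 * \sum_(l < n) kern gam a (yz z.1 z.2 (Vv X Phi xi l w)) else 0) - Wlim rho z.1 z.2.

Lemma trunc_estimatorE h w z : 0 < h ->
  trunc_estimator eta h h^-1 (fun l => noisy_obs eta (X l w) (xi l w)) (fun l => Phi l w) z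
    - wigner T z.1 z.2 = truncF h^-1 w z.
Proof.
move=> h0; rewrite /truncF rhoT; congr (_ - _); rewrite /trunc_estimator; case: ifP => // _.
rewrite /estimator; congr (_ * _); apply: eq_bigr => l _; rewrite kernelK_kern//; congr kern.
by rewrite noisy_sg /yz /pj /=; ring.
Qed.

Lemma measurable_truncF a : 0 < a -> measurable_fun setT (fun x : Omega * (R * R) => truncF a x.1 x.2).
Proof.
move=> a0; apply: measurable_funB; last first.
  by apply: (measurableT_comp (f := fun z : R * R => Wlim rho z.1 z.2)) => //; exact: (measurable_Wlim D0 Hrho HD).
have m21 : measurable_fun setT (fun x : Omega * (R * R) => x.2.1) by exact: measurableT_comp.
have m22 : measurable_fun setT (fun x : Omega * (R * R) => x.2.2) by exact: measurableT_comp.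
have mP l : measurable_fun setT (fun x : Omega * (R * R) => Phi l x.1) by exact: measurableT_comp.
apply: measurable_fun_ifT => //.
- apply: measurable_fun_ler => //.
  apply: measurableT_comp; last by apply: measurable_funD; exact: measurable_funX.
  by apply: continuous_measurable_fun; exact: sqrt_continuous.
- apply: measurable_funM => //; apply: measurable_sum => l.
  apply: (measurableT_comp (measurable_kern gam a)).
  rewrite /yz /=.
  apply: measurable_funB; last by apply: measurable_funM => //; exact: measurableT_comp.
  apply: measurable_funB; last exact: measurableT_comp.
  apply: measurable_funD; apply: measurable_funM => //.
    exact: measurable_cosT.
  exact: measurable_sinT.
Qed.

Definition riskb (a : R) : R := kernM gam a ^+ 2 / n%:R + (biasC * expR (- (b' * (a / 2) `^ r))) ^+ 2.

Lemma truncF_risk a z : (0 < n)%N -> 0 < a ->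
  \int[P]_w (truncF a w z ^+ 2) <=
  riskb a * \1_(`[- a, a]%classic `*` `[- a, a]%classic) z +
  (4 * (pi^-1 * D)) ^+ 2 * expR (- (b' * (a / 2) `^ r)) ^+ 2 * L' * (lor z.1 * lor z.2).
Proof.
move=> n0 a0; case: z => q p; rewrite /truncF /=.
have r20 : 0 <= (4 * (pi^-1 * D)) ^+ 2 * expR (- (b' * (a / 2) `^ r)) ^+ 2 * L' * (lor q * lor p).
  rewrite -mulrA mulr_ge0//; first by rewrite mulr_ge0 ?sqr_ge0.
  by rewrite (le_trans _ (HL' q p))// expR_ge0.
have r10 : 0 <= riskb a by rewrite addr_ge0 ?sqr_ge0// divr_ge0// sqr_ge0.
have s0 := sqrtr_ge0 (q ^+ 2 + p ^+ 2).
have s2 : Num.sqrt (q ^+ 2 + p ^+ 2) ^+ 2 = q ^+ 2 + p ^+ 2 by rewrite sqr_sqrtr// addr_ge0// sqr_ge0.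
have [sa|sa] := lerP (Num.sqrt (q ^+ 2 + p ^+ 2)) a; last first.
  have -> : \int[P]_w ((0 - Wlim rho q p) ^+ 2) = (Wlim rho q p) ^+ 2.
    by rewrite sub0r sqrrN /Rintegral integral_cst//= probability_setT mule1.
  rewrite -[X in X <= _]add0r lerD//; first by rewrite mulr_ge0.
  have hW := Wlim_bound D0 Hrho HD q p.
  have e1 : ez r b q p <= expR (- (b' * (a / 2) `^ r)) * ez r c' q p.
    rewrite /ez -expRD ler_expR -opprD lerN2 bE mulrDl lerD2r ler_wpM2l ?(ltW b'0)//.
    apply: ge0_ler_powR; rewrite ?nnegrE ?(ltW r0) ?(ltW a0) ?divr_ge0 ?(ltW a0)//.
    by rewrite (le_trans _ (ltW sa))// ler_pdivrMr// ler_peMr ?(ltW a0)// ler1n.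
  have e2 : ez r c' q p <= 1.
    by rewrite /ez -expR0 ler_expR oppr_le0 mulr_ge0 ?powR_ge0 ?(ltW c'0).
  have e0 : 0 <= ez r c' q p by exact: expR_ge0.
  have e3 : ez r c' q p ^+ 2 <= L' * (lor q * lor p).
    by rewrite (le_trans _ (HL' q p))// expr2 ler_piMr.
  have k0 : 0 <= 4 * (pi^-1 * D) by rewrite !mulr_ge0// invr_ge0 pi_ge0.
  have e4 : `|Wlim rho q p| <= 4 * (pi^-1 * D) * (expR (- (b' * (a / 2) `^ r)) * ez r c' q p).
    by rewrite (le_trans hW)// ler_wpM2l.
  rewrite -real_normK ?num_real//.
  apply: (@le_trans _ _ ((4 * (pi^-1 * D) * (expR (- (b' * (a / 2) `^ r)) * ez r c' q p)) ^+ 2)).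
    by rewrite lerXn2r ?nnegrE// (le_trans _ e4).
  clear -e3; move: (4 * (pi^-1 * D)) => A; move: (expR _) => E.
  rewrite !exprMn mulrA -[X in _ <= X]mulrA; apply: ler_wpM2l => //.
  by rewrite mulr_ge0 ?sqr_ge0.
have ia x : `|x| <= Num.sqrt (q ^+ 2 + p ^+ 2) -> `[- a, a]%classic x.
  by move=> h; rewrite /= in_itv/= -ler_norml (le_trans h).
have iq : `[- a, a]%classic q.
  by apply: ia; rewrite -[leLHS]sqrtr_sqr ler_sqrt// ?lerDl ?addr_ge0 ?sqr_ge0// real_normK ?num_real// lerDl sqr_ge0.
have ip : `[- a, a]%classic p.
  by apply: ia; rewrite -[leLHS]sqrtr_sqr ler_sqrt// ?lerDr ?addr_ge0 ?sqr_ge0// real_normK ?num_real// lerDr sqr_ge0.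
rewrite indicE mem_set// mulr1 -[X in X <= _]addr0 lerD// /riskb.
apply: (mse_bound (Z := fun l w => kern gam a (yz q p (Vv X Phi xi l w)))) => //.
- move=> l; apply: (measurableT_comp (measurable_kern gam a)).
  exact: (measurableT_comp (measurable_yz q p) (measurable_Vv X Phi xi l)).
- by move=> l w; exact: kern_bound.
- move=> l k lk; apply: (Rintegral_indep2 hs (f := fun v => kern gam a (yz q p v)) (c := kernM gam a)) => //.
    by apply: (measurableT_comp (measurable_kern gam a)); exact: measurable_yz.
  by move=> v; exact: kern_bound.
- by move=> l; exact: bias_bound.
Qed.

Lemma poweR2 (x : \bar R) : (0 <= x)%E -> (x `^ 2 = x ^+ 2)%E.
Proof.
by case: x => [x| |] x0; rewrite ?poweR_EFin ?powR_mulrn ?poweRyr ?pnatr_eq0.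
Qed.

Let Lam : R := \int[leb]_t lor t.

Lemma integral_majorant (a c1 c2 : R) : 0 < a -> 0 <= c1 -> 0 <= c2 ->
  (\int[leb2]_z (c1 * \1_(`[- a, a]%classic `*` `[- a, a]%classic) z + c2 * (lor z.1 * lor z.2))%:E =
   (c1 * (2 * a) ^+ 2 + c2 * Lam ^+ 2)%:E)%E.
Proof.
move=> a0 c10 c20.
have ma : measR `[- a, a] by [].
have msq : measurable (`[- a, a]%classic `*` `[- a, a]%classic : set (measurableTypeR R * measurableTypeR R)) by exact: measurableX.
have mlor : measurable_fun setT (@lor R) by apply: continuous_measurable_fun; exact: continuous_lor.
have ml : measurable_fun setT (fun z : R * R => lor z.1 * lor z.2).
  by apply: measurable_funM; exact: (measurableT_comp mlor).
have il := @integrable_lor R.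
have lb (x y : R) : [set: R] x -> [set: R] y -> `|lor x * lor y| <= lor x * lor y.
  by move=> _ _; rewrite ger0_norm// mulr_ge0 ?lor_ge0.
have hi := integrable_prod_dom (m1 := leb) (m2 := leb) measurableT measurableT ml il il lb.
have hF := FubiniR_prod (m1 := leb) (m2 := leb) measurableT measurableT ml il il lb.
rewrite setXTT in hi hF.
under eq_integral do rewrite EFinD.
rewrite ge0_integralD//; last 4 first.
- by move=> z _; rewrite lee_fin mulr_ge0.
- by apply/measurable_EFinP; apply: measurable_funM => //; exact: measurable_indic.
- by move=> z _; rewrite lee_fin mulr_ge0// mulr_ge0 ?lor_ge0.
- by apply/measurable_EFinP; apply: measurable_funM => //; exact: ml.
rewrite EFinD; congr (_ + _)%E.
  under eq_integral do rewrite EFinM.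
  rewrite ge0_integralZl//; last by apply/measurable_EFinP; exact: measurable_indic.
  pose I : set (measurableTypeR R * measurableTypeR R) := `[- a, a]%classic `*` `[- a, a]%classic.
  transitivity (c1%:E * leb2 I)%E.
    by congr (_ * _)%E; have := integral_indic leb2 measurableT msq; rewrite setIT.
  by rewrite /I square_measure.
under eq_integral do rewrite EFinM.
rewrite ge0_integralZl//; last 2 first.
- by apply/measurable_EFinP; exact: ml.
- by move=> z _; rewrite lee_fin mulr_ge0 ?lor_ge0.
transitivity (c2%:E * (\int[leb2]_z (lor z.1 * lor z.2))%:E)%E.
  by congr (_ * _)%E; exact: (Rintegral_fin measurableT hi).
rewrite hF -EFinM; congr (EFin (_ * _)).
under eq_Rintegral do rewrite RintegralZl//.
by rewrite RintegralZr// expr2.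
Qed.

(** Tonelli exchanges the expectation with the integral over the plane, so that the pointwise bound
    [truncF_risk] can be integrated. *)
Lemma mise_le h : (0 < n)%N -> 0 < h ->
  (mise T eta h h^-1 X Phi xi <= (riskb h^-1 * (2 * h^-1) ^+ 2 +
    (4 * (pi^-1 * D)) ^+ 2 * expR (- (b' * (h^-1 / 2) `^ r)) ^+ 2 * L' * Lam ^+ 2)%:E)%E.
Proof.
move=> n0 h0; have a0 : 0 < h^-1 by rewrite invr_gt0.
set a := h^-1 in a0 *.
have mF := measurable_truncF a0.
have mF2 : measurable_fun setT (fun x : Omega * (measurableTypeR R * measurableTypeR R) => (truncF a x.1 x.2 ^+ 2)%:E).
  by apply/measurable_EFinP; apply: measurable_funX; exact: mF.
have L'0 : 0 <= L'.
  have := HL' 0 0; rewrite /lor expr0n addr0 invr1 !mulr1 => h1.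
  by rewrite (le_trans _ h1)// expR_ge0.
rewrite /mise.
have E1 w : (Lnorm leb2 2%:E (fun z => (trunc_estimator eta h a
     (fun l => noisy_obs eta (X l w) (xi l w)) (fun l => Phi l w) z - wigner T z.1 z.2)%:E) ^+ 2 =
   \int[leb2]_z (truncF a w z ^+ 2)%:E)%E.
  rewrite -poweR2 ?Lnorm_ge0// poweR_Lnorm//; apply: eq_integral => z _.
  by rewrite trunc_estimatorE//= powR_mulrn// real_normK ?num_real.
under eq_integral do rewrite E1.
have F0 (x : Omega * (measurableTypeR R * measurableTypeR R)) : (0 <= (truncF a x.1 x.2 ^+ 2)%:E)%E.
  by rewrite lee_fin sqr_ge0.
have FT := fubini_tonelli (m1 := P) (m2 := leb2S) _ mF2 F0.
apply: (le_trans (_ : _ <= \int[leb2]_z \int[P]_w (truncF a w z ^+ 2)%:E)%E); first by rewrite -[leRHS]FT.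
rewrite -integral_majorant//; last 2 first.
- by rewrite addr_ge0 ?sqr_ge0// divr_ge0// sqr_ge0.
- by rewrite mulr_ge0// mulr_ge0 ?sqr_ge0.
have iF z : P.-integrable setT (EFin \o (fun w => truncF a w z ^+ 2)).
  have mz : measurable_fun setT (fun w => truncF a w z).
    by apply: (measurableT_comp (f := fun x : Omega * (R * R) => truncF a x.1 x.2) (g := fun w => (w, z)) mF); exact: measurable_fun_pair.
  apply: (bounded_integrable P (c := (kernM gam a + `|Wlim rho z.1 z.2|) ^+ 2)); first exact: measurable_funX.
  move=> w; rewrite normrX lerXn2r ?nnegrE ?addr_ge0 ?kernM_ge0//.
  rewrite /truncF (le_trans (ler_normB _ _))// lerD2r.
  case: ifP => _; last by rewrite normr0 kernM_ge0.
  have nn : 0 < (n%:R : R) by rewrite ltr0n.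
  rewrite normrM ger0_norm ?invr_ge0// ler_pdivrMl// (le_trans (ler_norm_sum _ _ _))//.
  apply: (@le_trans _ _ (\sum_(l < n) kernM gam a)); last by rewrite sumr_const card_ord -[X in X <= _]mulr_natl.
  by apply: ler_sum => l _; exact: kern_bound.
apply: ge0_le_integral => //.
- by move=> z _; apply: integral_ge0 => w _; rewrite lee_fin sqr_ge0.
- apply: (measurable_fun_fubini_tonelli_G (m1 := P) (fun x => (truncF a x.1 x.2 ^+ 2)%:E)) => //.
- apply/measurable_EFinP; apply: measurable_funD; apply: measurable_funM => //.
    by apply: measurable_indic; exact: measurableX.
  have mlor : measurable_fun setT (@lor R) by apply: continuous_measurable_fun; exact: continuous_lor.
  by apply: measurable_funM; exact: (measurableT_comp mlor).
- move=> z _; rewrite /= Rintegral_fin// lee_fin; exact: truncF_risk.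
Qed.

End Model.

(** * Rates *)

Section MaximalRisk.
Context {R : realType}.

Lemma exp_linear_lor (c r : R) : 0 < c -> 0 < r -> exists2 K : R, 0 <= K &
  forall t : R, 0 <= t -> t * expR (- (c * (t / 2) `^ r)) <= K * lor t.
Proof.
move=> c0 r0; have [K1 K10 h1] := pow_powR_exp 1 c0 r0; have [K3 K30 h3] := pow_powR_exp 3 c0 r0.
exists (2 * K1 + 8 * K3); first by rewrite addr_ge0// mulr_ge0.
move=> t t0; have x0 : 0 <= t / 2 by rewrite divr_ge0.
rewrite /lor ler_pdivlMr; last by rewrite ltr_pwDl// sqr_ge0.
have := h1 _ x0; have := h3 _ x0; rewrite expr1; move: (expR _) => e g3 g1.
have -> : t * e * (1 + t ^+ 2) = 2 * (t / 2 * e) + 8 * ((t / 2) ^+ 3 * e) by field.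
by rewrite lerD// ler_pM2l.
Qed.

(** All constants come from the decay of the coefficients and depend on B, r, eta, b and b' alone,
    hence the uniformity over the states. The area of the square gives h^-2, which for h <= 1 also
    absorbs the contribution from outside the disc. *)
Lemma maximal_risk_le (B r eta b b' : R) : 0 < B -> 0 < eta < 1 -> admissible B r b ->
  0 < b' -> b' < b -> exists2 C1 : R, 0 < C1 & forall (h : R) (n : nat), (0 < n)%N -> 0 < h -> h <= 1 ->
  (maximal_risk B r eta h h^-1 n <=
    (C1 * h^-1 ^+ 2 * (expR (2 * ((1 - eta) / (4 * eta)) * h^-1 ^+ 2) / n%:R +
       expR (- (2 * b' * (h^-1 / 2) `^ r))))%:E)%E.
Proof.
move=> B0 heta adm b'0 b'b; have [b0 r0 _] := adm.
set gam := (1 - eta) / (4 * eta).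
have c'0 : 0 < b - b' by rewrite subr_gt0.
have [D D0 HD] := fock_decay B0 adm.
have [L L0 HL] := exp_lor2 b0 r0.
have [L' L'0 HL'] := exp_lor2 c'0 r0.
have [Kt Kt0 HKt] := exp_linear_lor c'0 r0.
have bE : b = b' + (b - b') by rewrite addrC subrK.
set Lam := \int[@lebesgue_measure R]_t lor t.
pose c1 := 4 * (4 * pi * gam)^-1 ^+ 2; pose c2 := 4 * biasC D Kt ^+ 2; pose c3 := (4 * (pi^-1 * D)) ^+ 2 * L' * Lam ^+ 2.
have c10 : 0 <= c1 by rewrite mulr_ge0// sqr_ge0.
have c20 : 0 <= c2 by rewrite mulr_ge0// sqr_ge0.
have c30 : 0 <= c3 by rewrite mulr_ge0 ?sqr_ge0// mulr_ge0 ?sqr_ge0.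
exists (c1 + c2 + c3 + 1); first by rewrite ltr_wpDl// !addr_ge0.
move=> h n n0 h0 h1; apply: ub_ereal_sup => _ [T [[_ HT] [d [Om [P [X [Phi [xi [hs ->]]]]]]]]].
have Hrho m k : cmod (density_matrix T m k) <= expR (- (B * (m + k)%:R `^ (r / 2))).
  by have := HT m k; rewrite cmodE lecR.
have := mise_le b0 r0 D0 Hrho HD L0 HL (erefl _) hs heta bE b'0 c'0 HKt HL' n0 h0.
move=> /le_trans; apply; rewrite lee_fin /riskb /kernM -/gam -/Lam.
have u1 : 1 <= h^-1 ^+ 2 by rewrite exprn_ege1// invf_ge1.
have e1 : expR (gam * h^-1 ^+ 2) ^+ 2 = expR (2 * gam * h^-1 ^+ 2).
  by rewrite -expRM_natl; congr expR; ring.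
have e2 : expR (- (b' * (h^-1 / 2) `^ r)) ^+ 2 = expR (- (2 * b' * (h^-1 / 2) `^ r)).
  by rewrite -expRM_natl; congr expR; ring.
rewrite ![(_ * expR _) ^+ 2]exprMn e1 e2.
have s0 : 0 <= expR (2 * gam * h^-1 ^+ 2) / n%:R by rewrite divr_ge0 ?expR_ge0.
have t0 : 0 <= expR (- (2 * b' * (h^-1 / 2) `^ r)) by exact: expR_ge0.
have -> : ((4 * pi * gam)^-1 ^+ 2 * expR (2 * gam * h^-1 ^+ 2) / n%:R + biasC D Kt ^+ 2 * expR (- (2 * b' * (h^-1 / 2) `^ r))) *
   (2 * h^-1) ^+ 2 = h^-1 ^+ 2 * (c1 * (expR (2 * gam * h^-1 ^+ 2) / n%:R) + c2 * expR (- (2 * b' * (h^-1 / 2) `^ r))).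
  rewrite /c1 /c2; move: (biasC D Kt) ((4 * pi * gam)^-1) (h^-1) (n%:R^-1) (expR _) (expR _) => v1 v2 v3 v4 v5 v6; ring.
have -> : (4 * (pi^-1 * D)) ^+ 2 * expR (- (2 * b' * (h^-1 / 2) `^ r)) * L' * Lam ^+ 2 =
  c3 * expR (- (2 * b' * (h^-1 / 2) `^ r)).
  by rewrite /c3; ring.
set s := expR (2 * gam * h^-1 ^+ 2) / n%:R in s0 *; clearbody s.
move: (expR (- _)) t0 (h^-1 ^+ 2) u1 => t t0 u u1; move: c1 c2 c3 c10 c20 c30 => k1 k2 k3 c10 c20 c30.
have : k3 * t <= u * (k3 * t) by rewrite ler_peMl// mulr_ge0.
have : 0 <= u * (k1 * t) by rewrite !mulr_ge0// (le_trans ler01).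
have : 0 <= u * (k2 * s) by rewrite !mulr_ge0// (le_trans ler01).
have : 0 <= u * (k3 * s) by rewrite !mulr_ge0// (le_trans ler01).
have : 0 <= u * (s + t) by rewrite mulr_ge0 ?addr_ge0// (le_trans ler01).
have -> : (k1 + k2 + k3 + 1) * u * (s + t) = u * (k1 * s + k2 * t) + u * (k3 * t) + u * (k1 * t) + u * (k2 * s) + u * (k3 * s) + u * (s + t) by ring.
lra.
Qed.

Lemma limn_esup_le (u : nat -> \bar R) (C : \bar R) :
  (\forall n \near \oo, (u n <= C)%E) -> (limn_esup u <= C)%E.
Proof.
move=> h; apply: (@le_trans _ _ (ereal_sup (u @` [set n | (u n <= C)%E]))).
  by apply: ereal_inf_lbound; exists [set n | (u n <= C)%E].
by apply: ub_ereal_sup => _ [n /= hn <-].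
Qed.

Lemma ratio_le1 (x : \bar R) (y z : R) : 0 < z -> (x <= y%:E)%E -> y <= z -> (x * (z^-1)%:E <= 1%:E)%E.
Proof.
move=> z0 xy yz; apply: (@le_trans _ _ (z%:E * (z^-1)%:E)%E).
  by apply: lee_wpmul2r; [rewrite lee_fin invr_ge0 ltW|rewrite (le_trans xy)// lee_fin].
by rewrite -EFinM mulfV// gt_eqF.
Qed.

Lemma near_lnln (M : R) : \forall n \near \oo, (0 < n)%N /\ M <= ln (ln (n%:R : R)) /\ 0 < ln (n%:R : R).
Proof.
have [N hN] := exp_ub_nat (expR (expR M)).
exists N.+1 => // n /= Nn; split; first exact: leq_trans Nn.
have e : expR (expR M) <= n%:R by rewrite (le_trans hN)// ler_nat ltnW.
have n0 : 0 < (n%:R : R) by rewrite (lt_le_trans _ e)// expR_gt0.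
have l1 : expR M <= ln (n%:R : R) by rewrite -[leLHS]expRK ler_ln ?posrE ?expR_gt0.
have l0 : 0 < ln (n%:R : R) by rewrite (lt_le_trans _ l1)// expR_gt0.
by split=> //; rewrite -[leLHS]expRK ler_ln ?posrE ?expR_gt0.
Qed.

(** With k = 4 gamma + beta and x = h^-2, the bandwidth makes the variance term n^(- beta / k) (log
    n)^(2 gamma / k), and the bias term is at most that. The factor x is O(log n), so the exponent
    of log n in phi_n^2 is larger by exactly 1/2. *)
Lemma risk_case_r2 (B eta : R) : 0 < B -> 0 < eta < 1 ->
  let gamma := (1 - eta) / (4 * eta) in
  let beta := B / (1 + Num.sqrt B) ^+ 2 in
  let h := fun n : nat =>
      (2 / (4 * gamma + beta) * ln n%:R
       + (4 * gamma + beta)^-1 * ln (ln n%:R)) `^ (- 2^-1) in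
  let phi2 := fun n : nat =>
      (ln n%:R) `^ ((16 * gamma + 3 * beta) / (8 * gamma + 2 * beta))
      * n%:R `^ (- (beta / (4 * gamma + beta))) in
  (limn_esup (fun n : nat =>
       maximal_risk B 2 eta (h n) (h n)^-1 n * ((phi2 n)^-1)%:E) <= 1%:E)%E : Prop.
Proof.
move=> B0 heta gamma beta h phi2.
have /andP[e0 e1] := heta.
have g0 : 0 < gamma by rewrite divr_gt0 ?subr_gt0// mulr_gt0.
have s0 : 0 < Num.sqrt B by rewrite sqrtr_gt0.
have be0 : 0 < beta by rewrite divr_gt0// exprn_gt0// addr_gt0.
have beB : beta < B / (1 + B).
  rewrite /beta ltr_pM2l// ltf_pV2 ?posrE ?exprn_gt0 ?addr_gt0//.
  have -> : (1 + Num.sqrt B) ^+ 2 = 1 + B + 2 * Num.sqrt B.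
    by rewrite -[X in 1 + X + _](sqr_sqrtr (ltW B0)); ring.
  by rewrite ltrDl mulr_gt0.
pose b := (beta + B / (1 + B)) / 2.
have bb : beta < b by rewrite /b; lra.
have adm : admissible B 2 b.
  by split=> //; [rewrite (lt_trans be0)|left; split=> //; rewrite /b; lra].
have [C1 C10 HC] := maximal_risk_le B0 heta adm be0 bb.
set k := 4 * gamma + beta in h phi2 *.
have k0 : 0 < k by rewrite addr_gt0// mulr_gt0.
(* The summands k + 1 ensure x >= 1; the summand 2 C1 (6 / k) makes e^(LL / 2) = (log n)^(1/2)
   exceed the final constant C1 (6 / k). *)
apply: limn_esup_le; have := near_lnln (`|2 * (C1 * (6 / k))| + k + 1); apply: filterS => n [n0 [hM l0]].
set Lg := ln (n%:R : R) in hM l0 *; set LL := ln Lg in hM *.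
have LL1 : k + 1 <= LL by have := normr_ge0 (2 * (C1 * (6 / k))); lra.
have LL0 : 0 < LL by rewrite (lt_le_trans _ LL1)// ltr_wpDl// ltW.
have LgE : Lg = expR LL by rewrite lnK.
have LgLL : LL + 1 <= Lg by rewrite LgE addrC expR_ge1Dx.
pose x := 2 / k * Lg + k^-1 * LL.
have x1 : 1 <= x.
  rewrite /x mulrAC [k^-1 * _]mulrC -mulrDl ler_pdivlMr// mul1r; lra.
have x0 : 0 < x by rewrite (lt_le_trans ltr01).
have hE : h n = x `^ (- 2^-1) by [].
have hn0 : 0 < h n by rewrite hE powR_gt0.
have hi : (h n)^-1 ^+ 2 = x.
  by rewrite hE -powRN opprK -powR_mulrn ?powR_ge0// -powRrM mulVf ?pnatr_eq0// powRr1 ?(ltW x0).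
have hn1 : h n <= 1.
  have : 1 <= (h n)^-1 ^+ 2 by rewrite hi.
  rewrite -[leLHS](expr1n _ 2) ler_pXn2r ?nnegrE ?invr_ge0 ?ler01 ?(ltW hn0)//.
  by rewrite invf_ge1.
have nE : (n%:R : R) = expR Lg by rewrite lnK// posrE ltr0n.
have phiE : phi2 n = expR ((16 * gamma + 3 * beta) / (8 * gamma + 2 * beta) * LL - beta / k * Lg).
  rewrite /phi2 -/Lg /powR (gt_eqF l0) pnatr_eq0 (gtn_eqF n0) -/Lg -/LL -expRD; congr expR; ring.
apply: (ratio_le1 _ (HC _ _ n0 hn0 hn1)); first by rewrite phiE expR_gt0.
have -> : (2 * beta * ((h n)^-1 / 2) `^ 2) = beta * x / 2.
  by rewrite powR_mulrn ?divr_ge0 ?invr_ge0 ?(ltW hn0)// exprMn hi; field.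
rewrite hi -/gamma nE -expRN -expRD phiE.
have xb : x <= 3 / k * expR LL.
  by rewrite /x -LgE mulrAC [k^-1 * _]mulrC -mulrDl mulrAC ler_pM2r ?invr_gt0//; lra.
set e3 := expR (- (beta / k) * Lg + 2 * gamma / k * LL).
have ex1 : expR (2 * gamma * x - Lg) = e3.
  by rewrite /e3; congr expR; rewrite /x /k; field; rewrite -/k; exact: lt0r_neq0.
have ex2 : expR (- (beta * x / 2)) <= e3.
  rewrite ler_expR /x.
  have -> : - (beta * (2 / k * Lg + k^-1 * LL) / 2) = - (beta / k) * Lg - beta / (2 * k) * LL by field; exact: lt0r_neq0.
  rewrite lerD2l; apply: (@le_trans _ _ 0); first by rewrite oppr_le0 !mulr_ge0 ?invr_ge0 ?mulr_ge0// ltW.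
  by rewrite mulr_ge0 ?(ltW LL0)// divr_ge0 ?(ltW k0)// mulr_ge0 ?(ltW g0).
apply: (@le_trans _ _ (C1 * (3 / k * expR LL) * (e3 + e3))).
  have k3 : 0 <= e3 by exact: expR_ge0.
  rewrite ler_pM//.
  - by rewrite mulr_ge0 ?ltW.
  - by rewrite ler_pM2l.
  - by rewrite ex1 lerD2l.
have -> : C1 * (3 / k * expR LL) * (e3 + e3) = C1 * (6 / k) * (expR LL * e3).
  by move: (expR LL) => u; field; exact: lt0r_neq0.
rewrite /e3 -expRD.
have -> : (16 * gamma + 3 * beta) / (8 * gamma + 2 * beta) * LL - beta / k * Lg =
  LL / 2 + (LL + (- (beta / k) * Lg + 2 * gamma / k * LL)).
  rewrite /k; field; rewrite -/k; apply/andP; split; first exact: lt0r_neq0.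
  by apply: lt0r_neq0; rewrite addr_gt0// mulr_gt0.
rewrite [leRHS]expRD ler_wpM2r ?expR_ge0//.
apply: (le_trans _ (expR_ge1Dx _)).
by have := ler_norm (2 * (C1 * (6 / k))); lra.
Qed.

(** The equation for h makes the variance term e^(- (log log n)^2) times the bias term E, so the
    risk is at most 2 C1 h^-2 E. Since h^(3 r - 10) >= h^-4 for h <= 1, it remains to see that h is
    eventually small. *)
Lemma risk_case_lt2 (B r eta beta : R) : 0 < B -> 0 < r -> r < 2 -> 0 < eta < 1 -> 0 < beta < B ->
  let gamma := (1 - eta) / (4 * eta) in
  forall h : nat -> R,
    (\forall n \near \oo, 0 < h n /\
       2 `^ (1 - r) * beta / h n `^ r + 2 * gamma / h n ^+ 2
       = ln n%:R - (ln (ln n%:R)) ^+ 2) ->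
    let phi2 := fun n : nat =>
      h n `^ (3 * r - 10) * expR (- (2 `^ (1 - r) * beta / h n `^ r)) in
    (limn_esup (fun n : nat =>
       maximal_risk B r eta (h n) (h n)^-1 n * ((phi2 n)^-1)%:E) <= 1%:E)%E : Prop.
Proof.
move=> B0 r0 r2 heta /andP[be0 beB] gamma h hh phi2.
have /andP[e0 e1] := heta.
have g0 : 0 < gamma by rewrite divr_gt0 ?subr_gt0// mulr_gt0.
pose b := (beta + B) / 2.
have bb : beta < b by rewrite /b; lra.
have adm : admissible B r b.
  by split=> //; [rewrite (lt_trans be0)|right; split=> //; rewrite /b; lra].
have [C1 C10 HC] := maximal_risk_le B0 heta adm be0 bb.
(* Below this level both h <= 1 and 2 C1 h^2 <= 1 hold. *)
pose ep := Num.min 1 (2 * C1 + 1)^-1.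
have ep0 : 0 < ep by rewrite lt_min ltr01/= invr_gt0 ltr_wpDl// mulr_ge0 ?ltW.
(* The left-hand side of the equation at ep. It decreases in h, so a right-hand side above M forces
   h < ep. *)
pose M := 2 `^ (1 - r) * beta / ep `^ r + 2 * gamma / ep ^+ 2.
have p0 : 0 < 2 `^ (1 - r) * beta by rewrite mulr_gt0// powR_gt0.
(* For LL >= 54 = 2 * 27 the cubic term of (1 + LL / 3)^3 <= e^LL already gives 2 LL^2 <= log n, so
   the right-hand side of the equation is at least LL^2. *)
apply: limn_esup_le; have := near_lnln (`|M| + 54).
move: hh; apply: filterS2 => n [hn0 heq] [n0 [hM l0]].
set Lg := ln (n%:R : R) in hM l0 heq *; set LL := ln Lg in hM heq *.
have LL54 : 54 <= LL by rewrite (le_trans _ hM)// lerDr.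
have LgE : Lg = expR LL by rewrite lnK.
have Lg2 : 2 * LL ^+ 2 <= Lg.
  have -> : Lg = expR (LL / 3) ^+ 3 by rewrite LgE -expRM_natl; congr expR; field.
  have h1 : 1 + LL / 3 <= expR (LL / 3) := expR_ge1Dx _.
  have h2 : (1 + LL / 3) ^+ 3 <= expR (LL / 3) ^+ 3.
    by rewrite lerXn2r ?nnegrE ?expR_ge0//; lra.
  apply: le_trans h2.
  have -> : (1 + LL / 3) ^+ 3 = 1 + LL + LL ^+ 2 / 3 + LL ^+ 2 * (LL / 27) by field.
  have s2 := sqr_ge0 LL.
  have : 2 * LL ^+ 2 <= LL ^+ 2 * (LL / 27) by rewrite mulrC ler_wpM2l//; lra.
  by lra.
have hep : h n < ep.
  rewrite ltNge; apply/negP => hge.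
  have h1 : 2 `^ (1 - r) * beta / h n `^ r <= 2 `^ (1 - r) * beta / ep `^ r.
    rewrite ler_wpM2l ?(ltW p0)// lef_pV2 ?posrE ?powR_gt0//.
    by apply: ge0_ler_powR; rewrite ?nnegrE ?(ltW r0) ?(ltW ep0) ?(ltW hn0).
  have h2 : 2 * gamma / h n ^+ 2 <= 2 * gamma / ep ^+ 2.
    apply: ler_wpM2l; first by rewrite mulr_ge0// ltW.
    rewrite lef_pV2 ?posrE ?exprn_gt0//.
    by rewrite lerXn2r ?nnegrE ?(ltW ep0) ?(ltW hn0).
  have : Lg - LL ^+ 2 <= M by rewrite -heq /M lerD.
  have LLs : LL <= LL ^+ 2 by rewrite expr2 ler_peMl; lra.
  by have := ler_norm M; lra.
have hn1 : h n <= 1 by rewrite (le_trans (ltW hep))// ge_min lexx.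
have hC : 2 * C1 * h n ^+ 2 <= 1.
  have i1 : h n <= (2 * C1 + 1)^-1 by rewrite (le_trans (ltW hep))// ge_min lexx orbT.
  have i2 : h n * (2 * C1 + 1) <= 1 by rewrite -ler_pdivlMr ?div1r// ltr_wpDl// mulr_ge0 ?ltW.
  have i3 : 2 * C1 * h n ^+ 2 <= 2 * C1 * h n by rewrite ler_wpM2l ?mulr_ge0 ?(ltW C10)// expr2 ler_piMl// ltW.
  by lra.
set E := expR (- (2 `^ (1 - r) * beta / h n `^ r)).
have E0 : 0 < E by exact: expR_gt0.
have phi0 : 0 < phi2 n by rewrite mulr_gt0// powR_gt0.
apply: (ratio_le1 phi0 (HC _ _ n0 hn0 hn1)).
have -> : expR (- (2 * beta * ((h n)^-1 / 2) `^ r)) = E.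
  rewrite /E; congr (expR (- _)).
  rewrite powRM ?invr_ge0 ?(ltW hn0)// -powR_inv1 ?(ltW hn0)// -powRrM mulN1r powRN.
  rewrite -[2^-1]powR_inv1// -powRrM mulN1r powRD ?powRr1//; first ring.
  by rewrite implybE pnatr_eq0 orbT.
have nE : (n%:R : R) = expR Lg by rewrite lnK// posrE ltr0n.
have e2 : expR (2 * gamma * (h n)^-1 ^+ 2) / n%:R <= E.
  rewrite nE -expRN -expRD ler_expR exprVn.
  have := sqr_ge0 LL; move: heq; rewrite -/Lg -/LL; lra.
rewrite -/gamma.
apply: (@le_trans _ _ (C1 * (h n)^-1 ^+ 2 * (E + E))).
  by apply: ler_wpM2l; [rewrite mulr_ge0 ?sqr_ge0 ?(ltW C10)|rewrite lerD2r].
rewrite /phi2 -/E.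
have hp : (h n)^-1 ^+ 2 * h n ^+ 2 = 1 by rewrite -exprMn mulVf ?expr1n// gt_eqF.
have -> : C1 * (h n)^-1 ^+ 2 * (E + E) = 2 * C1 * (h n)^-1 ^+ 2 * E by ring.
rewrite ler_pM2r//.
have q1 : (h n)^-1 ^+ 4 <= h n `^ (3 * r - 10).
  have -> : (h n)^-1 ^+ 4 = h n `^ (- 4).
    by rewrite exprVn powRN powR_mulrn// ltW.
  by rewrite ger_powR ?hn0 ?hn1//; lra.
apply: le_trans q1.
have h2 : (h n)^-1 ^+ 4 = (h n)^-1 ^+ 2 * (h n)^-1 ^+ 2 by rewrite -exprD.
rewrite h2; have v0 : 0 <= (h n)^-1 ^+ 2 by exact: sqr_ge0.
move: ((h n)^-1 ^+ 2) (h n ^+ 2) hp hC v0 => v u vu Cu v0.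
have : v * (2 * C1 * u) <= v * 1 by rewrite ler_wpM2l.
have -> : v * (2 * C1 * u) = 2 * C1 * (v * u) by ring.
rewrite vu mulr1 mulr1 => k1; rewrite ler_wpM2r//.
Qed.

End MaximalRisk.

Theorem theorem4 (R : realType) (B r eta : R)
    (hB : 0 < B) (hr : 0 < r <= 2) (heta : 0 < eta < 1) :
  let gamma := (1 - eta) / (4 * eta) in
  exists C : R, 0 < C /\
  (r = 2 ->
    let beta := B / (1 + Num.sqrt B) ^+ 2 in
    let h := fun n : nat =>
      (2 / (4 * gamma + beta) * ln n%:R
       + (4 * gamma + beta)^-1 * ln (ln n%:R)) `^ (- 2^-1) in
    let phi2 := fun n : nat =>
      (ln n%:R) `^ ((16 * gamma + 3 * beta) / (8 * gamma + 2 * beta))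
      * n%:R `^ (- (beta / (4 * gamma + beta))) in
    (limn_esup (fun n : nat =>
       maximal_risk B r eta (h n) (h n)^-1 n * ((phi2 n)^-1)%:E) <= C%:E)%E)
  /\
  (r < 2 -> forall beta : R, 0 < beta < B ->
    forall h : nat -> R,
    (\forall n \near \oo, 0 < h n /\
       2 `^ (1 - r) * beta / h n `^ r + 2 * gamma / h n ^+ 2
       = ln n%:R - (ln (ln n%:R)) ^+ 2) ->
    let phi2 := fun n : nat =>
      h n `^ (3 * r - 10) * expR (- (2 `^ (1 - r) * beta / h n `^ r)) in
    (limn_esup (fun n : nat =>
       maximal_risk B r eta (h n) (h n)^-1 n * ((phi2 n)^-1)%:E) <= C%:E)%E).
Proof.
(* The constant 1 serves every beta and both cases, since the surplus in phi_n^2 has absorbed the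
   actual constants. *)
case/andP: hr => r0 r2 gamma; exists 1; split; first exact: ltr01.
split=> [->|rlt2 beta hbeta h hh]; first exact: risk_case_r2.
exact: risk_case_lt2.
Qed.
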